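(* Let $(R,\mathfrak m,K)$ be a local ring of Krull dimension $d$, and let $\mathcal M=\{M_n\}_n$ be a lim Cohen-Macaulay sequence of modules for $R$. Let ${}^{\natural}$ denote $\mathcal M$-closure with respect to either $\nu$ or rank (if rank is defined for the $M_n$). Let $x_1,\dots,x_d$ be any system of parameters for $R$ and let $I_t=(x_1^t,\dots,x_d^t)R$. Then for all $t\ge1$, $$I_t^{\natural}:(x_1\cdots x_d)^{t-1}\subseteq(x_1,\dots,x_d)^{\natural}\subseteq\mathfrak m,$$ and so $(x_1\cdots x_d)^{t-1}\notin I_t^{\natural}$. Hence: (a) If $T\to R$ is a module-finite local map from a regular local ring $T$, then $T$ is a direct summand of $R$ as a $T$-module. (b) If $R$ is regular, the $\mathcal M$-closure of every submodule $A$ of every finitely generated module $B$ is $A$, both with respect to $\nu$ and with respect to rank.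
   Context: A local ring is Noetherian. $\ell$ is length, $\nu(M)=\dim_K(K\otimes_RM)$ is the least number of generators of $M$, $H_i(\underline x;M)$ is Koszul homology. A sequence $\{M_n\}_n$ of nonzero finitely generated $R$-modules is lim Cohen-Macaulay if for some (equivalently, every) system of parameters $\underline x$ of $R$, $\ell(H_i(\underline x;M_n))=\mathrm o(\nu(M_n))$ as $n\to\infty$ for all $i\ge1$. A finitely generated $R$-module $M$ has rank $r$ if $\ell_{R_{\mathfrak p}}(M_{\mathfrak p})=r\,\ell_{R_{\mathfrak p}}(R_{\mathfrak p})$ for every minimal prime $\mathfrak p$ of $R$ with $\dim(R/\mathfrak p)=\dim R$ (for $R$ a domain this is torsion-free rank, which is always defined). Closure: let $\alpha$ be a function from the set of modules $\{M_n\}$ to the positive integers (here $\nu$ or rank). For finitely generated $R$-modules $A\subseteq B$ with $B/A$ of finite length, the $\mathcal M$-closure $A^{*\mathcal M,\alpha}_B$ of $A$ in $B$ with respect to $\alpha$ is the largest submodule $A'$ with $A\subseteq A'\subseteq B$ such that $\ell\big(\operatorname{Im}(M_n\otimes_R(A'/A)\to M_n\otimes_R(B/A))\big)=\mathrm o(\alpha(M_n))$ as $n\to\infty$. In general $A^{*\mathcal M,\alpha}_B=\bigcap_t(A+\mathfrak m^tB)^{*\mathcal M,\alpha}_B$. For an ideal $I$ of $R$, its closure means the closure in $R$.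
   Formalization: In (a) the module-finite local map T → R is assumed injective; without this the claim fails (T = k[[x]] → R = k, M_n = k), and injectivity is necessary whenever T is a direct summand of R. *)

(* Defs.v *)
From HB Require Import structures.
From mathcomp Require Import all_boot all_order all_algebra ring_quotient generic_quotient.
From mathcomp Require Import boolp classical_sets ring.

Set Implicit Arguments.
Unset Strict Implicit.
Unset Printing Implicit Defensive.

Import Order.TTheory GRing.Theory Num.Theory.
Local Open Scope ring_scope.
Local Open Scope quotient_scope.

(* Submodules are the library's [submodClosed V]; their boolean membership is
   obtained from propositions by [asbool], written `[< P >]. *)

Definition ideal (R : comNzRingType) := submodClosed R^o.

Section Span.
Variables (R : comNzRingType) (V : lmodType R) (S : set V).

Definition span : {pred V} := fun v =>
  `[< forall W : submodClosed V, (forall s, S s -> s \in W) -> v \in W >].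

Lemma span_submod : submod_closed span.
Proof.
split; first by apply/asboolP => W _; rewrite rpred0.
move=> a u v /asboolP hu /asboolP hv; apply/asboolP => W SW.
by rewrite rpredD ?rpredZ ?hu ?hv.
Qed.
HB.instance Definition _ := GRing.isSubmodClosed.Build R V span span_submod.
End Span.

Definition generated_by (R : comNzRingType) (V : lmodType R) (k : nat) :=
  exists g : 'I_k -> V, forall v, v \in span [set g i | i in [set: 'I_k]]%classic.

Definition finitely_generated (R : comNzRingType) (V : lmodType R) :=
  exists k, generated_by V k.

(* [0] by convention when [V] is not finitely generated. *)
Definition nu (R : comNzRingType) (V : lmodType R) : nat :=
  xget 0%N [set k | generated_by V k /\
                    forall j, generated_by V j -> (k <= j)%N]%classic.

Section SubmoduleOperations.
Variables (R : comNzRingType) (V W : lmodType R) (f : {linear V -> W}).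

Definition ker_pred : {pred V} := fun v => f v == 0.
Lemma ker_submod : submod_closed ker_pred.
Proof.
split; first by rewrite unfold_in linear0.
by move=> a u v; rewrite !unfold_in linearP => /eqP -> /eqP ->; rewrite scaler0 addr0.
Qed.
HB.instance Definition _ := GRing.isSubmodClosed.Build R V ker_pred ker_submod.

Definition image_pred (A : submodClosed V) : {pred W} := fun w =>
  `[< exists2 v, v \in A & f v = w >].
Lemma image_submod A : submod_closed (image_pred A).
Proof.
split; first by apply/asboolP; exists 0; rewrite ?rpred0 ?linear0.
move=> a u v /asboolP[x xA <-] /asboolP[y yA <-]; apply/asboolP.
by exists (a *: x + y); rewrite ?linearP// rpredD ?rpredZ.
Qed.
HB.instance Definition _ A :=
  GRing.isSubmodClosed.Build R W (image_pred A) (image_submod A).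

Definition preim_pred (A : submodClosed W) : {pred V} := fun v => f v \in A.
Lemma preim_submod A : submod_closed (preim_pred A).
Proof.
split=> [|a u v hu hv]; first by rewrite unfold_in linear0; exact: rpred0.
by rewrite unfold_in linearP; apply: rpredD => //; exact: rpredZ.
Qed.
HB.instance Definition _ A :=
  GRing.isSubmodClosed.Build R V (preim_pred A) (preim_submod A).

Definition cap_pred (A B : submodClosed V) : {pred V} :=
  fun v => (v \in A) && (v \in B).
Lemma cap_submod A B : submod_closed (cap_pred A B).
Proof.
split=> [|a u v /andP[uA uB] /andP[vA vB]]; apply/andP; split;
  by rewrite ?rpred0 ?rpredD ?rpredZ.
Qed.
HB.instance Definition _ A B :=
  GRing.isSubmodClosed.Build R V (cap_pred A B) (cap_submod A B).

Definition add_pred (A B : submodClosed V) : {pred V} := fun v =>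
  `[< exists a b, [/\ a \in A, b \in B & v = a + b] >].
Lemma add_submod A B : submod_closed (add_pred A B).
Proof.
split; first by apply/asboolP; exists 0, 0; rewrite !rpred0 addr0.
move=> c u v /asboolP[a [b [aA bB ->]]] /asboolP[a' [b' [aA' bB' ->]]].
apply/asboolP; exists (c *: a + a'), (c *: b + b').
by split; rewrite ?rpredD ?rpredZ// scalerDr addrACA.
Qed.
HB.instance Definition _ A B :=
  GRing.isSubmodClosed.Build R V (add_pred A B) (add_submod A B).

Definition full_pred : {pred V} := predT.
Lemma full_submod : submod_closed full_pred.
Proof. by []. Qed.
HB.instance Definition _ := GRing.isSubmodClosed.Build R V full_pred full_submod.
End SubmoduleOperations.

Definition full_submodule (R : comNzRingType) (V : lmodType R) : submodClosed V :=
  @full_pred R V.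

Section SubmoduleType.
Variables (R : comNzRingType) (V : lmodType R) (A : submodClosed V).

Record submodule := Submodule { submodule_val : V; _ : submodule_val \in A }.
HB.instance Definition _ := [isSub for submodule_val].
HB.instance Definition _ := [Choice of submodule by <:].
HB.instance Definition _ := [SubChoice_isSubLmodule of submodule by <:].

Lemma submodule_val_linear : linear submodule_val.
Proof. exact: (linearP (\val : submodule -> V)). Qed.
HB.instance Definition _ :=
  GRing.isLinear.Build R submodule V *:%R submodule_val submodule_val_linear.
End SubmoduleType.

Section QuotientModule.
Variables (R : comNzRingType) (V : lmodType R) (A : submodClosed V).

Definition zmod_of : {pred V} := A.
Lemma zmod_of_closed : zmod_closed zmod_of.
Proof.
split; first exact: (rpred0 A).
by move=> u v uA vA; rewrite -[v]scale1r -scaleNr; apply: (rpredD (S := A)); rewrite ?rpredZ.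
Qed.
HB.instance Definition _ := GRing.isZmodClosed.Build V zmod_of zmod_of_closed.

Definition quotient_module := Quotient.quot zmod_of.
HB.instance Definition _ := EqQuotient.on quotient_module.
HB.instance Definition _ := GRing.Zmodule.on quotient_module.

Definition quotient_proj (v : V) : quotient_module := \pi_quotient_module v.

Lemma quotient_projP u v : reflect (quotient_proj u = quotient_proj v) (u - v \in A).
Proof.
apply: (iffP idP) => [uvA|/eqmodP//].
by apply/eqmodP; exact: uvA.
Qed.

Lemma quotient_projB : {morph quotient_proj : u v / u - v}.
Proof. by move=> u v; exact: (raddfB (\pi_(Quotient.quot zmod_of))). Qed.
Lemma quotient_projD : {morph quotient_proj : u v / u + v}.
Proof. by move=> u v; exact: (raddfD (\pi_(Quotient.quot zmod_of))). Qed.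

Definition quotient_scale (a : R) (q : quotient_module) : quotient_module :=
  quotient_proj (a *: repr q).

Lemma quotient_reprK q : quotient_proj (repr q) = q.
Proof. exact: reprK. Qed.

Lemma quotient_scale_proj a v :
  quotient_scale a (quotient_proj v) = quotient_proj (a *: v).
Proof.
apply/quotient_projP; rewrite -scalerBr rpredZ//; apply/quotient_projP.
exact: quotient_reprK.
Qed.

Fact quotient_scaleA a b q :
  quotient_scale a (quotient_scale b q) = quotient_scale (a * b) q.
Proof. by rewrite -[q]quotient_reprK !quotient_scale_proj scalerA. Qed.
Fact quotient_scale1 : left_id 1 quotient_scale.
Proof. by move=> q; rewrite -[q]quotient_reprK !quotient_scale_proj scale1r. Qed.
Fact quotient_scaleDr : right_distributive quotient_scale +%R.
Proof.
move=> a p q; rewrite -[p]quotient_reprK -[q]quotient_reprK.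
by rewrite -quotient_projD !quotient_scale_proj scalerDr quotient_projD.
Qed.
Fact quotient_scaleDl q : {morph quotient_scale^~ q : a b / a + b}.
Proof.
move=> a b; rewrite -[q]quotient_reprK !quotient_scale_proj scalerDl.
exact: quotient_projD.
Qed.
HB.instance Definition _ := GRing.Zmodule_isLmodule.Build R quotient_module
  quotient_scaleA quotient_scale1 quotient_scaleDr quotient_scaleDl.

Lemma quotient_proj_linear : linear quotient_proj.
Proof. by move=> a u v; rewrite quotient_projD -quotient_scale_proj. Qed.
HB.instance Definition _ := GRing.isLinear.Build R V quotient_module *:%R
  quotient_proj quotient_proj_linear.
End QuotientModule.

(* Tensor products: a finite formal sum of simple tensors is the sequence of its
   terms; [tensor_eq] is the least congruence making it bilinear. Opposites need
   no separate treatment because [(- m, n)] is inverse to [(m, n)]. *)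
Section Tensor.
Variables (R : comNzRingType) (M N : lmodType R).

Inductive tensor_eq : seq (M * N) -> seq (M * N) -> Prop :=
| tensor_refl s : tensor_eq s s
| tensor_sym s t : tensor_eq s t -> tensor_eq t s
| tensor_trans s t u : tensor_eq s t -> tensor_eq t u -> tensor_eq s u
| tensor_cat s s' t t' :
    tensor_eq s s' -> tensor_eq t t' -> tensor_eq (s ++ t) (s' ++ t')
| tensor_comm s t : tensor_eq (s ++ t) (t ++ s)
| tensor_zero n : tensor_eq [:: (0, n)] [::]
| tensor_addl m m' n : tensor_eq [:: (m + m', n)] [:: (m, n); (m', n)]
| tensor_addr m n n' : tensor_eq [:: (m, n + n')] [:: (m, n); (m, n')]
| tensor_bal a m n : tensor_eq [:: (a *: m, n)] [:: (m, a *: n)].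

Definition tensor_eqb s t := `[< tensor_eq s t >].
Lemma tensor_eqb_equiv : equiv_class_of tensor_eqb.
Proof.
split=> [s|s t|t s u].
- by apply/asboolP; exact: tensor_refl.
- by apply/asboolP/asboolP => /tensor_sym.
- by move=> /asboolP st /asboolP tu; apply/asboolP; exact: tensor_trans st tu.
Qed.
Canonical tensor_equiv := EquivRelPack tensor_eqb_equiv.
Canonical tensor_encModRel := defaultEncModRel tensor_eqb.

Definition tensor := {eq_quot tensor_eqb}.
HB.instance Definition _ := EqQuotient.on tensor.
HB.instance Definition _ := Choice.on tensor.

Definition tensor_class (s : seq (M * N)) : tensor := \pi_tensor s.
Lemma tensor_classP s t : tensor_class s = tensor_class t <-> tensor_eq s t.
Proof. by split=> [/eqmodP/asboolP|st]//; apply/eqmodP/asboolP. Qed.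
Lemma tensor_reprK q : tensor_class (repr q) = q. Proof. exact: reprK. Qed.
Lemma tensor_repr s : tensor_eq (repr (tensor_class s)) s.
Proof. by apply/tensor_classP; exact: tensor_reprK. Qed.

Definition scale_terms (a : R) (s : seq (M * N)) :=
  [seq (a *: p.1, p.2) | p <- s].

Lemma scale_terms_eq a s t :
  tensor_eq s t -> tensor_eq (scale_terms a s) (scale_terms a t).
Proof.
rewrite /scale_terms; elim=> {s t}.
- by move=> s; exact: tensor_refl.
- by move=> s t _; exact: tensor_sym.
- by move=> s t u _ + _; exact: tensor_trans.
- by move=> s s' t t' _ h _ h'; rewrite !map_cat; exact: tensor_cat.
- by move=> s t; rewrite !map_cat; exact: tensor_comm.
- by move=> n /=; rewrite scaler0; exact: tensor_zero.
- by move=> m m' n /=; rewrite scalerDr; exact: tensor_addl.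
- by move=> m n n' /=; exact: tensor_addr.
- by move=> b m n /=; rewrite scalerA mulrC -scalerA; exact: tensor_bal.
Qed.

Definition tensor_add (p q : tensor) := tensor_class (repr p ++ repr q).
Definition tensor_opp (p : tensor) := tensor_class (scale_terms (- 1) (repr p)).
Definition tensor_scale a (p : tensor) := tensor_class (scale_terms a (repr p)).

Lemma tensor_add_class s t :
  tensor_add (tensor_class s) (tensor_class t) = tensor_class (s ++ t).
Proof. by apply/tensor_classP; apply: tensor_cat; exact: tensor_repr. Qed.
Lemma tensor_scale_class a s :
  tensor_scale a (tensor_class s) = tensor_class (scale_terms a s).
Proof. by apply/tensor_classP; apply: scale_terms_eq; exact: tensor_repr. Qed.

Lemma tensor_addA : associative tensor_add.
Proof.
move=> p q r; rewrite -[p]tensor_reprK -[q]tensor_reprK -[r]tensor_reprK.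
by rewrite !tensor_add_class catA.
Qed.
Lemma tensor_addC : commutative tensor_add.
Proof. by move=> p q; apply/tensor_classP; exact: tensor_comm. Qed.
Lemma tensor_add0 : left_id (tensor_class [::]) tensor_add.
Proof. by move=> p; rewrite -[p]tensor_reprK tensor_add_class. Qed.
Lemma scale_terms_cons a m n s :
  scale_terms a ((m, n) :: s) = (a *: m, n) :: scale_terms a s.
Proof. by []. Qed.

Lemma scale_termsD a b s :
  tensor_eq (scale_terms (a + b) s) (scale_terms a s ++ scale_terms b s).
Proof.
elim: s => [|[m n] s IH]; first exact: tensor_refl.
rewrite !scale_terms_cons scalerDl.
apply: (tensor_trans (t := [:: (a *: m, n); (b *: m, n)]
                           ++ (scale_terms a s ++ scale_terms b s))).
  by apply: (@tensor_cat [:: _] _ _ _) => //; exact: tensor_addl.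
have -> : ((a *: m, n) :: scale_terms a s) ++ (b *: m, n) :: scale_terms b s =
    [:: (a *: m, n)] ++ ((scale_terms a s ++ [:: (b *: m, n)]) ++ scale_terms b s).
  by rewrite -catA.
apply: (@tensor_cat [:: (a *: m, n)] _ ([:: (b *: m, n)] ++ _)).
  exact: tensor_refl.
rewrite catA; apply: tensor_cat; first exact: tensor_comm.
exact: tensor_refl.
Qed.
Lemma scale_terms0 s : tensor_eq (scale_terms 0 s) [::].
Proof.
elim: s => [|[m n] s IH]; first exact: tensor_refl.
rewrite scale_terms_cons scale0r -cat1s.
by apply: (@tensor_cat _ [::] _ [::]) => //; exact: tensor_zero.
Qed.
Lemma scale_terms1 s : scale_terms 1 s = s.
Proof. by elim: s => [//|[m n] s IH]; rewrite scale_terms_cons IH scale1r. Qed.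

Lemma tensor_addN : left_inverse (tensor_class [::]) tensor_opp tensor_add.
Proof.
move=> p; rewrite -[X in tensor_add _ X]tensor_reprK tensor_add_class.
apply/tensor_classP; apply: tensor_trans (scale_terms0 (repr p)).
by rewrite -[X in _ ++ X]scale_terms1 -(addNr 1); exact/tensor_sym/scale_termsD.
Qed.
HB.instance Definition _ := GRing.isZmodule.Build tensor
  tensor_addA tensor_addC tensor_add0 tensor_addN.

Fact tensor_scaleA a b p :
  tensor_scale a (tensor_scale b p) = tensor_scale (a * b) p.
Proof.
rewrite -[p]tensor_reprK !tensor_scale_class /scale_terms -map_comp.
by congr tensor_class; apply: eq_map => -[m n] /=; rewrite scalerA.
Qed.
Fact tensor_scale1 : left_id 1 tensor_scale.
Proof. by move=> p; rewrite -[p]tensor_reprK tensor_scale_class scale_terms1. Qed.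
Fact tensor_scaleDr : right_distributive tensor_scale +%R.
Proof.
move=> a p q; rewrite -[p]tensor_reprK -[q]tensor_reprK.
rewrite [_ + _]tensor_add_class !tensor_scale_class [RHS]tensor_add_class.
by rewrite /scale_terms map_cat.
Qed.
Fact tensor_scaleDl p : {morph tensor_scale^~ p : a b / a + b}.
Proof.
move=> a b; rewrite -[p]tensor_reprK !tensor_scale_class [RHS]tensor_add_class.
by apply/tensor_classP; exact: scale_termsD.
Qed.
HB.instance Definition _ := GRing.Zmodule_isLmodule.Build R tensor
  tensor_scaleA tensor_scale1 tensor_scaleDr tensor_scaleDl.
End Tensor.

Section TensorMap.
Variables (R : comNzRingType) (M N P : lmodType R) (f : {linear N -> P}).

Definition map_terms (s : seq (M * N)) : seq (M * P) :=
  [seq (p.1, f p.2) | p <- s].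
Lemma map_terms_eq s t :
  tensor_eq s t -> tensor_eq (map_terms s) (map_terms t).
Proof.
rewrite /map_terms; elim=> {s t}.
- by move=> s; exact: tensor_refl.
- by move=> s t _; exact: tensor_sym.
- by move=> s t u _ + _; exact: tensor_trans.
- by move=> s s' t t' _ h _ h'; rewrite !map_cat; exact: tensor_cat.
- by move=> s t; rewrite !map_cat; exact: tensor_comm.
- by move=> n /=; exact: tensor_zero.
- by move=> m m' n /=; exact: tensor_addl.
- by move=> m n n' /=; rewrite linearD; exact: tensor_addr.
- by move=> b m n /=; rewrite linearZ; exact: tensor_bal.
Qed.

Definition tensor_map (p : tensor M N) : tensor M P :=
  tensor_class (map_terms (repr p)).
Lemma tensor_map_class s :
  tensor_map (tensor_class s) = tensor_class (map_terms s).
Proof. by apply/tensor_classP; apply: map_terms_eq; exact: tensor_repr. Qed.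

Lemma tensor_map_linear : linear tensor_map.
Proof.
move=> a p q; rewrite -[p]tensor_reprK -[q]tensor_reprK.
rewrite [_ *: _]tensor_scale_class [_ + _]tensor_add_class !tensor_map_class.
rewrite [_ *: _]tensor_scale_class [_ + _]tensor_add_class.
by rewrite /map_terms /scale_terms map_cat -!map_comp.
Qed.
HB.instance Definition _ := GRing.isLinear.Build R (tensor M N) (tensor M P) *:%R
  tensor_map tensor_map_linear.
End TensorMap.
Arguments tensor_map {R} M {N P} f.

Lemma regular_scaleE (R : comNzRingType) (a b : R) : a *: (b : R^o) = a * b :> R.
Proof. by []. Qed.

Section Localization.
Variables (R : comNzRingType) (p : prime_idealr R).

Definition denom := {s : R | s \notin p}.
Lemma denom1_subproof : 1 \notin p. Proof. by rewrite idealr1. Qed.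
Definition denom1 : denom :=
  exist (fun s => s \notin p) _ denom1_subproof.
Lemma denomM_subproof (s t : denom) : sval s * sval t \notin p.
Proof. by rewrite prime_idealrM negb_or (svalP s) (svalP t). Qed.
Definition denomM (s t : denom) : denom :=
  exist (fun s => s \notin p) _ (denomM_subproof s t).

Section LocalizedModule.
Variable M : lmodType R.

(* The pair [(m, s)] is the fraction [m / s]. *)
Definition frac_eq (x y : M * denom) := `[< exists u : denom,
  (sval u * sval y.2) *: x.1 = (sval u * sval x.2) *: y.1 >].

Lemma frac_eq_equiv : equiv_class_of frac_eq.
Proof.
split=> [x|x y|y x z].
- by apply/asboolP; exists denom1.
- by apply/asboolP/asboolP => -[u e]; exists u.
- move=> /asboolP[u e] /asboolP[v e']; apply/asboolP.
  exists (denomM (denomM u v) y.2) => /=.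
  have := congr1 ( *:%R (sval u * sval x.2)) e'.
  have := congr1 ( *:%R (sval v * sval z.2)) e.
  rewrite !scalerA => e1 e2.
  have -> : sval u * sval v * sval y.2 * sval z.2 =
            sval v * sval z.2 * (sval u * sval y.2) by ring.
  rewrite e1; have -> : sval v * sval z.2 * (sval u * sval x.2) =
            sval u * sval x.2 * (sval v * sval z.2) by ring.
  by rewrite e2; congr (_ *: _); ring.
Qed.
Canonical frac_equiv := EquivRelPack frac_eq_equiv.
Canonical frac_encModRel := defaultEncModRel frac_eq.

Definition local_module := {eq_quot frac_eq}.
HB.instance Definition _ := EqQuotient.on local_module.
HB.instance Definition _ := Choice.on local_module.

Definition frac (m : M) (s : denom) : local_module := \pi_local_module (m, s).

Lemma frac_eqP m s n t : frac m s = frac n t <->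
  exists u : denom, (sval u * sval t) *: m = (sval u * sval s) *: n.
Proof. by split=> [/eqmodP/asboolP|h]//; apply/eqmodP/asboolP. Qed.
Lemma frac_ind (P : local_module -> Prop) : (forall m s, P (frac m s)) -> forall x, P x.
Proof. by move=> h x; rewrite -[x]reprK; case: (repr x) => m s; exact: h. Qed.
Lemma frac_repr m s : exists u : denom,
  (sval u * sval s) *: (repr (frac m s)).1 = (sval u * sval (repr (frac m s)).2) *: m.
Proof.
by apply/frac_eqP; rewrite /frac -surjective_pairing reprK.
Qed.

Definition local_add (x y : local_module) : local_module :=
  frac (sval (repr y).2 *: (repr x).1 + sval (repr x).2 *: (repr y).1)
       (denomM (repr x).2 (repr y).2).
Definition local_opp (x : local_module) : local_module :=
  frac (- (repr x).1) (repr x).2.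

Lemma local_add_frac m s n t :
  local_add (frac m s) (frac n t) = frac (sval t *: m + sval s *: n) (denomM s t).
Proof.
have [u] := frac_repr m s; have [v] := frac_repr n t; rewrite /local_add.
move: (repr (frac m s)) (repr (frac n t)) => [m' s'] [n' t'] /= e e'.
apply/frac_eqP; exists (denomM u v) => /=; rewrite !scalerDr !scalerA.
congr (_ + _).
- transitivity ((sval v * sval t * sval t') *: ((sval u * sval s) *: m')).
    by rewrite scalerA; congr (_ *: _); ring.
  by rewrite e' scalerA; congr (_ *: _); ring.
- transitivity ((sval u * sval s * sval s') *: ((sval v * sval t) *: n')).
    by rewrite scalerA; congr (_ *: _); ring.
  by rewrite e scalerA; congr (_ *: _); ring.
Qed.
Lemma local_opp_frac m s : local_opp (frac m s) = frac (- m) s.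
Proof.
have [u] := frac_repr m s; rewrite /local_opp.
move: (repr (frac m s)) => [m' s'] /= e.
by apply/frac_eqP; exists u; rewrite !scalerN e.
Qed.

Lemma local_addA : associative local_add.
Proof.
elim/frac_ind=> m s; elim/frac_ind=> n t; elim/frac_ind=> q r.
rewrite !local_add_frac; apply/frac_eqP; exists denom1 => /=.
by rewrite !scalerDr !scalerA !addrA; congr (_ *: _ + _ *: _ + _ *: _); ring.
Qed.
Lemma local_addC : commutative local_add.
Proof.
elim/frac_ind=> m s; elim/frac_ind=> n t.
rewrite !local_add_frac; apply/frac_eqP; exists denom1 => /=.
by rewrite addrC (mulrC (sval s)).
Qed.
Lemma local_add0 : left_id (frac 0 denom1) local_add.
Proof.
elim/frac_ind=> m s; rewrite local_add_frac; apply/frac_eqP; exists denom1 => /=.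
by rewrite scaler0 add0r scalerA; congr (_ *: _); ring.
Qed.
Lemma local_addN : left_inverse (frac 0 denom1) local_opp local_add.
Proof.
elim/frac_ind=> m s; rewrite local_opp_frac local_add_frac.
apply/frac_eqP; exists denom1 => /=.
by rewrite scalerN addNr !scaler0.
Qed.
HB.instance Definition _ := GRing.isZmodule.Build local_module
  local_addA local_addC local_add0 local_addN.
End LocalizedModule.

Definition local_ring := local_module R^o.
HB.instance Definition _ := GRing.Zmodule.on local_ring.

(* [(a / s) * (m / t) = am / st] *)
Definition local_scale (M : lmodType R) (x : local_ring) (y : local_module M) : local_module M :=
  frac ((repr x).1 *: (repr y).1) (denomM (repr x).2 (repr y).2).

Lemma local_scale_frac (M : lmodType R) (a : R^o) s (m : M) t :
  local_scale (frac a s) (frac m t) = frac (a *: m) (denomM s t).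
Proof.
have [u] := frac_repr a s; have [v] := frac_repr m t; rewrite /local_scale.
move: (repr (frac a s)) (repr (frac m t)) => [a' s'] [m' t'] /= e e'.
apply/frac_eqP; exists (denomM u v) => /=; rewrite !scalerA.
transitivity ((sval u * sval s * a') *: ((sval v * sval t) *: m')).
  by rewrite scalerA; congr (_ *: _); ring.
by rewrite e [sval u * sval s * a']e' scalerA; congr (_ *: _); rewrite ?regular_scaleE; ring.
Qed.

Definition local_one : local_ring := frac (1 : R^o) denom1.
Definition local_mul (x y : local_ring) : local_ring := local_scale x y.

Lemma local_scaleA (M : lmodType R) (x y : local_ring) (z : local_module M) :
  local_scale x (local_scale y z) = local_scale (local_mul x y) z.
Proof.
elim/frac_ind: x => a s; elim/frac_ind: y => b t; elim/frac_ind: z => m r.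
rewrite /local_mul (local_scale_frac a s b t) (local_scale_frac b t m r).
rewrite (local_scale_frac a s (b *: m)) (local_scale_frac (a *: b) _ m).
apply/frac_eqP; exists denom1 => /=; rewrite !scalerA; congr (_ *: _).
by rewrite regular_scaleE; ring.
Qed.
Lemma local_scale1 (M : lmodType R) : left_id local_one (@local_scale M).
Proof.
elim/frac_ind=> m t; rewrite local_scale_frac; apply/frac_eqP; exists denom1.
by rewrite /= scalerA; congr (_ *: _); ring.
Qed.
Lemma local_scaleDr (M : lmodType R) : right_distributive (@local_scale M) +%R.
Proof.
elim/frac_ind=> a s; elim/frac_ind=> m t; elim/frac_ind=> n r.
rewrite [_ + _]local_add_frac (local_scale_frac a s m) (local_scale_frac a s n).
rewrite local_scale_frac [RHS]local_add_frac; apply/frac_eqP; exists denom1 => /=.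
by rewrite !scalerDr !scalerA; congr (_ *: _ + _ *: _); ring.
Qed.
Lemma local_scaleDl (M : lmodType R) (z : local_module M) :
  {morph (@local_scale M)^~ z : x y / x + y}.
Proof.
elim/frac_ind=> a s; elim/frac_ind=> b t; elim/frac_ind: z => m r.
rewrite [_ + _]local_add_frac (local_scale_frac a s m) (local_scale_frac b t m).
rewrite local_scale_frac [RHS]local_add_frac; apply/frac_eqP; exists denom1 => /=.
rewrite scalerDl !scalerDr !scalerA !regular_scaleE.
by congr (_ *: _ + _ *: _); ring.
Qed.
Lemma local_mulC : commutative local_mul.
Proof.
elim/frac_ind=> a s; elim/frac_ind=> b t; rewrite /local_mul.
rewrite (local_scale_frac a s b) (local_scale_frac b t a).
apply/frac_eqP; exists denom1; rewrite /= !regular_scaleE.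
by congr (_ *: _); ring.
Qed.
Lemma local_mulA : associative local_mul.
Proof. by move=> x y z; exact: local_scaleA. Qed.
Lemma local_mul1 : left_id local_one local_mul.
Proof. exact: local_scale1. Qed.
Lemma local_mulDl : left_distributive local_mul +%R.
Proof. by move=> x y z; exact: local_scaleDl. Qed.
Lemma local_one_neq0 : local_one != 0.
Proof.
apply/eqP => /frac_eqP[u] /=; rewrite scaler0 => /eqP.
rewrite /GRing.scale /= !mulr1 => /eqP u0.
by have := svalP u; rewrite u0 idealr0.
Qed.
HB.instance Definition _ := GRing.Zmodule_isComNzRing.Build local_ring
  local_mulA local_mulC local_mul1 local_mulDl local_one_neq0.
HB.instance Definition _ (M : lmodType R) := GRing.Zmodule_isLmodule.Build local_ring
  (local_module M) (@local_scaleA M) (@local_scale1 M) (@local_scaleDr M)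
  (@local_scaleDl M).
End Localization.

Section ChainLength.
Variables (T : Type) (F : {pred T} -> Prop).

Definition strict_chain (l : nat) := exists c : nat -> {pred T},
  (forall i, (i <= l)%N -> F (c i)) /\
  (forall i, (i < l)%N -> {subset c i <= c i.+1} /\ ~ {subset c i.+1 <= c i}).
Definition longest_chain (l : nat) :=
  strict_chain l /\ forall k, strict_chain k -> (k <= l)%N.
End ChainLength.

(* The length is the supremum of the lengths of strict chains of submodules; as a
   relation with values in [nat], it also asserts that this is finite. *)
Definition has_length (R : comNzRingType) (V : lmodType R) (l : nat) :=
  longest_chain (fun S : {pred V} => submod_closed S) l.

Definition krull_dim (R : comNzRingType) (d : nat) :=
  longest_chain (fun P : {pred R} => idealr_closed P /\ prime_idealr_closed P) d.

Definition ideal_gen (R : comNzRingType) (k : nat) (x : 'I_k -> R) : ideal R :=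
  span [set (x i : R^o) | i in [set: 'I_k]]%classic.

Definition noetherian (R : comNzRingType) := forall I : ideal R,
  exists k (x : 'I_k -> R), I =i ideal_gen x.

Definition maximal_ideal (R : comNzRingType) (m : ideal R) := 1 \notin m /\
  forall J : ideal R, 1 \notin J -> {subset m <= J} -> {subset J <= m}.

Definition local_noetherian (R : comNzRingType) (m : ideal R) :=
  [/\ noetherian R, maximal_ideal m &
      forall J : ideal R, maximal_ideal J -> J =i m].

Definition regular_local (R : comNzRingType) (m : ideal R) :=
  local_noetherian m /\ krull_dim R (nu (submodule m)).

(* [d] is meant to be the Krull dimension of the local ring [(R, m)]. *)
Definition sop (R : comNzRingType) (m : ideal R) (d : nat) (x : 'I_d -> R) :=
  (forall i, x i \in m) /\
  forall a : R, a \in m -> exists k, a ^+ k \in ideal_gen x.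

(* The Koszul complex [K_i] has basis [e_S] for [S] a subset of ['I_d] with [i]
   elements; an element of the total complex is the family of its coordinates.
   From [d e_S = \sum_(j in S) (-1)^#{k in S | k < j} x_j e_(S - j)], the
   [S]-coordinate of [d f] collects the [S + j] with [j] outside [S]. *)
Section Koszul.
Variables (R : comNzRingType) (M : lmodType R) (d : nat) (x : 'I_d -> R).

Definition koszul := {ffun {set 'I_d} -> M}.
HB.instance Definition _ := GRing.Lmodule.on koszul.

Definition koszul_d (f : koszul) : koszul := [ffun S : {set 'I_d} =>
  \sum_(j < d | j \notin S)
     ((-1) ^+ #|[set k in S | (k < j)%N]| * x j) *: f (j |: S)].
Lemma koszul_d_linear : linear koszul_d.
Proof.
move=> a f g; apply/ffunP => S; rewrite !ffunE scaler_sumr -big_split /=.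
apply: eq_bigr => j _; rewrite !ffunE scalerDr !scalerA.
by congr (_ *: _ + _); ring.
Qed.
HB.instance Definition _ :=
  GRing.isLinear.Build R koszul koszul *:%R koszul_d koszul_d_linear.

Definition koszul_deg (i : nat) : {pred koszul} :=
  fun f => [forall S : {set 'I_d}, (#|S| != i) ==> (f S == 0)].
Lemma koszul_deg_submod i : submod_closed (koszul_deg i).
Proof.
split; first by apply/forallP => S; rewrite ffunE eqxx implybT.
move=> a f g /forallP hf /forallP hg; apply/forallP => S; apply/implyP => Si.
rewrite !ffunE; have /implyP/(_ Si)/eqP -> := hf S.
by have /implyP/(_ Si)/eqP -> := hg S; rewrite scaler0 addr0.
Qed.
HB.instance Definition _ i :=
  GRing.isSubmodClosed.Build R koszul (koszul_deg i) (koszul_deg_submod i).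

Definition koszul_cycles (i : nat) : submodClosed koszul :=
  cap_pred (koszul_deg i) (ker_pred koszul_d).
Definition koszul_boundaries (i : nat) : submodClosed koszul :=
  image_pred koszul_d (koszul_deg i.+1).
Definition koszul_homology (i : nat) : lmodType R :=
  quotient_module (preim_pred (@submodule_val R koszul (koszul_cycles i))
                              (koszul_boundaries i)).
End Koszul.

(* The lengths of the [N n] are finite and [o(alpha n)]. *)
Definition length_little_o (R : comNzRingType) (N : nat -> lmodType R)
    (alpha : nat -> nat) := exists l : nat -> nat,
  (forall n, has_length (N n) (l n)) /\
  forall eps : rat, 0 < eps ->
    exists n0, forall n, (n0 <= n)%N -> (l n)%:R <= eps * (alpha n)%:R.

Definition lim_CM (R : comNzRingType) (m : ideal R) (d : nat)
    (M : nat -> lmodType R) :=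
  (forall n, finitely_generated (M n) /\ exists v : M n, v != 0) /\
  exists x : 'I_d -> R, sop m x /\
    forall i, (0 < i)%N ->
      length_little_o (fun n => koszul_homology (M n) x i) (fun n => nu (M n)).

Definition minimal_prime (R : comNzRingType) (p : prime_idealr R) :=
  forall q : prime_idealr R, {subset q <= p} -> {subset p <= q}.

Definition has_rank (R : comNzRingType) (V : lmodType R) (r : nat) :=
  forall (d : nat) (p : prime_idealr R), krull_dim R d -> minimal_prime p ->
    krull_dim {ideal_quot p} d ->
    exists l, has_length (local_ring p)^o l /\
              has_length (local_module p V : lmodType (local_ring p)) (r * l)%N.

Definition rank_defined (R : comNzRingType) (V : lmodType R) :=
  exists r, has_rank V r.

(* [0] by convention when the rank is not defined. *)
Definition rank (R : comNzRingType) (V : lmodType R) : nat :=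
  xget 0%N [set r | has_rank V r]%classic.

Section Closure.
Variables (R : comNzRingType) (m : ideal R) (M : nat -> lmodType R).
Variables (alpha : nat -> nat) (B : lmodType R).

(* [A' / A] for [A <= A'], inside [B / A] *)
Definition sub_quotient (A A' : submodClosed B) : submodClosed (quotient_module A) :=
  image_pred (@quotient_proj R B A) A'.

Definition tensor_image (A A' : submodClosed B) (n : nat) :
    submodClosed (tensor (M n) (quotient_module A)) :=
  image_pred (tensor_map (M n) (@submodule_val R _ (sub_quotient A A')))
             (full_submodule _).

Definition admissible (A A' : submodClosed B) := {subset A <= A'} /\
  length_little_o (fun n => submodule (tensor_image A A' n)) alpha.

(* Meant for [B / A] of finite length; would there be no largest admissible
   submodule, this would be all of [B]. *)
Definition M_closure_fl (A : submodClosed B) : {pred B} := fun b =>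
  `[< forall C : submodClosed B, admissible A C ->
        (forall A' : submodClosed B, admissible A A' -> {subset A' <= C}) ->
        b \in C >].

Definition ideal_power (t : nat) : ideal R :=
  span [set (\prod_(i < t) a i : R^o) |
        a in [set a : 'I_t -> R | forall i, a i \in m]]%classic.

Definition ideal_mul (I : ideal R) : submodClosed B :=
  span [set v : B | exists a b, a \in I /\ v = (a : R) *: b]%classic.

(* When [B / A] has finite length, [m^t B <= A] for large [t], so that this
   agrees with [M_closure_fl A]. *)
Definition M_closure (A : submodClosed B) : {pred B} := fun b =>
  `[< forall t, b \in M_closure_fl (add_pred A (ideal_mul (ideal_power t))) >].
End Closure.

Definition ideal_M_closure (R : comNzRingType) (m : ideal R) (M : nat -> lmodType R)
    (alpha : nat -> nat) (I : ideal R) : {pred R} :=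
  @M_closure R m M alpha R^o I.

Section Restriction.
Variables (T R : comNzRingType).

Definition restrict (f : {rmorphism T -> R}) : Type := R.

Variable f : {rmorphism T -> R}.
HB.instance Definition _ := GRing.Zmodule.on (restrict f).

Definition restrict_scale (a : T) (r : restrict f) : restrict f := f a * (r : R).
Fact restrict_scaleA a b r :
  restrict_scale a (restrict_scale b r) = restrict_scale (a * b) r.
Proof. by rewrite /restrict_scale rmorphM mulrA. Qed.
Fact restrict_scale1 : left_id 1 restrict_scale.
Proof. by move=> r; rewrite /restrict_scale rmorph1 mul1r. Qed.
Fact restrict_scaleDr : right_distributive restrict_scale +%R.
Proof. by move=> a r s; exact: mulrDr. Qed.
Fact restrict_scaleDl r : {morph restrict_scale^~ r : a b / a + b}.
Proof. by move=> a b; rewrite /restrict_scale rmorphD mulrDl. Qed.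
HB.instance Definition _ := GRing.Zmodule_isLmodule.Build T (restrict f)
  restrict_scaleA restrict_scale1 restrict_scaleDr restrict_scaleDl.

Definition restrict_map (a : T^o) : restrict f := f a.
Lemma restrict_map_linear : linear restrict_map.
Proof. by move=> a b c; rewrite /restrict_map rmorphD regular_scaleE rmorphM. Qed.
HB.instance Definition _ := GRing.isLinear.Build T T^o (restrict f) *:%R
  restrict_map restrict_map_linear.
End Restriction.

Definition direct_summand_along (R : comNzRingType) (V W : lmodType R)
    (i : {linear V -> W}) := injective i /\
  exists N : submodClosed W,
    (forall w, exists v n, n \in N /\ w = i v + n) /\
    (forall v, i v \in N -> i v = 0).

(* Main.v *)
(* Let [h] be the length of [H_1] of the Koszul complex of a system of parameters [x] on
   [M]. The kernel of multiplication by [x_1] from [M / (x_1^a, x')M] to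
   [M / (x_1^(a+1), x')M] is a quotient of [H_1(x_1, x'; M)], and [H_1] of a sequence of
   powers is bounded by the product of the exponents times [h]. Comparing through the
   Koszul complex on both sequences shows that [h = o(nu(M_n))] for every system of
   parameters, also for those with fewer than [d] elements generating an m-primary ideal.
   Multiplying by [x_i] step by step then gives the first inclusion, and
   [nu(M) <= length (M / xM)] gives [(x)^closure <= m].

   For (a) and (b) let [x] generate the maximal ideal of a regular ring [T], let [f : T -> R]
   be a finite map or the identity, and let [L] be a [T]-module of finite length with a
   socle element [b]. Counting composition factors, [u |-> u (x) b] from [M] to
   [M (x)_T L] has an image of length at least [nu(M) - C h]. If [b] is not in a submodule
   [A], enlarging [A] to a submodule maximal among those avoiding [b] reduces to this
   situation. In (a) the obstruction to solving the linear system that defines a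
   retraction of [T -> R] is such a [b], and [u (x) b = 0] for all [u] because the system is
   solvable in [R].

   Closures with respect to rank are compared with those for [nu] through
   [rank M <= nu(M) <= C rank M + d h]. For the second inequality take a prime filtration of
   [M]: factors [R/p] with [dim R/p < d] contribute [O(t^(d-1))] to the length of
   [M / (x_1^t, .., x_d^t)M], the number of the others is at most a constant times the
   rank, and that length is at least [t^d (length (M / xM) - d h)]. *)

Require Import Defs.
From HB Require Import structures.
From mathcomp Require Import all_boot all_order all_algebra ring_quotient generic_quotient.
From mathcomp Require Import boolp classical_sets ring lra zify.

Set Implicit Arguments.
Unset Strict Implicit.
Unset Printing Implicit Defensive.
Import Order.TTheory GRing.Theory Num.Theory.
Local Open Scope ring_scope.

(** * Lengths of subquotients *)

(** Lengths of quotients are bounded without forming the quotients, by chains in an interval of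
    submodules; exact sequences then turn into the two transport lemmas [lenle_inj] and
    [lenle_surj]. Upper bounds [lenle] are the default, while an actual length [len] appears where
    lengths must be subtracted, and then finiteness has to be carried along. Closures are handled
    one element at a time. When B / A has finite length, b lies in the closure exactly if the image
    of u |-> u (x) b has length o(alpha) ([tsmall]); this image is M modulo a kernel, and for an
    ideal I in place of A that kernel is IM : b. Hence the estimates are about colons of submodules
    of M and use only H_1. Higher Koszul homology serves to replace the given parameters by other
    ones. Sequences shorter than d must be allowed there because going up yields dim T <= dim R for
    the ring T of (a). All that is used of alpha is that alpha <= nu and that o(nu) implies
    o(alpha); this treats nu and rank together. *)

Lemma scaler_comm (R : comNzRingType) (V : lmodType R) (a b : R) (v : V) :
  a *: (b *: v) = b *: (a *: v).
Proof. by rewrite !scalerA mulrC. Qed.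

Section Submodules.
Variables (R : comNzRingType) (V : lmodType R).
Implicit Types (A B P Q S : submodClosed V) (v b : V) (x : R).

Lemma submodN A v : v \in A -> - v \in A.
Proof. by move=> vA; rewrite -scaleN1r rpredZ. Qed.

Lemma submodB A u v : u \in A -> v \in A -> u - v \in A.
Proof. by move=> uA vA; rewrite rpredD ?submodN. Qed.

Lemma submod_subK A u v : u - v \in A -> v \in A -> u \in A.
Proof. by move=> h hv; rewrite -(subrK v u) rpredD. Qed.

Lemma submod_sum A (I : Type) (r : seq I) (F : I -> V) :
  (forall i, F i \in A) -> \sum_(i <- r) F i \in A.
Proof.
move=> h; elim/big_rec: _ => [|i y _ hy]; first exact: rpred0.
exact: rpredD.
Qed.

Definition of_closed (P : {pred V}) (h : submod_closed P) : {pred V} := P.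
HB.instance Definition _ (P : {pred V}) (h : submod_closed P) :=
  GRing.isSubmodClosed.Build R V (of_closed h) h.

Definition zero_submod_pred : {pred V} := fun v => v == 0.
Lemma zero_submod_closed : submod_closed zero_submod_pred.
Proof.
split; first exact: eqxx.
by move=> a u v; rewrite !unfold_in => /eqP -> /eqP ->; rewrite scaler0 addr0.
Qed.
Definition zero_submod : submodClosed V := of_closed zero_submod_closed.

Lemma mem_zero v : (v \in zero_submod) = (v == 0).
Proof. by []. Qed.

Lemma zero_sub A : {subset zero_submod <= A}.
Proof. by move=> v; rewrite mem_zero => /eqP ->; exact: rpred0. Qed.

Lemma sub_full A : {subset A <= full_submodule V}. Proof. by []. Qed.

Definition addm A B : submodClosed V := add_pred A B.
Definition capm A B : submodClosed V := cap_pred A B.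

Lemma addmP A B v : reflect (exists (a b : V), [/\ a \in A, b \in B & v = a + b])
  (v \in addm A B).
Proof. exact: asboolP. Qed.

Lemma capmP A B v : reflect (v \in A /\ v \in B) (v \in capm A B).
Proof. exact: andP. Qed.

Lemma sub_addl A B : {subset A <= addm A B}.
Proof. by move=> v vA; apply/addmP; exists v, 0; rewrite rpred0 addr0. Qed.
Lemma sub_addr A B : {subset B <= addm A B}.
Proof. by move=> v vA; apply/addmP; exists 0, v; rewrite rpred0 add0r. Qed.
Lemma add_sub A B P : {subset A <= P} -> {subset B <= P} -> {subset addm A B <= P}.
Proof. by move=> h h' v /addmP[a [b [/h ? /h' ? ->]]]; apply: rpredD. Qed.

(** [adj P b] is P + R b; similarly [addx P x] below is P + x V. *)
Definition adj_pred P b : {pred V} := fun v => `[< exists a, v - a *: b \in P >].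
Lemma adj_closed P b : submod_closed (adj_pred P b).
Proof.
split; first by apply/asboolP; exists 0; rewrite scale0r subr0 rpred0.
move=> c u v /asboolP[x hx] /asboolP[y hy]; apply/asboolP; exists (c * x + y).
by rewrite scalerDl -scalerA opprD addrACA -scalerBr rpredD ?rpredZ.
Qed.
Definition adj P b : submodClosed V := of_closed (adj_closed P b).

Lemma adjP P b v : reflect (exists a, v - a *: b \in P) (v \in adj P b).
Proof. exact: asboolP. Qed.
Lemma mem_adj P b : b \in adj P b.
Proof. by apply/adjP; exists 1; rewrite scale1r subrr rpred0. Qed.
Lemma sub_adj P b : {subset P <= adj P b}.
Proof. by move=> v vP; apply/adjP; exists 0; rewrite scale0r subr0. Qed.
Lemma adj_sub P b Q : {subset P <= Q} -> b \in Q -> {subset adj P b <= Q}.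
Proof. by move=> h bQ v /adjP[a /h /submod_subK]; apply; rewrite rpredZ. Qed.

Definition addx_pred P x : {pred V} := fun v => `[< exists w, v - x *: w \in P >].
Lemma addx_closed P x : submod_closed (addx_pred P x).
Proof.
split; first by apply/asboolP; exists 0; rewrite scaler0 subr0 rpred0.
move=> c u v /asboolP[w hw] /asboolP[w' hw']; apply/asboolP; exists (c *: w + w').
by rewrite scalerDr scaler_comm opprD addrACA -scalerBr rpredD ?rpredZ.
Qed.
Definition addx P x : submodClosed V := of_closed (addx_closed P x).

Lemma addxP P x v : reflect (exists w, v - x *: w \in P) (v \in addx P x).
Proof. exact: asboolP. Qed.
Lemma mem_addx P x v : x *: v \in addx P x.
Proof. by apply/addxP; exists v; rewrite subrr rpred0. Qed.
Lemma sub_addx P x : {subset P <= addx P x}.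
Proof. by move=> v vP; apply/addxP; exists 0; rewrite scaler0 subr0. Qed.
Lemma addx_sub P x Q : {subset P <= Q} -> (forall v, x *: v \in Q) -> {subset addx P x <= Q}.
Proof. by move=> h h' v /addxP[w /h /submod_subK]; apply; exact: h'. Qed.

Definition colon_pred P x : {pred V} := fun v => x *: v \in P.
Lemma colon_closed P x : submod_closed (colon_pred P x).
Proof.
split; first by rewrite unfold_in scaler0 rpred0.
move=> c u v hu hv; rewrite unfold_in scalerDr scaler_comm.
by apply: rpredD => //; exact: rpredZ.
Qed.
Definition colon P x : submodClosed V := of_closed (colon_closed P x).
Lemma mem_colon P x v : (v \in colon P x) = (x *: v \in P). Proof. by []. Qed.
Lemma sub_colon P x : {subset P <= colon P x}.
Proof. by move=> v vP; rewrite mem_colon rpredZ. Qed.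

(** This is P + (l) V. Keeping a base P allows elements of l to be absorbed into it, so that an
    induction over l can treat one element modulo the others. *)
Fixpoint idlb P (l : seq R) : submodClosed V :=
  if l is x :: l' then addx (idlb P l') x else P.

Lemma sub_idlb P (l : seq R) : {subset P <= idlb P l}.
Proof. by elim: l => //= x l IH v /IH; exact: sub_addx. Qed.

Lemma mem_idlb P (l : seq R) x v : x \in l -> x *: v \in idlb P l.
Proof.
elim: l => //= y l IH; rewrite inE => /orP[/eqP ->|/IH h]; first exact: mem_addx.
exact: sub_addx.
Qed.

Lemma idlb_sub P (l : seq R) Q : {subset P <= Q} -> (forall x v, x \in l -> x *: v \in Q) ->
  {subset idlb P l <= Q}.
Proof.
move=> PQ; elim: l => [|y l IH] h //=.
apply: addx_sub => [|v]; last by apply: h; rewrite mem_head.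
by apply: IH => x v xl; apply: h; rewrite inE xl orbT.
Qed.

Lemma idl_sub (l : seq R) Q : (forall x v, x \in l -> x *: v \in Q) ->
  {subset idlb zero_submod l <= Q}.
Proof. by apply: idlb_sub; exact: zero_sub. Qed.

Lemma idlb_mono P Q l : {subset P <= Q} -> {subset idlb P l <= idlb Q l}.
Proof. by move=> PQ; apply: idlb_sub => [v /PQ|x v]; [exact: sub_idlb|exact: mem_idlb]. Qed.

(* The top of the chain need only be contained in the second argument. *)
Inductive chain P : submodClosed V -> nat -> Prop :=
| chain0 Q : {subset P <= Q} -> chain P Q 0
| chainS Q Q' k : chain P Q k -> {subset Q <= Q'} -> ~ {subset Q' <= Q} -> chain P Q' k.+1.

Lemma chain_sub P Q k : chain P Q k -> {subset P <= Q}.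
Proof. by elim=> // {}Q Q' {}k _ h h' _ v /h /h'. Qed.

Lemma chain_mono P Q Q' k : chain P Q k -> {subset Q <= Q'} -> chain P Q' k.
Proof.
case=> [{}Q h h'|Q1 {}Q {}k c h nh h']; first by apply: chain0 => v /h /h'.
by apply: (chainS c) => [v /h /h'|h2] //; apply: nh => v /h' /h2.
Qed.

Lemma chain_cat P Q S j k : chain P Q j -> chain Q S k -> chain P S (j + k)%N.
Proof.
move=> c; elim=> [{}S h|{}S S' {}k _ IH h nh]; first by rewrite addn0; exact: chain_mono h.
by rewrite addnS; exact: chainS IH h nh.
Qed.

(** For P contained in Q: Q / P has length at most n. Chains from P end inside Q only if P is
    contained in Q, so the condition is vacuous otherwise. *)
Definition lenle P Q n := forall k, chain P Q k -> (k <= n)%N.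
Definition finite_length P Q := exists n, lenle P Q n.
(* [0] when [Q / P] has infinite length. *)
Definition len P Q : nat :=
  xget 0%N [set n | chain P Q n /\ lenle P Q n]%classic.

Lemma lenle_fin P Q n : lenle P Q n -> finite_length P Q. Proof. by exists n. Qed.
Lemma lenle_leq P Q m n : (m <= n)%N -> lenle P Q m -> lenle P Q n.
Proof. by move=> mn h k /h/leq_trans; apply. Qed.

Lemma lenP P Q : {subset P <= Q} -> finite_length P Q -> chain P Q (len P Q) /\ lenle P Q (len P Q).
Proof.
move=> PQ [n hn].
suff [k hk] : exists k, chain P Q k /\ lenle P Q k.
  exact: (@xgetPex _ 0%N [set n | chain P Q n /\ lenle P Q n]%classic (ex_intro _ k hk)).
have ex : exists k, `[< chain P Q k >] by exists 0%N; apply/asboolP; exact: chain0.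
have ub k : `[< chain P Q k >] -> (k <= n)%N by move/asboolP/hn.
case: (ex_maxnP ex ub) => k /asboolP ck hk; exists k; split=> // j cj.
by apply: hk; apply/asboolP.
Qed.

Lemma len_lenle P Q : finite_length P Q -> lenle P Q (len P Q).
Proof.
move=> f k c; exact: (lenP (chain_sub c) f).2.
Qed.

Lemma len_leq P Q n : lenle P Q n -> (len P Q <= n)%N.
Proof.
rewrite /len; case: xgetP => [k -> [c _] h|//]; exact: h.
Qed.

Lemma lenle_mono P P' Q Q' n : {subset P <= P'} -> {subset P' <= Q'} -> {subset Q' <= Q} ->
  lenle P Q n -> lenle P' Q' n.
Proof.
move=> h1 h2 h3 h k c; apply: h; have c0 : chain P P' 0 by exact: chain0.
by have := chain_cat c0 c => /chain_mono; rewrite add0n; apply.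
Qed.

Lemma lenle_trans P Q S m n : {subset P <= Q} -> {subset Q <= S} ->
  lenle P Q m -> lenle Q S n -> lenle P S (m + n).
Proof.
move=> PQ QS hm hn k c.
suff [k1 [k2 [c1 c2 kk]]] : exists k1 k2,
    [/\ chain P (capm S Q) k1, chain Q (addm S Q) k2 & (k <= k1 + k2)%N].
  apply: leq_trans kk (leq_add _ _); first by apply/hm/(chain_mono c1) => v /capmP[].
  by apply/hn/(chain_mono c2)/add_sub.
(* By the modular law a strict step [S < S'] is strict after intersecting with
   [Q] or after adding [Q]. *)
elim: c {QS hn} => [{}S PS|{}S S' {}k _ [k1 [k2 [c1 c2 kk]]] h nh].
  exists 0%N, 0%N; split=> //; apply: chain0 => v vP.
    by apply/capmP; split; [exact: PS|exact: PQ].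
  exact: (@sub_addr S Q).
have sI : {subset capm S Q <= capm S' Q}.
  by move=> v /capmP[/h vS vQ]; apply/capmP.
have sU : {subset addm S Q <= addm S' Q}.
  by apply: add_sub => v hv; [apply/sub_addl/h|apply/sub_addr].
case: (pselect {subset capm S' Q <= capm S Q}) => [hI|hI]; last first.
  by exists k1.+1, k2; split; [exact: chainS c1 sI hI|exact: chain_mono c2 sU|].
exists k1, k2.+1; split; last by rewrite addnS.
  exact: chain_mono c1 sI.
apply: chainS c2 sU _ => hU; apply: nh => v vS'.
have /addmP[s [q [sS qQ def_v]]] := hU _ (sub_addl Q vS').
have /capmP[qS _] : q \in capm S Q.
  apply/hI/capmP; split=> //; rewrite -[q](addKr s) -def_v.
  by apply: rpredD => //; exact/submodN/h.
by rewrite def_v rpredD.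
Qed.

Lemma fin_mono P P' Q Q' : {subset P <= P'} -> {subset P' <= Q'} -> {subset Q' <= Q} ->
  finite_length P Q -> finite_length P' Q'.
Proof. by move=> h1 h2 h3 [n hn]; exists n; exact: lenle_mono hn. Qed.

Lemma lenD P Q S : {subset P <= Q} -> {subset Q <= S} -> finite_length P S ->
  len P S = (len P Q + len Q S)%N.
Proof.
move=> PQ QS f.
have fPQ : finite_length P Q by apply: fin_mono f.
have fQS : finite_length Q S by apply: fin_mono f.
have [cPQ hPQ] := lenP PQ fPQ; have [cQS hQS] := lenP QS fQS.
apply/eqP; rewrite eqn_leq; apply/andP; split.
  by apply: len_leq; exact: lenle_trans hPQ hQS.
exact: len_lenle (chain_cat cPQ cQS).
Qed.

Lemma lenle_refl P Q : {subset Q <= P} -> lenle P Q 0.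
Proof.
move=> QP k c; case: c QP => // Q1 {}Q {}k c h nh QP.
by case: nh => v /QP; exact: chain_sub c v.
Qed.

Lemma len_monor P Q Q' : {subset P <= Q} -> {subset Q <= Q'} -> finite_length P Q' ->
  (len P Q <= len P Q')%N.
Proof. by move=> h h' f; rewrite (lenD h h' f) leq_addr. Qed.

Lemma len_monol P P' Q : {subset P <= P'} -> {subset P' <= Q} -> finite_length P Q ->
  (len P' Q <= len P Q)%N.
Proof. by move=> h h' f; rewrite (lenD h h' f) leq_addl. Qed.
Lemma chain_extl P (P' : submodClosed V) Q k : P =i P' -> chain P Q k -> chain P' Q k.
Proof.
move=> e c; have : chain P' P 0 by apply: chain0 => v; rewrite e.
by move/chain_cat => /(_ _ _ c).
Qed.

Lemma len_extl P (P' : submodClosed V) Q : P =i P' -> len P Q = len P' Q.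
Proof.
move=> e; have e' k : chain P Q k <-> chain P' Q k.
  by split; apply: chain_extl => v; rewrite e.
rewrite /len; congr xget; apply/seteqP; split=> k /= [c h].
  by split=> [|j /e' /h]; first exact/e'.
by split=> [|j /e' /h]; first exact/e'.
Qed.

Lemma lenle_eq P (P' : submodClosed V) Q n : P =i P' -> lenle P Q n -> lenle P' Q n.
Proof. by move=> e h k c; apply: h; apply: chain_extl c => v; rewrite e. Qed.
End Submodules.

Notation idl V := (idlb (zero_submod V)).

Section LengthMaps.
Variables (R : comNzRingType) (V W : lmodType R) (f : {linear V -> W}).
Implicit Types (P Q : submodClosed V).

Definition imagem P : submodClosed W := image_pred f P.
Definition preimm (A : submodClosed W) : submodClosed V := preim_pred f A.

Lemma imagemP P w : reflect (exists2 v, v \in P & f v = w) (w \in imagem P).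
Proof. exact: asboolP. Qed.
Lemma mem_imagem P v : v \in P -> f v \in imagem P.
Proof. by move=> vP; apply/imagemP; exists v. Qed.
Lemma mem_preim (P' : submodClosed W) v : (v \in preimm P') = (f v \in P'). Proof. by []. Qed.

(** [f] induces an injection of Q / P into Q' / P'. A chain above P is sent to its images plus P',
    and a step that collapsed there would already be trivial in V. *)
Lemma lenle_inj P Q (P' Q' : submodClosed W) n :
  {subset P' <= Q'} -> (forall v, v \in Q -> f v \in Q') ->
  (forall v, v \in Q -> f v \in P' -> v \in P) ->
  lenle P' Q' n -> lenle P Q n.
Proof.
move=> P'Q' fQ fP h k c; apply: h; have := chain_sub c => PQ.
suff : chain P' (addm (imagem Q) P') k.
  by move=> /chain_mono; apply; apply: add_sub => // w /imagemP[v /fQ ? <-].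
elim: c {fQ} fP {PQ} => [{}Q _ _|{}Q Q1 {}k c IH h nh fP].
  by apply: chain0; exact: sub_addr.
have PQ := chain_sub c; apply: chainS (IH _) _ _ => [v /h|w /addmP[a [b [aQ bP ->]]]|h'].
- exact: fP.
- apply: rpredD; last exact: sub_addr.
  by case/imagemP: aQ => v /h vQ1 <-; apply/sub_addl/mem_imagem.
apply: nh => v vQ1; have /h' := sub_addl P' (mem_imagem vQ1).
case/addmP => _ [p [/imagemP[u uQ <-] pP e]].
rewrite -(subrK u v) rpredD //; apply/PQ/fP; first by rewrite submodB // h.
by rewrite linearB e addrC addKr.
Qed.

(** Q' / P' is a quotient of a submodule of Q / P: chains are pulled back along [f] and intersected
    with Q, because [f] may map parts of Q outside Q'. *)
Lemma lenle_surj P Q (P' Q' : submodClosed W) n :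
  {subset P <= Q} -> (forall v, v \in P -> f v \in P') ->
  (forall w, w \in Q' -> exists2 v, v \in Q & w - f v \in P') ->
  lenle P Q n -> lenle P' Q' n.
Proof.
move=> PQ fP fQ h k c; apply: h.
suff : chain P (capm (preimm Q') Q) k.
  by move=> /chain_mono; apply => v /capmP[].
elim: c fQ => [{}Q' h _|{}Q' Q1 {}k c IH h nh fQ].
  by apply: chain0 => v vP; apply/capmP; split; [rewrite mem_preim; apply/h/fP|exact: PQ].
have PQ' := chain_sub c; apply: chainS (IH _) _ _ => [w /h|v /capmP[vQ' vQ]|h'].
- exact: fQ.
- by apply/capmP; split=> //; apply: h.
apply: nh => w wQ1; have [v vQ e] := fQ _ wQ1.
have /capmP[vQ' _] : v \in capm (preimm Q') Q.
  apply/h'/capmP; split=> //; rewrite mem_preim.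
  by rewrite -(subKr w (f v)) submodB //; apply/h/PQ'.
by apply: (submod_subK (PQ' _ e)).
Qed.
End LengthMaps.

Definition scale_by (R : comNzRingType) (V : lmodType R) (a : R) (v : V) : V := a *: v.
Lemma scale_by_linear (R : comNzRingType) (V : lmodType R) (a : R) : linear (@scale_by R V a).
Proof. by move=> c u v; rewrite /scale_by scalerDr scaler_comm. Qed.
HB.instance Definition _ (R : comNzRingType) (V : lmodType R) (a : R) :=
  GRing.isLinear.Build R V V *:%R (@scale_by R V a) (@scale_by_linear R V a).

Definition scale_vec (R : comNzRingType) (V : lmodType R) (v : V) (a : R^o) : V := a *: v.
Lemma scale_vec_linear (R : comNzRingType) (V : lmodType R) (v : V) : linear (scale_vec v).
Proof. by move=> c a b; rewrite /scale_vec scalerDl scalerA. Qed.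
HB.instance Definition _ (R : comNzRingType) (V : lmodType R) (v : V) :=
  GRing.isLinear.Build R R^o V *:%R (scale_vec v) (scale_vec_linear v).

Lemma mem_idl_self (R : comNzRingType) (l : seq R) x : x \in l -> x \in idl R^o l.
Proof. by move=> xl; rewrite -[x]mulr1; exact: (mem_idlb (V := R^o)). Qed.

(** * Colons and powers for one element *)

Section Powers.
Variables (R : comNzRingType) (V : lmodType R).
Implicit Types (P Q : submodClosed V) (x r : R).
Local Notation full := (full_submodule V).

Lemma addx1 P Q : {subset Q <= addx P 1}.
Proof. by move=> v _; rewrite -[v]scale1r mem_addx. Qed.

Lemma addx_scale P x y v : v \in addx P y -> x *: v \in addx P (x * y).
Proof.
case/addxP=> w h; apply/addxP; exists w.
by rewrite -scalerA -scalerBr rpredZ.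
Qed.

Lemma addx_mulr P x y : {subset addx P (x * y) <= addx P x}.
Proof. by apply: addx_sub => [|v]; [exact: sub_addx|rewrite -scalerA mem_addx]. Qed.

(** In the filtration P + xyV, P + xV, V the lower factor is the image of V / (P + yV) under
    multiplication by x. *)
Lemma lenle_addx_mul P x y m n : lenle (addx P y) full m ->
  lenle (addx P x) full n -> lenle (addx P (x * y)) full (m + n).
Proof.
move=> hm hn; apply: (lenle_trans (Q := addx P x)) hn => //; first exact: addx_mulr.
apply: (lenle_surj (f := scale_by x)) hm => // [v|w /addxP[v vP]]; first exact: addx_scale.
by exists v => //; exact: sub_addx.
Qed.

Lemma lenle_addx_exp P x m t : lenle (addx P x) full m ->
  lenle (addx P (x ^+ t)) full (t * m).
Proof.
move=> h; elim: t => [|t IH]; first by rewrite expr0 mul0n; apply: lenle_refl; exact: addx1.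
by rewrite exprS mulSn addnC; exact: lenle_addx_mul.
Qed.

(** If x w = x y u modulo P, then w - y u lies in P : x and is congruent to w modulo yV. *)
Lemma lenle_colon_addx P x y h : lenle P (colon P x) h ->
  lenle (addx P y) (colon (addx P (x * y)) x) h.
Proof.
move=> hh; apply: (lenle_surj (f := idfun)) hh; first exact: sub_colon.
- by move=> v /=; exact: sub_addx.
move=> w; rewrite mem_colon => /addxP[u hu]; exists (w - y *: u) => /=.
  by rewrite mem_colon scalerBr scalerA.
by rewrite subKr mem_addx.
Qed.

Lemma sub_colon_addx P x y : {subset addx P y <= colon (addx P (x * y)) x}.
Proof. by move=> v /(addx_scale x). Qed.

(** Lengths in the exact sequence V / (P + yV) -> V / (P + xyV) -> V / (P + xV) -> 0, whose first
    map is multiplication by x, with a kernel of length at most h. *)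
Lemma len_addx_mul P x y h : finite_length (addx P (x * y)) full -> lenle P (colon P x) h ->
  (len (addx P y) full + len (addx P x) full <= len (addx P (x * y)) full + h)%N.
Proof.
move=> f hh; have hs := addx_mulr (P := P) (x := x) (y := y).
have f1 : finite_length (addx P y) full by apply: fin_mono f => //; rewrite mulrC; exact: addx_mulr.
rewrite (lenD hs _ f) // (lenD (@sub_colon_addx P x y) _ f1) //.
have /len_leq := lenle_colon_addx (y := y) hh.
have : (len (colon (addx P (x * y)) x) full <= len (addx P (x * y)) (addx P x))%N.
  apply: len_leq.
  apply: (lenle_inj (f := scale_by x) (P' := addx P (x * y)) (Q' := addx P x)) => //.
  - by move=> v _; exact: mem_addx.
  - by apply: len_lenle; apply: fin_mono f.
move=> h1 h2; apply: leq_trans (leq_add (leq_add h2 h1) (leqnn _)) _.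
lia.
Qed.

Lemma len_addx_exp P x h t : (0 < t)%N -> finite_length (addx P (x ^+ t)) full -> lenle P (colon P x) h ->
  (t * len (addx P x) full <= len (addx P (x ^+ t)) full + t * h)%N.
Proof.
move=> + + hh; elim: t => // -[_ _ _|t IH _]; first by rewrite expr1; lia.
rewrite exprS => f; have f1 : finite_length (addx P (x ^+ t.+1)) full.
  by apply: fin_mono f => //; rewrite mulrC; exact: addx_mulr.
have := len_addx_mul f hh; have := IH isT f1; lia.
Qed.

(** V / (J : r) is the image of r on V / J. Multiplication by x maps the image of r on V / (P + yV)
    onto the image of r x on V / (P + xyV), with a kernel of length at most h. *)
Lemma lenle_colon_mul P x y r h n : lenle P (colon P x) h ->
  lenle (colon (addx P (x * y)) (r * x)) full n ->
  lenle (colon (addx P y) r) full (h + n).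
Proof.
move=> hh hn; apply: lenle_trans hn => //.
  by move=> v; rewrite !mem_colon mulrC -scalerA; exact: sub_colon_addx.
apply: (lenle_inj (f := scale_by r) _ _ _ (lenle_colon_addx (y := y) hh)) => // v.
  exact: sub_colon_addx.
by rewrite !mem_colon /scale_by scalerA mulrC.
Qed.

Lemma lenle_colon_exp P x r h t n : lenle P (colon P x) h ->
  lenle (colon (addx P (x ^+ t.+1)) (r * x ^+ t)) full n ->
  lenle (colon (addx P x) r) full (t * h + n).
Proof.
move=> hh; elim: t n => [n|t IH n hn]; first by rewrite expr1 mulr1.
rewrite mulSnr -addnA; apply: IH; apply: lenle_colon_mul hh _.
by rewrite -exprS -mulrA -exprSr.
Qed.
End Powers.

Section IdealList.
Variables (R : comNzRingType) (V : lmodType R).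
Implicit Types (l : seq R).

Lemma idl_mono l l' : {subset l <= l'} -> {subset idl V l <= idl V l'}.
Proof. by move=> h; apply: idl_sub => x v /h xl; exact: mem_idlb. Qed.

Lemma addx_mono (P Q : submodClosed V) x : {subset P <= Q} -> {subset addx P x <= addx Q x}.
Proof.
move=> h; apply: addx_sub => [v /h|v]; [exact: sub_addx|exact: mem_addx].
Qed.

Lemma idl_scale l a (v : V) : a \in idl R^o l -> a *: v \in idl V l.
Proof.
suff /(_ a) h : {subset idl R^o l <= preimm (scale_vec v) (idl V l)} by [].
apply: idl_sub => x b xl; change ((x * b) *: v \in idl V l); rewrite -scalerA.
exact: mem_idlb.
Qed.

Lemma idl_incl l l' : (forall x, x \in l -> x \in idl R^o l') -> {subset idl V l <= idl V l'}.
Proof. by move=> h; apply: idl_sub => x v /h; exact: idl_scale. Qed.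

Lemma idlb_addx (P : submodClosed V) x l : idlb (addx P x) l =i addx (idlb P l) x.
Proof.
move=> v; apply/idP/idP.
  apply: idlb_sub => [|y w yl]; last by apply: sub_addx; exact: mem_idlb.
  by apply: addx_mono; exact: sub_idlb.
apply: addx_sub => [|w]; first by apply: idlb_mono; exact: sub_addx.
by apply: sub_idlb; exact: mem_addx.
Qed.

Lemma lenle_idlb_pows (P : submodClosed V) l t n : lenle (idlb P l) (full_submodule V) n ->
  lenle (idlb P (map (fun x : R => x ^+ t) l)) (full_submodule V) (t ^ size l * n).
Proof.
elim: l P n => [|x l IH] P n hn /=; first by rewrite mul1n.
rewrite expnS -mulnA; apply: lenle_addx_exp.
apply: (lenle_eq (idlb_addx P x _)); apply: IH.
by apply: lenle_eq hn => v; rewrite idlb_addx.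
Qed.
End IdealList.

(** * Mapping cones *)

(** Bundles a map with a proof of linearity, so that maps defined in the middle of a proof can be
    used in the transport lemmas. *)
Definition mk_linear (R : comNzRingType) (V W : lmodType R) (f : V -> W) (lf : linear f) :
  V -> W := f.
HB.instance Definition _ (R : comNzRingType) (V W : lmodType R) (f : V -> W) (lf : linear f) :=
  GRing.isLinear.Build R V W *:%R (mk_linear lf) lf.

Section LinearFacts.
Variables (R : comNzRingType) (V W : lmodType R) (f : V -> W) (lf : linear f).
Lemma lin0 : f 0 = 0. Proof. exact: (linear0 (mk_linear lf)). Qed.
Lemma linN v : f (- v) = - f v. Proof. exact: (linearN (mk_linear lf)). Qed.
Lemma linD u v : f (u + v) = f u + f v. Proof. exact: (linearD (mk_linear lf)). Qed.
Lemma linZ a v : f (a *: v) = a *: f v. Proof. exact: (linearZ_LR (mk_linear lf)). Qed.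
End LinearFacts.

Section Complexes.
Variable R : comNzRingType.

(** One module with an endomorphism and a family of submodules as degrees, instead of a family of
    modules: a mapping cone is then a plain product, without dependent types. The module need not be
    the direct sum of its degrees. *)
Record complex := Complex {
  cmod : lmodType R;
  cD : {linear cmod -> cmod};
  cdeg : nat -> submodClosed cmod;
  cDD : forall v, cD (cD v) = 0;
  cD_deg : forall i v, v \in cdeg i.+1 -> cD v \in cdeg i;
  cD_deg0 : forall v, v \in cdeg 0 -> cD v = 0 }.

Arguments cD {c}.
Arguments cdeg : clear implicits.
Arguments cDD {c}.

Definition boundaries (C : complex) i : submodClosed (cmod C) := imagem (@cD C) (cdeg C i.+1).
Definition cycles (C : complex) i : submodClosed (cmod C) := capm (cdeg C i) (ker_pred (@cD C)).
Definition homle (C : complex) i n := lenle (boundaries C i) (cycles C i) n.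

Lemma cyclesP C i v : reflect (v \in cdeg C i /\ cD v = 0) (v \in cycles C i).
Proof. by apply: (iffP (capmP _ _ _)) => -[h /eqP h']; split=> //; apply/eqP. Qed.

Lemma boundariesP C i v : reflect (exists2 u, u \in cdeg C i.+1 & cD u = v) (v \in boundaries C i).
Proof. exact: imagemP. Qed.

Lemma sub_boundaries C i : {subset boundaries C i <= cycles C i}.
Proof.
by move=> v /boundariesP[u hu <-]; apply/cyclesP; rewrite cDD; split=> //; exact: cD_deg.
Qed.

Section Cone.
Variables (x : R) (C : complex).
Local Notation V := (cmod C).

(** The mapping cone of multiplication by x on C. The second component is C shifted by one degree,
    whence the sign of its differential. *)
Definition cone_D (p : V * V) : V * V := (cD p.1 + x *: p.2, - cD p.2).
Lemma cone_D_linear : linear cone_D.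
Proof.
move=> a [u u'] [v v']; rewrite /cone_D /=; congr pair; rewrite /= !(linearP cD).
  by rewrite !scalerDr (scaler_comm x a) addrACA.
by rewrite opprD scalerN.
Qed.
HB.instance Definition _ := GRing.isLinear.Build R (V * V)%type (V * V)%type *:%R
  cone_D cone_D_linear.

Definition cone_deg_pred i : {pred V * V} := fun p =>
  (p.1 \in cdeg C i) && (if i is j.+1 then p.2 \in cdeg C j else p.2 == 0).
Lemma cone_deg_closed i : submod_closed (cone_deg_pred i).
Proof.
split; first by rewrite unfold_in /cone_deg_pred rpred0; case: i => [|i]; rewrite ?rpred0 /=.
move=> a u v /andP[u1 u2] /andP[v1 v2]; rewrite unfold_in /cone_deg_pred.
rewrite rpredD ?rpredZ //=; case: i {u1 v1} u2 v2 => [/eqP -> /eqP ->|i u2 v2].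
  by rewrite scaler0 addr0.
by rewrite rpredD ?rpredZ.
Qed.
Definition cone_deg i : submodClosed (V * V)%type := of_closed (cone_deg_closed i).

Lemma cone_degS i u v : ((u, v) \in cone_deg i.+1) = (u \in cdeg C i.+1) && (v \in cdeg C i).
Proof. by []. Qed.
Lemma cone_deg0 u v : ((u, v) \in cone_deg 0) = (u \in cdeg C 0) && (v == 0).
Proof. by []. Qed.

Lemma cone_DD p : cone_D (cone_D p) = 0.
Proof.
case: p => u v; rewrite /cone_D /= (linearD cD) (linearN cD) (linearZ_LR cD) !cDD scalerN.
by rewrite add0r subrr !oppr0.
Qed.
Lemma cone_D_deg i p : p \in cone_deg i.+1 -> cone_D p \in cone_deg i.
Proof.
case: p => u v; rewrite cone_degS /cone_D => /andP[/= hu hv].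
case: i hu hv => [|i] hu hv.
  by rewrite cone_deg0 rpredD ?rpredZ ?cD_deg //= cD_deg0 // oppr0 eqxx.
by rewrite cone_degS rpredD ?rpredZ ?cD_deg // submodN // cD_deg.
Qed.
Lemma cone_D_deg0 p : p \in cone_deg 0 -> cone_D p = 0.
Proof.
case: p => u v; rewrite cone_deg0 /cone_D => /andP[/= hu /eqP ->].
by rewrite scaler0 addr0 linear0 oppr0 cD_deg0.
Qed.

Definition cone := Complex cone_DD cone_D_deg cone_D_deg0.
End Cone.

Lemma coneDE x C (u v : cmod C) : @cD (cone x C) (u, v) = (cD u + x *: v, - cD v).
Proof. by []. Qed.

Lemma mem_coneS x C i (u v : cmod C) :
  ((u, v) \in cdeg (cone x C) i.+1) = (u \in cdeg C i.+1) && (v \in cdeg C i).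
Proof. by []. Qed.
Lemma mem_cone0 x C (u v : cmod C) :
  ((u, v) \in cdeg (cone x C) 0) = (u \in cdeg C 0) && (v == 0).
Proof. by []. Qed.

Lemma inl_linear C : linear (fun u : cmod C => (u, 0) : cmod C * cmod C).
Proof. by move=> a u v; congr pair; rewrite /= scaler0 addr0. Qed.

Lemma cycles_coneP x C i u v : (u, v) \in cycles (cone x C) i.+1 ->
  [/\ u \in cdeg C i.+1, v \in cdeg C i, cD u + x *: v = 0 & cD v = 0].
Proof.
case/cyclesP; rewrite coneDE => /andP[/= hu hv] [h1 /eqP]; rewrite oppr_eq0 => /eqP h2.
by split.
Qed.

Lemma cycles_coneI x C i u v : u \in cdeg C i.+1 -> v \in cdeg C i ->
  cD u + x *: v = 0 -> cD v = 0 -> (u, v) \in cycles (cone x C) i.+1.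
Proof.
move=> hu hv h1 h2; apply/cyclesP; rewrite coneDE h1 h2 oppr0; split=> //.
by apply/andP.
Qed.

Lemma boundaries_coneI x C i u v : u \in cdeg C i.+2 -> v \in cdeg C i.+1 ->
  (cD u + x *: v, - cD v) \in boundaries (cone x C) i.+1.
Proof. by move=> hu hv; apply/boundariesP; exists (u, v) => //; apply/andP. Qed.

(** This is the piece H_(i+1)(C) -> H_(i+1)(cone) -> H_i(C) of the long exact sequence; [P1]
    consists of the cycles that die in the last term. *)
Lemma homle_cone x C i m n : homle C i.+1 m -> homle C i n ->
  homle (cone x C) i.+1 (m + n).
Proof.
move=> hm hn.
pose P1 := capm (cycles (cone x C) i.+1)
  (preimm (snd : cmod (cone x C) -> cmod C) (boundaries C i)).
apply: (lenle_trans (Q := P1)).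
- move=> p hp; apply/capmP; split; first exact: sub_boundaries.
  case/boundariesP: hp => -[u v] /andP[/= hu hv] <-.
  rewrite mem_preim /= -(linearN cD); apply/boundariesP; exists (- v) => //.
  exact: submodN.
- by move=> p /capmP[].
- apply: (lenle_surj (f := mk_linear (@inl_linear C))) hm; first exact: sub_boundaries.
    move=> u /boundariesP[w hw <-]; rewrite /mk_linear.
    have := boundaries_coneI x hw (rpred0 (cdeg C i.+1)).
    by rewrite (linear0 cD) scaler0 addr0 oppr0.
  move=> [u v] /capmP[/cycles_coneP[hu hv h1 h2]]; rewrite mem_preim /= => /boundariesP[w hw ew].
  exists (u + x *: w).
    apply/cyclesP; rewrite (linearD cD) /= (linearZ_LR cD) /= ew h1; split=> //.
    by rewrite rpredD ?rpredZ.
  have := boundaries_coneI x (rpred0 (cdeg C i.+2)) (submodN hw).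
  rewrite (linear0 cD) add0r (linearN cD) opprK ew.
  have -> // : (u, v) - mk_linear (@inl_linear C) (u + x *: w) = (x *: - w, v).
  by congr pair; rewrite /= ?subr0 // opprD addNKr scalerN.
apply: (lenle_inj (f := (snd : cmod (cone x C) -> cmod C))) hn.
- exact: sub_boundaries.
- by move=> [u v] /cycles_coneP[hu hv h1 h2]; apply/cyclesP.
- by move=> p hp hb; apply/capmP.
Qed.

(** The connecting map of the long exact sequence is multiplication by x, so H_(i+1) of the cone
    maps onto the kernel of x on H_i(C): from D u = x v one obtains the cycle (- u, v). *)
Lemma homle_colon x C i h : homle (cone x C) i.+1 h ->
  lenle (boundaries C i) (capm (cycles C i) (colon (boundaries C i) x)) h.
Proof.
apply: (lenle_surj (f := (snd : cmod (cone x C) -> cmod C))).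
- exact: (@sub_boundaries (cone x C)).
- move=> p /boundariesP[[u v] /andP[/= hu hv] <-] /=.
  by rewrite -(linearN cD); apply/boundariesP; exists (- v) => //; exact: submodN.
move=> v /capmP[/cyclesP[hv h2]]; rewrite mem_colon => /boundariesP[u hu eu].
exists (- u, v); last by rewrite subrr rpred0.
by apply: cycles_coneI => //; [exact: submodN|rewrite (linearN cD) eu addNr].
Qed.

(** H_i(C) is filtered by the kernels [K j] of x ^ j, and multiplication by x ^ j embeds
    [K j.+1 / K j] into the kernel of x. *)
Lemma homle_nilpotent x C i h N :
  (forall v, v \in cycles C i -> x ^+ N *: v \in boundaries C i) ->
  homle (cone x C) i.+1 h -> homle C i (N * h).
Proof.
move=> hN /homle_colon hh.
pose K j := capm (cycles C i) (colon (boundaries C i) (x ^+ j)).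
suff hK j : lenle (boundaries C i) (K j) (j * h).
  apply: lenle_mono (hK N) => // [|v hv]; first exact: sub_boundaries.
  by apply/capmP; split=> //; exact: hN.
have sK k : {subset boundaries C i <= K k}.
  by move=> v hv; apply/capmP; split; [exact: sub_boundaries|exact: sub_colon].
elim: j => [|j IH].
  by apply: lenle_refl => v /capmP[_]; rewrite mem_colon expr0 scale1r.
rewrite mulSn addnC; apply: lenle_trans (sK j) _ IH _.
  move=> v /capmP[h1]; rewrite mem_colon => h2; apply/capmP; split=> //.
  by rewrite mem_colon exprS -scalerA rpredZ.
apply: (lenle_inj (f := scale_by (x ^+ j))) hh.
- by move=> v hv; apply/capmP; split; [exact: sub_boundaries|exact: sub_colon].
- move=> v /capmP[h1]; rewrite mem_colon => h2; apply/capmP; split; first exact: rpredZ.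
  by rewrite mem_colon /scale_by scalerA -exprS.
- by move=> v /capmP[h1 _] h2; apply/capmP.
Qed.

(** The chain maps (u, v) |-> (z u, v) from the cone of w and (u, v) |-> (u, w v) to the cone of z
    give a sequence in homology that is exact in the middle, at the cone of z w. *)
Lemma homle_cone_mul z w C i m n : homle (cone z C) i.+1 m -> homle (cone w C) i.+1 n ->
  homle (cone (z * w) C) i.+1 (m + n).
Proof.
move=> hm hn; rewrite addnC.
pose g (p : cmod (cone (z * w) C)) : cmod (cone z C) := (p.1, w *: p.2).
have lg : linear g.
  by move=> a u v; congr pair; rewrite /= scalerDr (scaler_comm w).
pose k (p : cmod (cone w C)) : cmod (cone (z * w) C) := (z *: p.1, p.2).
have lk : linear k.
  by move=> a u v; congr pair; rewrite /= scalerDr (scaler_comm z).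
pose P1 := capm (cycles (cone (z * w) C) i.+1)
  (preimm (mk_linear lg) (boundaries (cone z C) i.+1)).
apply: (lenle_trans (Q := P1)).
- move=> p hp; apply/capmP; split; first exact: sub_boundaries.
  case/boundariesP: hp => -[u v] /andP[/= hu hv] <-; rewrite mem_preim.
  have hwv : w *: v \in cdeg C i.+1 by exact: rpredZ.
  by have := boundaries_coneI z hu hwv; rewrite (linearZ_LR cD) scalerA -scalerN.
- by move=> p /capmP[].
- apply: (lenle_surj (f := mk_linear lk)) hn; first exact: sub_boundaries.
    move=> p /boundariesP[[u v] /andP[/= hu hv] <-].
    have hzu : z *: u \in cdeg C i.+2 by exact: rpredZ.
    by have := boundaries_coneI (z * w) hzu hv; rewrite (linearZ_LR cD) -scalerA -scalerDr.
  move=> [u v] /capmP[/cycles_coneP[hu hv h1 h2]]; rewrite mem_preim.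
  case/boundariesP=> -[p q] /andP[/= hp hq] [e1 e2].
  (* If (u, w v) is the boundary of (p, q), then D q + w v = 0 and u = D p + z q. So (q, v) is a
     cycle whose image (z q, v) differs from (u, v) by the boundary (D p, 0). *)
  exists (q, v).
    by apply: cycles_coneI => //; rewrite -e2 subrr.
  have := boundaries_coneI (z * w) hp (rpred0 (cdeg C i.+1)).
  rewrite (linear0 cD) oppr0 scaler0 addr0.
  have -> // : (u, v) - mk_linear lk (q, v) = (cD p, 0).
  by congr pair; rewrite /= ?subrr // -e1 addrK.
apply: (lenle_inj (f := mk_linear lg)) hm.
- exact: sub_boundaries.
- move=> [u v] /cycles_coneP[hu hv h1 h2]; apply: cycles_coneI => //=.
  + exact: rpredZ.
  + by rewrite scalerA.
  + by rewrite (linearZ_LR cD) h2 scaler0.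
- by move=> p hp hb; apply/capmP.
Qed.

Lemma homle_cone_exp x C i h t : homle (cone x C) i.+1 h ->
  homle (cone (x ^+ t.+1) C) i.+1 (t.+1 * h).
Proof.
move=> hh; elim: t => [|t IH]; first by rewrite expr1 mul1n.
by rewrite exprS mulSn; exact: homle_cone_mul.
Qed.

(* Unlike annihilating the homology, being null-homotopic is inherited by cones. *)
Definition nullhom C y := exists s : cmod C -> cmod C, [/\ linear s,
  forall i v, v \in cdeg C i -> s v \in cdeg C i.+1 &
  forall v, cD (s v) + s (cD v) = y *: v].

Lemma nullhom_cone_self x C : nullhom (cone x C) x.
Proof.
exists (fun p => (0, p.1)); split.
- by move=> a u v; congr pair; rewrite /= scaler0 addr0.
- move=> i [u v] /andP[/= hu hv]; apply/andP; split=> //; exact: rpred0.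
move=> [u v]; rewrite !coneDE /=; congr pair; rewrite /= ?(linear0 cD) ?add0r ?addr0 //.
by rewrite addKr.
Qed.

Lemma nullhom_cone x y C : nullhom C y -> nullhom (cone x C) y.
Proof.
case=> s [ls hs es]; exists (fun p => (s p.1, - s p.2)); split.
- by move=> a u v; congr pair; rewrite /= ls // opprD scalerN.
- move=> [|i] [u v] /andP[/= hu hv]; apply/andP; split=> /=; try exact: hs.
    by rewrite (eqP hv) (lin0 ls) oppr0 rpred0.
  exact/submodN/hs.
move=> [u v]; rewrite !coneDE /=; congr pair; rewrite /=.
  by rewrite (linD ls) (linZ ls) scalerN addrACA addNr addr0 es.
by rewrite (linearN cD) (linN ls) !opprK es.
Qed.

Lemma nullhom0 C : nullhom C 0.
Proof.
exists (fun=> 0); split=> [a u v|i v _|v]; rewrite ?scaler0 ?addr0 ?rpred0 //.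
by rewrite (linear0 cD) scale0r.
Qed.

Lemma nullhomD C y y' a : nullhom C y -> nullhom C y' -> nullhom C (a * y + y').
Proof.
case=> s [ls hs es] [s' [ls' hs' es']]; exists (fun v => a *: s v + s' v); split.
- move=> c u v; rewrite ls ls' !scalerDr -addrA -[RHS]addrA (scaler_comm a c); congr (_ + _).
  by rewrite addrCA.
- by move=> i v hv; rewrite rpredD ?rpredZ ?hs ?hs'.
move=> v; rewrite (linearD cD) (linearZ_LR cD) /= addrACA -scalerDr es es' scalerA.
by rewrite scalerDl.
Qed.

Lemma nullhom_cycles C y i v : nullhom C y -> v \in cycles C i -> y *: v \in boundaries C i.
Proof.
case=> s [ls hs es] /cyclesP[hv Dv]; apply/boundariesP; exists (s v); first exact: hs.
by rewrite -es Dv (lin0 ls) addr0.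
Qed.

Definition complex_iso C C' := exists (f : cmod C -> cmod C') (g : cmod C' -> cmod C),
  [/\ linear f, cancel g f, cancel f g, forall v, f (cD v) = cD (f v) &
      forall i v, (f v \in cdeg C' i) = (v \in cdeg C i)].

Lemma ciso_refl C : complex_iso C C.
Proof. by exists id, id. Qed.
Lemma ciso_trans C1 C2 C3 : complex_iso C1 C2 -> complex_iso C2 C3 -> complex_iso C1 C3.
Proof.
case=> f [g [lf gf fg Df df]] [f' [g' [lf' gf' fg' Df' df']]].
exists (f' \o f), (g \o g'); split=> [a u v|||v|i v] /=.
- by rewrite lf lf'.
- exact: can_comp.
- exact: can_comp.
- by rewrite Df Df'.
- by rewrite df' df.
Qed.

Lemma ciso_cone x C C' : complex_iso C C' -> complex_iso (cone x C) (cone x C').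
Proof.
case=> f [g [lf gf fg Df df]].
exists (fun p => (f p.1, f p.2)), (fun p => (g p.1, g p.2)); split.
- by move=> a u v; congr pair; rewrite /= lf.
- by move=> [u v] /=; rewrite !gf.
- by move=> [u v] /=; rewrite !fg.
- by move=> [u v] /=; rewrite !coneDE /= (linD lf) (linZ lf) (linN lf) !Df.
- move=> [|i] [u v]; rewrite -[LHS]/(_ && _) -[RHS]/(_ && _) /= !df //.
  by rewrite -(inj_eq (can_inj fg)) (lin0 lf).
Qed.

(** Exchanging the two middle components must be accompanied by a sign in the last one, since the
    two Koszul generators anticommute. *)
Lemma ciso_swap x y C : complex_iso (cone x (cone y C)) (cone y (cone x C)).
Proof.
pose f (p : (cmod C * cmod C) * (cmod C * cmod C)) := ((p.1.1, p.2.1), (p.1.2, - p.2.2)).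
have ff : cancel f f by move=> [[a b] [c d]]; rewrite /f /= opprK.
exists f, f; split=> //.
- by move=> a u v; rewrite /f /=; congr (_, (_, _)); rewrite /= opprD scalerN.
- move=> [[a b] [c d]]; rewrite /f !coneDE /=; congr ((_, _), (_, _)) => /=.
  + by rewrite addrAC.
  + by rewrite opprD scalerN.
  + by rewrite scalerN opprD opprK.
  + by rewrite (linearN cD).
- have memN i (v : cmod C) : (- v \in cdeg C i) = (v \in cdeg C i).
    by apply/idP/idP => /submodN; rewrite ?opprK.
  have pair0 (u v : cmod C) : ((u, v) == 0 :> cmod C * cmod C) = (u == 0) && (v == 0) by [].
  move=> [|[|i]] [[a b] [c d]]; have -> : f ((a, b), (c, d)) = ((a, c), (b, - d)) by [].
  + by rewrite !mem_cone0 !pair0 oppr_eq0 -!andbA; do ?bool_congr.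
  + by rewrite !mem_coneS !mem_cone0 oppr_eq0 -!andbA; do ?bool_congr.
  + by rewrite !mem_coneS memN -!andbA; do ?bool_congr.
Qed.

Lemma homle_iso C C' i n : complex_iso C C' -> homle C i n -> homle C' i n.
Proof.
case=> f [g [lf gf fg Df df]].
apply: (lenle_surj (f := mk_linear lf)); first exact: sub_boundaries.
  move=> v /boundariesP[u hu <-]; apply/boundariesP; exists (f u); first by rewrite df.
  by rewrite -Df.
move=> w /cyclesP[hw Dw]; exists (g w); last first.
  by have -> : w - mk_linear lf (g w) = 0; rewrite ?rpred0 // -{1}(gf w) subrr.
apply/cyclesP; rewrite -df gf; split=> //; apply: (can_inj fg).
by rewrite Df gf Dw (lin0 lf).
Qed.

Definition kos (l : seq R) (C : complex) := foldr cone C l.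

Lemma kos_cat l l' C : kos (l ++ l') C = kos l (kos l' C).
Proof. exact: foldr_cat. Qed.

Lemma kos_middle x l1 l2 C : complex_iso (kos (x :: l1 ++ l2) C) (kos (l1 ++ x :: l2) C).
Proof.
rewrite /= !kos_cat /=; elim: l1 => [|y l IH] /=; first exact: ciso_refl.
exact: ciso_trans (ciso_swap _ _ _) (ciso_cone y IH).
Qed.

Lemma kos_perm l l' C : perm_eq l l' -> complex_iso (kos l C) (kos l' C).
Proof.
elim: l l' => [l' /perm_size /esym /size0nil ->|x l IH l' h]; first exact: ciso_refl.
have /path.splitPr : x \in l' by rewrite -(perm_mem h) mem_head.
case def_l' : _ / => [l1 l2]; move: h; rewrite {}def_l' => h.
apply: ciso_trans (kos_middle x l1 l2 C); apply: (ciso_cone x); apply: IH.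
by rewrite -(perm_cons x); apply: perm_trans h _; rewrite perm_catC /= perm_cons perm_catC.
Qed.

(** Each element of l is null-homotopic on its own cone, further cones preserve this, and the
    null-homotopic scalars form an ideal. *)
Lemma nullhom_kos l C x : x \in idl R^o l -> nullhom (kos l C) x.
Proof.
elim: l x => [x|y l IH x].
  by rewrite mem_zero => /eqP ->; exact: nullhom0.
case/addxP=> w /IH /(nullhom_cone y) h.
have := nullhomD w (nullhom_cone_self y (kos l C)) h.
have -> // : w * y + (x - y *: w) = x.
by rewrite (_ : y *: w = y * w) // mulrC addrC subrK.
Qed.
End Complexes.
Arguments cD {R c}.
Arguments cdeg {R} c.
Arguments cDD {R c}.

(** * The Koszul complex *)

Section Koszul.
Variable R : comNzRingType.

(** Every cone adds the bounds of two neighbouring degrees, hence the power of 2. As i exceeds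
    [size l], degree 0 of C, about which nothing is assumed, is not reached. *)
Lemma homle_kos_add (C : complex R) l n G : (forall i, (0 < i <= n)%N -> homle C i G) ->
  forall i, (size l < i <= n)%N -> homle (kos l C) i (2 ^ size l * G).
Proof.
move=> hG; elim: l => [|x l IH] i /=; first by rewrite mul1n; exact: hG.
case: i => // i /andP[h1 h2]; rewrite expnS mul2n -addnn mulnDl.
by apply: homle_cone; apply: IH; rewrite ?(ltnW h2) ?(ltnW h1) ?h2 ?andbT.
Qed.

Lemma nullhom_kos_base (C : complex R) l y : nullhom C y -> nullhom (kos l C) y.
Proof. by move=> h; elim: l => //= x l; exact: nullhom_cone. Qed.

(** [homle_nilpotent] removes one element of l at the price of one degree and a factor N; the
    remaining cones inherit the null-homotopy that it relies on. *)
Lemma homle_kos_nilpotent (C : complex R) l N i h : (forall x, x \in l -> nullhom C (x ^+ N)) ->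
  homle (kos l C) (i + size l) h -> homle C i (N ^ size l * h).
Proof.
elim: l h => [|x l IH] h hl /=; first by rewrite addn0 mul1n.
rewrite addnS expnSr -mulnA => hh.
apply: IH => [y yl|]; first by apply: hl; rewrite inE yl orbT.
apply: homle_nilpotent hh => v; apply: nullhom_cycles.
exact: nullhom_kos_base (hl _ (mem_head x l)).
Qed.

(* In degrees [> size ly] the homology of [kos (ly ++ lx)] only involves the
   homology of [kos lx] in positive degrees; the elements of [lx] are nilpotent on
   that of [kos ly], which in degree [1] therefore contributes to degree
   [(size lx).+1]. *)
Lemma homle_kos_indep (C : complex R) (lx ly : seq R) N G : (size ly <= size lx)%N ->
  (forall x, x \in lx -> x ^+ N \in idl R^o ly) ->
  (forall i, (0 < i <= (size lx).+1)%N -> homle (kos lx C) i G) ->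
  homle (kos ly C) 1 (N ^ size lx * (2 ^ size ly * G)).
Proof.
move=> hs hN hG; apply: homle_kos_nilpotent.
  by move=> x /hN /nullhom_kos; apply.
rewrite -kos_cat; apply: (homle_iso (kos_perm C (permEl (perm_catC ly lx)))).
by rewrite kos_cat; apply: (homle_kos_add hG); rewrite add1n ltnS hs leqnn.
Qed.

Section Base.
Variable M : lmodType R.

Definition base_deg i : submodClosed M := if i is 0 then full_submodule M else zero_submod M.
Definition base_D (v : M) : M := 0.
Lemma base_D_linear : linear base_D.
Proof. by move=> a u v; rewrite /base_D scaler0 addr0. Qed.
Definition base_complex := @Complex R M (mk_linear base_D_linear) base_deg
  (fun=> erefl) (fun i v _ => rpred0 _) (fun _ _ => erefl).

Definition kosM l := kos l base_complex.

Fixpoint kos_inj l : M -> cmod (kosM l) :=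
  if l is x :: l' then fun v => (kos_inj l' v, 0) else id.

Lemma kos_inj_linear l : linear (kos_inj l).
Proof.
elim: l => // x l IH a u v /=; rewrite IH; congr pair.
by rewrite /= scaler0 addr0.
Qed.

Lemma kos_inj_deg0 l u : u \in cdeg (kosM l) 0 <-> exists v, u = kos_inj l v.
Proof.
elim: l u => [u|x l IH [u w]] /=; first by split=> // _; exists u.
split=> [/andP[/= /IH [v ->] /eqP ->]|[v [-> ->]]]; first by exists v.
by apply/andP; split=> //=; apply/IH; exists v.
Qed.

(** Thus H_0 is M / (l) M, the bridge from Koszul homology to colons of submodules of M. *)
Lemma kos_inj_boundary l v : kos_inj l v \in boundaries (kosM l) 0 <-> v \in idl M l.
Proof.
elim: l v => [v|x l IH v].
  rewrite mem_zero; split=> [/boundariesP[u _ /= <-]|/eqP ->]; first exact: eqxx.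
  exact: (rpred0 (boundaries (kosM [::]) 0)).
have lI := kos_inj_linear l; split.
  case/boundariesP=> -[u w]; rewrite mem_coneS coneDE => /andP[hu /kos_inj_deg0[z ez]] [e _].
  apply/addxP; exists z; apply/IH; rewrite (linD lI) (linN lI) (linZ lI) -ez -e addrK.
  by apply/boundariesP; exists u.
case/addxP=> w /IH /boundariesP[u hu eu]; apply/boundariesP; exists (u, kos_inj l w).
  by rewrite mem_coneS hu; apply/kos_inj_deg0; exists w.
rewrite coneDE eu (linD lI) (linN lI) (linZ lI) subrK; congr pair.
by rewrite cD_deg0 ?oppr0 //; apply/kos_inj_deg0; exists w.
Qed.

Lemma homle_idl_colon x l h : homle (kosM (x :: l)) 1 h ->
  lenle (idl M l) (colon (idl M l) x) h.
Proof.
move/homle_colon; have lI := kos_inj_linear l.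
apply: (lenle_inj (f := mk_linear lI)).
- by move=> v hv; apply/capmP; split; [exact: sub_boundaries|exact: sub_colon].
- move=> v; rewrite mem_colon => /kos_inj_boundary; rewrite (linZ lI) => hv.
  have hd : kos_inj l v \in cdeg (kosM l) 0 by apply/kos_inj_deg0; exists v.
  by apply/capmP; split=> //; apply/cyclesP; split=> //; exact: cD_deg0 hd.
- by move=> v _ /kos_inj_boundary.
Qed.
End Base.

Definition kseq d (x : 'I_d -> R) : seq R := [seq x i | i <- enum 'I_d].

Lemma kseqS d (x : 'I_d.+1 -> R) :
  kseq x = x ord0 :: kseq (x \o lift ord0).
Proof. by rewrite /kseq enum_ordSl /= -map_comp. Qed.

Lemma mem_kseq d (x : 'I_d -> R) i : x i \in kseq x.
Proof. by apply: map_f; rewrite mem_enum. Qed.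

Lemma size_kseq d (x : 'I_d -> R) : size (kseq x) = d.
Proof. by rewrite size_map size_enum_ord. Qed.

(* The coordinates away from [0] and those at [0] exhibit the Koszul complex of [x]
   as the cone of [x ord0]. *)
Lemma lift0_sum (M : lmodType R) d (x : 'I_d.+1 -> R) (v : koszul M d.+1) (S : {set 'I_d}) :
  let vA : koszul M d := [ffun T : {set 'I_d} => v (lift ord0 @: T)] in
  let vB : koszul M d := [ffun T : {set 'I_d} => v (ord0 |: lift ord0 @: T)] in
  koszul_d x v (lift ord0 @: S) = koszul_d (x \o lift ord0) vA S + x ord0 *: vB S /\
  koszul_d x v (ord0 |: lift ord0 @: S) = - koszul_d (x \o lift ord0) vB S.
Proof.
move=> vA vB; rewrite !ffunE.
have n0 : ord0 \notin [set lift ord0 i | i in S].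
  by apply/imsetP => -[i _] /eqP; rewrite (negbTE (neq_lift _ _)).
have memL (j : 'I_d) : (lift ord0 j \in [set lift ord0 i | i in S]) = (j \in S).
  by rewrite mem_imset //; exact: lift_inj.
have card_lt j : #|[set k in [set lift ord0 i | i in S] | (k < lift ord0 j)%N]| =
    #|[set k in S | (k < j)%N]|.
  rewrite -[RHS](card_imset _ (@lift_inj _ ord0)); apply: eq_card => k.
  rewrite !inE; apply/andP/imsetP => [[/imsetP[i iS ->] h]|[i]].
    by exists i => //; rewrite inE iS.
  by rewrite inE => /andP[iS h] ->; rewrite memL iS.
rewrite big_mkcond big_ord_recl /= n0.
have -> : [set k in [set lift ord0 i | i in S] | (k < 0)%N] = finset.set0.
  by apply/setP => k; rewrite !inE ltn0 andbF.
rewrite cards0 expr0 mul1r addrC; split; last first.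
  rewrite big_mkcond big_ord_recl /= setU11 add0r -sumrN [RHS]big_mkcond /=.
  apply: eq_bigr => j _; rewrite !inE /= memL; case: ifP => // jS; rewrite ffunE.
  have -> : [set k in ord0 |: [set lift ord0 i | i in S] | (k < lift ord0 j)%N] =
     ord0 |: [set k in [set lift ord0 i | i in S] | (k < lift ord0 j)%N].
    by apply/setP => k; rewrite !inE; case: (k =P ord0) => //= ->.
  rewrite cardsU1 !inE (negbTE n0) /= card_lt add1n exprS mulN1r mulNr scaleNr.
  by rewrite imsetU1 finset.setUCA.
congr (_ + _); rewrite [RHS]big_mkcond; apply: eq_bigr => j _ /=.
by rewrite memL card_lt; case: ifP => // jS; rewrite ffunE imsetU1.
Qed.

Definition shrink d (S : {set 'I_d.+1}) : {set 'I_d} := [set i | lift ord0 i \in S].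

Lemma shrinkE d (S : {set 'I_d.+1}) :
  S = if ord0 \in S then ord0 |: lift ord0 @: shrink S else lift ord0 @: shrink S.
Proof.
have memL (j : 'I_d) : (lift ord0 j \in [set lift ord0 i | i in shrink S]) = (lift ord0 j \in S).
  by rewrite mem_imset ?inE //; exact: lift_inj.
have n0 : ord0 \notin [set lift ord0 i | i in shrink S].
  by apply/imsetP => -[i _] /eqP; rewrite (negbTE (neq_lift _ _)).
apply/setP => k; case: ifP => S0; case: (unliftP ord0 k) => [j ->|->].
- by rewrite !inE memL.
- by rewrite S0 setU11.
- by rewrite memL.
- by rewrite S0 (negbTE n0).
Qed.

Lemma lift_shrink d (S : {set 'I_d}) :
  [/\ ord0 \notin lift ord0 @: S, shrink (lift ord0 @: S) = S &
      shrink (ord0 |: lift ord0 @: S) = S].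
Proof.
split; first by apply/imsetP => -[i _] /eqP; rewrite (negbTE (neq_lift _ _)).
- by apply/setP => j; rewrite inE mem_imset //; exact: lift_inj.
- by apply/setP => j; rewrite !inE /= mem_imset //; exact: lift_inj.
Qed.

Lemma koszul_degP (M : lmodType R) d i (v : koszul M d) :
  reflect (forall S : {set 'I_d}, #|S| != i -> v S = 0) (v \in koszul_deg i).
Proof.
apply: (iffP forallP) => [h S hS|h S]; last by apply/implyP => /h ->.
by have /implyP/(_ hS)/eqP := h S.
Qed.

(** Through this isomorphism the subset description of the Koszul complex is left behind: all later
    homology is that of iterated cones. *)
Lemma koszul_kos (M : lmodType R) d (x : 'I_d -> R) :
  exists (f : koszul M d -> cmod (kosM M (kseq x))) (g : cmod (kosM M (kseq x)) -> koszul M d),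
  [/\ linear f, cancel g f, cancel f g, forall v, f (koszul_d x v) = cD (f v) &
      forall i v, (f v \in cdeg _ i) = (v \in koszul_deg i)].
Proof.
elim: d x => [|d IH] x.
  have -> : kseq x = [::] by apply: size0nil; rewrite size_kseq.
  exists (fun v : koszul M 0 => v finset.set0), (fun w => [ffun=> w]); split.
  - by move=> a u v; rewrite !ffunE.
  - by move=> w; rewrite ffunE.
  - move=> v; apply/ffunP => S; rewrite ffunE; congr (v _).
    by apply/setP => -[].
  - by move=> v; rewrite ffunE big_ord0.
  move=> i v; apply/idP/forallP => [h S|h].
    have -> : S = finset.set0 by apply/setP => -[].
    by apply/implyP; rewrite cards0; case: i h => //= i; rewrite mem_zero.
  have := h finset.set0; rewrite cards0; case: i {h} => //= i.
rewrite kseqS; have [f [g [lf gf fg Df df]]] := IH (x \o lift ord0).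
pose A (v : koszul M d.+1) : koszul M d := [ffun T : {set 'I_d} => v (lift ord0 @: T)].
pose B (v : koszul M d.+1) : koszul M d := [ffun T : {set 'I_d} => v (ord0 |: lift ord0 @: T)].
pose G (p q : koszul M d) : koszul M d.+1 :=
  [ffun S : {set 'I_d.+1} => if ord0 \in S then q (shrink S) else p (shrink S)].
have AG p q : A (G p q) = p.
  apply/ffunP => S; rewrite !ffunE; have [n0 e _] := lift_shrink S.
  by rewrite (negbTE n0) e.
have BG p q : B (G p q) = q.
  apply/ffunP => S; rewrite !ffunE; have [n0 _ e] := lift_shrink S.
  by rewrite setU11 e.
have GAB v : G (A v) (B v) = v.
  by apply/ffunP => S; rewrite !ffunE [in RHS](shrinkE S); case: ifP.
exists (fun v => (f (A v), f (B v))), (fun w => G (g w.1) (g w.2)); split.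
- move=> a u v; congr pair; rewrite /= -lf; congr (f _); apply/ffunP => S; rewrite !ffunE //.
- by move=> [u v]; rewrite AG BG /= !gf.
- by move=> v /=; rewrite !fg GAB.
- move=> v; rewrite coneDE -!Df -(linZ lf) -(linD lf) -(linN lf).
  congr pair; congr (f _); apply/ffunP => S; rewrite [LHS]ffunE.
    by rewrite [RHS]ffunE (lift0_sum _ _ _).1; congr (_ + _); rewrite [RHS]ffunE.
  by rewrite [RHS]ffunE (lift0_sum _ _ _).2.
have f_eq0 w : (f w == 0) = (w == 0) by rewrite -(inj_eq (can_inj fg)) (lin0 lf).
have cA (S : {set 'I_d}) : #|lift ord0 @: S| = #|S| by apply: card_imset; exact: lift_inj.
have cB (S : {set 'I_d}) : #|ord0 |: lift ord0 @: S| = #|S|.+1.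
  by rewrite cardsU1 cA; have [-> _ _] := lift_shrink S.
move=> i v; apply/idP/koszul_degP => [h S|h].
  have [hA hB] : A v \in koszul_deg i /\ (forall T : {set 'I_d}, #|T|.+1 != i -> B v T = 0).
    case: i h => [|i]; rewrite ?mem_cone0 ?mem_coneS !df ?f_eq0.
      by move=> /andP[hA /eqP hB]; split=> // T _; rewrite hB ffunE.
    by move=> /andP[hA /koszul_degP hB]; split=> // T hT; apply: hB.
  rewrite (shrinkE S); case: ifP => _ hS.
    by have := hB (shrink S); rewrite ffunE; apply; rewrite -cB.
  by have /koszul_degP/(_ (shrink S)) := hA; rewrite ffunE; apply; rewrite -cA.
have hA : A v \in koszul_deg i.
  by apply/koszul_degP => S hS; rewrite ffunE; apply: h; rewrite cA.
case: i h hA => [|i] h hA; rewrite ?mem_cone0 ?mem_coneS !df hA /= ?f_eq0.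
  by apply/eqP/ffunP => S; rewrite !ffunE h // cB.
by apply/koszul_degP => S hS; rewrite ffunE h // cB.
Qed.

Lemma homle_koszul (M : lmodType R) d (x : 'I_d -> R) i n :
  lenle (koszul_boundaries M x i) (koszul_cycles M x i) n -> homle (kosM M (kseq x)) i n.
Proof.
have [f [g [lf gf fg Df df]]] := koszul_kos M x.
(* [koszul_d] squares to zero and lowers degrees because it corresponds to [cD]; this saves a
   comparison of signs over subsets. *)
have DD (v : koszul M d) : koszul_d x (koszul_d x v) = 0.
  by have := congr1 g (Df (koszul_d x v)); rewrite fg Df cDD -(lin0 lf) fg.
have dS j (v : koszul M d) : v \in koszul_deg j.+1 -> koszul_d x v \in koszul_deg j.
  by rewrite -!df Df; exact: cD_deg.
apply: (lenle_surj (f := mk_linear lf)).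
- move=> v /imagemP[u hu <-]; apply/capmP; split; first exact: dS.
  by apply/eqP; exact: DD.
- move=> v /imagemP[u hu <-]; apply/boundariesP; exists (f u); first by rewrite df.
  by rewrite -Df.
move=> w /cyclesP[hw Dw]; exists (g w).
  apply/capmP; split; first by rewrite -df gf.
  by have := congr1 g (Df (g w)); rewrite fg gf Dw -(lin0 lf) fg => e; apply/eqP.
have -> : w - mk_linear lf (g w) = 0 by rewrite -{1}(gf w) subrr.
exact: rpred0.
Qed.

End Koszul.

(** * Colons and powers for a sequence *)

Section PowersList.
Variables (R : comNzRingType) (M : lmodType R).
Implicit Types (l pre post : seq R).
Local Notation full := (full_submodule M).
Local Notation pows t l := (map (fun x : R => x ^+ t) l).

Lemma idl_eq_mem l l' : l =i l' -> idl M l =i idl M l'.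
Proof. by move=> e v; apply/idP/idP; apply: idl_mono => y; rewrite e. Qed.

Lemma mem_rot1 x (pre post : seq R) : (x :: post) ++ pre =i post ++ x :: pre.
Proof. by move=> y; rewrite !(mem_cat, inE); case: (y == x); rewrite ?orbT ?orbF. Qed.

Lemma homle_perm l l' i n : perm_eq l l' -> homle (kosM M l) i n -> homle (kosM M l') i n.
Proof. by move=> h; apply/homle_iso/kos_perm. Qed.

Lemma perm_rot1 x (pre post : seq R) : perm_eq ((x :: post) ++ pre) (post ++ x :: pre).
Proof. exact: (permEl (perm_catCA [:: x] post pre)). Qed.

(** The elements of [post] are raised to a power, those of [pre] are kept. The head x waits in [pre]
    while the rest of [post] is treated, and is then permuted to the front, where the cone estimate
    applies. *)
Lemma homle_pows t post pre h : homle (kosM M (post ++ pre)) 1 h ->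
  homle (kosM M (pows t.+1 post ++ pre)) 1 (t.+1 ^ size post * h).
Proof.
elim: post pre => [|x post IH] pre hh; first by rewrite mul1n.
rewrite expnS -mulnA; apply: homle_cone_exp.
apply: (@homle_perm (pows t.+1 post ++ x :: pre) (x :: pows t.+1 post ++ pre)).
  by rewrite perm_sym; exact: perm_rot1.
by apply: IH; apply: homle_perm hh; exact: perm_rot1.
Qed.

Lemma fin_idl_mono l l' : {subset idl M l <= idl M l'} -> finite_length (idl M l) full -> finite_length (idl M l') full.
Proof. by move=> h; apply: fin_mono. Qed.

(* The error term [size post * h] relative to [t.+1 ^ size post] does not depend on [t]. *)
Lemma len_pows t post pre h : finite_length (idl M (pows t.+1 post ++ pre)) full ->
  homle (kosM M (post ++ pre)) 1 h ->
  (t.+1 ^ size post * len (idl M (post ++ pre)) full <=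
   len (idl M (pows t.+1 post ++ pre)) full + size post * t.+1 ^ size post * h)%N.
Proof.
elim: post pre => [|x post IH] pre f hh; first by rewrite mul1n /= mul0n addn0.
have hh' : homle (kosM M (post ++ x :: pre)) 1 h by apply: homle_perm hh; exact: perm_rot1.
have s1 : {subset idl M ((x ^+ t.+1 :: pows t.+1 post) ++ pre) <=
    idl M (pows t.+1 post ++ x :: pre)}.
  apply: idl_sub => y v; rewrite mem_rot1 mem_cat !inE => hy.
  case: (eqVneq y (x ^+ t.+1)) => [->|ny].
    by rewrite exprS -scalerA; apply: mem_idlb; rewrite mem_cat mem_head orbT.
  apply: mem_idlb; rewrite mem_cat inE; move: hy; rewrite (negbTE ny) /=.
  by case/orP => ->; rewrite ?orbT.
have f' : finite_length (idl M (pows t.+1 post ++ x :: pre)) full by apply: fin_idl_mono f.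
have := IH _ f' hh'.
have h1 : homle (kosM M (x :: pows t.+1 post ++ pre)) 1 (t.+1 ^ size post * h).
  apply: (@homle_perm (pows t.+1 post ++ x :: pre)); last exact: homle_pows.
  by rewrite perm_sym; exact: perm_rot1.
have := len_addx_exp (x := x) (t := t.+1) isT f (homle_idl_colon h1).
rewrite -(len_extl full (idl_eq_mem (mem_rot1 x pre post))).
rewrite -(len_extl full (idl_eq_mem (mem_rot1 x pre (pows t.+1 post)))) /= expnS.
set a := len (addx (idl M (post ++ pre)) x) _; set b := len (addx _ x) _; set c := len _ _.
set T := (t.+1 ^ size post)%N; move: (t.+1) => s; rewrite -/(size post); nia.
Qed.

Lemma lenle_colon_idl l l' r n : l =i l' -> lenle (colon (idl M l) r) full n ->
  lenle (colon (idl M l') r) full n.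
Proof.
move=> e; apply: lenle_mono => // v; rewrite !mem_colon.
by rewrite (idl_eq_mem e).
Qed.

(** The exponent of each x is lowered from t.+1 to 1 modulo the powers of the later elements and the
    earlier elements themselves. Each lowering costs t times a bound for H_1 of such a mixed
    sequence, which [homle_pows] supplies. *)
Lemma lenle_colon_pows t post pre r h n : homle (kosM M (post ++ pre)) 1 h ->
  lenle (colon (idl M (pows t.+1 post ++ pre)) (r * (\prod_(x <- post) x) ^+ t)) full n ->
  lenle (colon (idl M (post ++ pre)) r) full (size post * t.+1 ^ size post * t * h + n).
Proof.
elim: post pre n => [|x post IH] pre n hh; first by rewrite big_nil expr1n mulr1.
have hh' : homle (kosM M (post ++ x :: pre)) 1 h by apply: homle_perm hh; exact: perm_rot1.
have h1 : homle (kosM M (x :: pows t.+1 post ++ pre)) 1 (t.+1 ^ size post * h).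
  apply: (@homle_perm (pows t.+1 post ++ x :: pre)); last exact: homle_pows.
  by rewrite perm_sym; exact: perm_rot1.
rewrite big_cons exprMn mulrCA mulrC.
move/(lenle_colon_exp (homle_idl_colon h1)).
move/(lenle_colon_idl (mem_rot1 x pre (pows t.+1 post)))/(IH _ _ hh').
move/(lenle_colon_idl (fun y => esym (mem_rot1 x pre post y))); apply: lenle_leq.
rewrite /= expnS addnA leq_add2r.
set T := (t.+1 ^ size post)%N; move: (size post) => k; nia.
Qed.
End PowersList.

(** * Noetherian modules and local rings *)

Section Noetherian.
Variables (R : comNzRingType) (V : lmodType R).
Implicit Types (P Q N S : submodClosed V) (l : seq V).

Definition adjs P l : submodClosed V := foldr (fun b Q => adj Q b) P l.

Lemma sub_adjs P l : {subset P <= adjs P l}.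
Proof. by elim: l => //= b l IH v /IH; exact: sub_adj. Qed.

Lemma mem_adjs P l b : b \in l -> b \in adjs P l.
Proof.
elim: l => //= c l IH; rewrite inE => /orP[/eqP ->|/IH]; first exact: mem_adj.
exact: sub_adj.
Qed.

Lemma adjs_sub P l N : {subset P <= N} -> {subset l <= N} -> {subset adjs P l <= N}.
Proof.
move=> PN; elim: l => //= b l IH h; apply: adj_sub; last by apply: h; rewrite mem_head.
by apply: IH => c cl; apply: h; rewrite inE cl orbT.
Qed.

Lemma adjs_mono P Q l : {subset P <= Q} -> {subset adjs P l <= adjs Q l}.
Proof. by move=> h; apply: adjs_sub => [v /h|v]; [exact: sub_adjs|exact: mem_adjs]. Qed.

Lemma adjs_split Q l v : v \in adjs Q l -> exists2 w, w \in Q & v - w \in adjs (zero_submod V) l.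
Proof.
elim: l v => [v vQ|b l IH v]; first by exists v => //; rewrite subrr rpred0.
case/adjP=> a /IH[w wQ h]; exists w => //.
by apply/adjP; exists a; rewrite addrAC.
Qed.

(* The interval [[P, Q]] of submodules is Noetherian. *)
Definition noeth P Q := forall N, {subset P <= N} -> {subset N <= Q} ->
  exists2 l, {subset l <= N} & {subset N <= adjs P l}.

Lemma noeth_trans P Q S : {subset P <= Q} -> {subset Q <= S} ->
  noeth P Q -> noeth Q S -> noeth P S.
Proof.
move=> PQ QS n1 n2 N PN NS.
have [|v /capmP[]//|l1 l1N N1] := n1 (capm N Q).
  by move=> v hv; apply/capmP; split; [exact: PN|exact: PQ].
have [||l2 l2N N2] := n2 (addm N Q); first exact: sub_addr.
  exact: add_sub.
(* Generators of N + Q over Q can be replaced by their components in N. *)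
have [l3 l3N N3] : exists2 l, {subset l <= N} & {subset adjs Q l2 <= adjs Q l}.
  elim: l2 l2N {N2} => [|b l2 IH] h; first by exists [::].
  have [|l hl hs] := IH; first by move=> v vl; apply: h; rewrite inE vl orbT.
  have /addmP[u [w [uN wQ e]]] := h _ (mem_head _ _).
  exists (u :: l) => [v|]; first by rewrite inE => /orP[/eqP ->|/hl].
  apply: adj_sub => [v /hs|]; first exact: sub_adj.
  rewrite e; apply: rpredD; first exact: mem_adj.
  by apply: sub_adj; exact: sub_adjs.
exists (l1 ++ l3) => [v|v vN]; first by rewrite mem_cat => /orP[/l1N /capmP[]|/l3N].
have /N2/N3/adjs_split[w wQ hw] : v \in addm N Q by exact: sub_addl.
have wN : w \in N.
  rewrite -[w](subKr v); apply: submodB => //.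
  by apply: adjs_sub hw => //; exact: zero_sub.
have /N1 : w \in capm N Q by exact/capmP.
move/(adjs_sub (@sub_adjs P (l1 ++ l3)) _) => h.
apply: (submod_subK (v := w)); last by apply: h => u ul; apply: mem_adjs; rewrite mem_cat ul.
apply: adjs_sub hw; first exact: zero_sub.
by move=> u ul; apply: mem_adjs; rewrite mem_cat ul orbT.
Qed.

Lemma noeth_refl P Q : {subset Q <= P} -> noeth P Q.
Proof. by move=> h N _ NQ; exists [::] => // v /NQ /h. Qed.
End Noetherian.

Section NoetherianModules.
Variables (R : comNzRingType) (V : lmodType R).
Implicit Types (P Q N S : submodClosed V) (l : seq V).

Lemma ideal_gen_idl d (x : 'I_d -> R) : ideal_gen x =i idl R^o (kseq x).
Proof.
move=> a; apply/idP/idP => [/asboolP h|].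
  by apply: h => b [i _ <-]; apply: mem_idl_self; exact: mem_kseq.
apply: idl_sub => b v /mapP[i _ ->].
have -> : x i *: v = v *: (x i : R^o) by rewrite /GRing.scale /= mulrC.
by apply: rpredZ; apply/asboolP => W h; apply: h; exists i.
Qed.

Hypothesis noethR : noetherian R.

Lemma noetherian_idl (I : ideal R) : exists xs : seq R, I =i idl R^o xs.
Proof.
by have [k [x e]] := noethR I; exists (kseq x) => a; rewrite e ideal_gen_idl.
Qed.

(** A submodule N between P and P + R b is determined by the ideal of all a with a b in N, and
    generators of this ideal give generators of N over P. *)
Lemma noeth_adj P b : noeth P (adj P b).
Proof.
move=> N PN NQ; have [xs e] := noetherian_idl (preimm (scale_vec b) N).
have xsN x : x \in xs -> x *: b \in N.
  move=> xl; have : x \in idl R^o xs by exact: mem_idl_self.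
  by rewrite -e.
exists [seq x *: b | x <- xs] => [v /mapP[x xl ->]|v vN]; first exact: xsN.
have /adjP[a h] := NQ _ vN; apply: (submod_subK (sub_adjs _ h)).
have : a \in idl R^o xs.
  rewrite -e; change (a *: b \in N); rewrite -[a *: b](subKr v).
  by apply: submodB => //; exact: PN.
suff : {subset idl R^o xs <= preimm (scale_vec b) (adjs P [seq x *: b | x <- xs])}.
  by move=> h1 /h1.
apply: idl_sub => x c xl; rewrite mem_preim.
change ((x * c) *: b \in adjs P [seq x *: b | x <- xs]).
by rewrite mulrC -scalerA rpredZ // mem_adjs //; exact: map_f.
Qed.

Lemma noeth_adjs P l : noeth P (adjs P l).
Proof.
elim: l => [|b l IH] /=; first exact: noeth_refl.
by apply: noeth_trans IH (@noeth_adj _ b); [exact: sub_adjs|exact: sub_adj].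
Qed.

Lemma generated_adjs k : generated_by V k <->
  exists2 l, size l = k & {subset full_submodule V <= adjs (zero_submod V) l}.
Proof.
split=> [[g hg]|[l sl hl]].
  exists [seq g i | i <- enum 'I_k]; first by rewrite size_map size_enum_ord.
  move=> v _; have /asboolP := hg v; apply=> _ [i _ <-].
  by apply: mem_adjs; apply: map_f; rewrite mem_enum.
exists (fun i : 'I_k => nth 0 l i) => v; apply/asboolP => W hW.
have : v \in adjs (zero_submod V) l by exact: hl.
apply: adjs_sub; first exact: zero_sub.
move=> b /(nthP 0)[i]; rewrite sl => ik <-; apply: hW.
by exists (Ordinal ik).
Qed.

Lemma finitely_generated_adjs : finitely_generated V <->
  exists l, {subset full_submodule V <= adjs (zero_submod V) l}.
Proof.
split=> [[k /generated_adjs[l _ h]]|[l h]]; first by exists l.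
by exists (size l); apply/generated_adjs; exists l.
Qed.

Lemma noeth_fg N : finitely_generated V ->
  exists2 l, {subset l <= N} & {subset N <= adjs (zero_submod V) l}.
Proof.
case/finitely_generated_adjs=> l hl; apply: (@noeth_adjs (zero_submod V) l).
  exact: zero_sub.
by move=> v _; exact: hl.
Qed.

(** Without a maximal member, choice would give a strictly increasing sequence; its union is
    finitely generated and so contained in one of its members. The lemma supplies maximal ideals,
    primes lying over a prime, stationary sequences, submodules avoiding an element and prime
    filtrations. *)
Lemma max_submod (F : submodClosed V -> Prop) N0 : finitely_generated V -> F N0 ->
  exists N, [/\ F N, {subset N0 <= N} & forall N', F N' -> {subset N <= N'} -> {subset N' <= N}].
Proof.
move=> fgV FN0.
pose G N := F N /\ {subset N0 <= N}.
apply: contrapT => /forallNP noN.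
have step (N : {N | G N}) : {N' : {N | G N} |
    {subset sval N <= sval N'} /\ ~ {subset sval N' <= sval N}}.
  apply: cid; case: N => N [FN hN] /=; apply: contrapT => /forallNP h; apply: (noN N).
  split=> // N' FN' NN'; apply: contrapT => nN'.
  have GN' : G N' by split=> // v /hN /NN'.
  by apply: (h (exist _ N' GN')).
have G0 : G N0 by split.
pose c n := sval (iter n (fun X => sval (step X)) (exist G N0 G0)).
have cS n : {subset c n <= c n.+1} /\ ~ {subset c n.+1 <= c n}.
  by rewrite /c iterS; case: (step _).
have c_mono i j : (i <= j)%N -> {subset c i <= c j}.
  move/subnKC <-; elim: (j - i)%N => [|k IH]; first by rewrite addn0.
  by rewrite addnS => v /IH; exact: (cS _).1.
pose U : {pred V} := fun v => `[< exists n, v \in c n >].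
have Uc : submod_closed U.
  split; first by apply/asboolP; exists 0%N; exact: rpred0.
  move=> a u v /asboolP[i hi] /asboolP[j hj]; apply/asboolP; exists (maxn i j).
  apply: rpredD; last exact: (c_mono _ _ (leq_maxr i j)).
  by apply: rpredZ; exact: (c_mono _ _ (leq_maxl i j)).
have [l lU Ul] := noeth_fg (of_closed Uc) fgV.
have [n hn] : exists n, {subset l <= c n}.
  elim: l lU {Ul} => [|b l IH] lU; first by exists 0%N.
  have [|n hn] := IH; first by move=> v vl; apply: lU; rewrite inE vl orbT.
  have /asboolP[k hk] := lU b (mem_head _ _).
  exists (maxn n k) => v; rewrite inE => /orP[/eqP ->|/hn hv].
    exact: (c_mono _ _ (leq_maxr n k)).
  exact: (c_mono _ _ (leq_maxl n k)).
case: (cS n) => _; apply => v hv.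
have : v \in adjs (zero_submod V) l by apply: Ul; apply/asboolP; exists n.+1.
by apply: adjs_sub => //; exact: zero_sub.
Qed.
End NoetherianModules.

Section LocalRings.
Variables (R : comNzRingType) (m : ideal R).

Lemma fg_regular : finitely_generated (R^o : lmodType R).
Proof.
apply/finitely_generated_adjs; exists [:: 1] => a _; apply/adjP; exists a.
by rewrite mem_zero /GRing.scale /= mulr1 subrr.
Qed.

Lemma local_unit : local_noetherian m -> forall a, a \notin m -> exists c, c * a = 1.
Proof.
move=> [noethR _ uniq_m] a am; apply: contrapT => /forallNP na.
pose I : ideal R := adjs (zero_submod R^o) [:: a].
have I1 : 1 \notin I.
  apply/negP => /adjP[c]; rewrite mem_zero subr_eq0 => /eqP e.
  by apply: (na c); rewrite e.
have [J [J1 IJ Jmax]] := max_submod noethR (F := fun J : ideal R => 1 \notin J) fg_regular I1.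
have /uniq_m e : maximal_ideal J by split.
by move: am; rewrite -e IJ //; apply: mem_adjs; rewrite mem_head.
Qed.

Lemma one_notin : local_noetherian m -> 1 \notin m.
Proof. by case=> _ []. Qed.

Lemma unit_one_sub : local_noetherian m -> forall a, a \in m -> exists c, c * (1 - a) = 1.
Proof.
move=> loc a am; apply: local_unit => //; apply/negP => h.
by have := one_notin loc; rewrite -[X in X \notin _](subrK a) rpredD.
Qed.
End LocalRings.

Lemma ideal_mull (R : comNzRingType) (I : ideal R) (c a : R) : a \in I -> c * a \in I.
Proof. by move=> h; have := rpredZ c (h : (a : R^o) \in I). Qed.

Section LocalModules.
Variables (R : comNzRingType) (m : ideal R).
Hypothesis loc : local_noetherian m.
Variable V : lmodType R.
Implicit Types (P Q N S : submodClosed V) (b v : V) (l : seq V).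
Local Notation full := (full_submodule V).

Lemma lenle_max : lenle m (full_submodule R^o) 1.
Proof.
move=> k; case=> // Q Q' j; case=> // Q1 Q2 i c _ n12 _ n2'; exfalso.
have [b bQ2 bQ1] : exists2 b, b \in Q2 & b \notin Q1.
  apply: contrapT => h; apply: n12 => b bQ2; apply: contrapT => /negP bQ1.
  by apply: h; exists b.
have [c' cb] : exists c, c * b = 1.
  by apply: local_unit loc _ _; apply/negP => /(chain_sub c); exact/negP.
apply: n2' => a _; have -> : a = (a * c') *: (b : R^o).
  by rewrite /GRing.scale /= -mulrA cb mulr1.
exact: rpredZ.
Qed.

Lemma lenle_adj P b : (forall a, a \in m -> a *: b \in P) -> lenle P (adj P b) 1.
Proof.
move=> h; apply: (lenle_surj (f := scale_vec b)) lenle_max => //.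
by move=> w /adjP[a ha]; exists a.
Qed.

Lemma lenle_adjs P l : (forall a b, a \in m -> b \in l -> a *: b \in P) ->
  lenle P (adjs P l) (size l).
Proof.
elim: l => [|b l IH] h; first exact: lenle_refl.
rewrite -[size _]addn1; apply: (lenle_trans (Q := adjs P l)).
- exact: sub_adjs.
- exact: sub_adj.
- by apply: IH => a c am cl; apply: h => //; rewrite inE cl orbT.
by apply: lenle_adj => a am; apply/sub_adjs/h => //; exact: mem_head.
Qed.

(** Q1 is the last proper step of a longest chain, so Q / Q1 is a simple module, generated by the
    class of b and killed by m. Inductions on length remove this top composition factor. *)
Lemma len_step P Q n : lenle P Q n -> {subset P <= Q} -> ~ {subset Q <= P} ->
  exists k Q1 b, [/\ (k < n)%N, lenle P Q1 k, {subset P <= Q1}, {subset Q1 <= Q} &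
    [/\ b \in Q, b \notin Q1, {subset Q <= adj Q1 b} &
        forall a v, a \in m -> v \in Q -> a *: v \in Q1]].
Proof.
move=> hn PQ nQP; have [cl hl] := lenP PQ (lenle_fin hn).
have ln := len_leq hn; move: {hn} (len P Q) cl hl ln => k c.
case: c PQ nQP => [{}Q h PQ nQP hl _|Q1 {}Q {}k c h nh PQ nQP hl kn].
  have : chain P Q 1 by apply: chainS (chain0 (Q := P) _) _ nQP.
  by move/hl.
have h1 : lenle Q1 Q 1 by move=> j /(chain_cat c) /hl; rewrite -addn1 leq_add2l.
have [b bQ bQ1] : exists2 b, b \in Q & b \notin Q1.
  apply: contrapT => h'; apply: nh => b bQ; apply: contrapT => /negP bQ1.
  by apply: h'; exists b.
have gen b' : b' \in Q -> b' \notin Q1 -> {subset Q <= adj Q1 b'}.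
  move=> b'Q b'Q1; apply: contrapT => nQ.
  have c2 : chain Q1 Q 2.
    apply: (chainS (Q := adj Q1 b')) nQ; last exact: adj_sub.
    apply: (chainS (Q := Q1)); [exact: chain0|exact: sub_adj|].
    by move=> /(_ _ (mem_adj _ _)); exact/negP.
  by have := h1 _ c2.
exists k, Q1, b; split=> //.
- by move=> j cj; rewrite -ltnS; apply: hl; exact: chainS cj h nh.
- exact: chain_sub c.
split=> //; first exact: gen.
(* If a v were outside Q1, it would generate Q over Q1; then v = c a v modulo Q1, where 1 - c a is a
   unit. *)
move=> a v am vQ; apply: contrapT => /negP nav.
have avQ : a *: v \in Q by exact: rpredZ.
have /adjP[c' hc] := gen _ avQ nav _ vQ.
have [e he] : exists e, e * (1 - c' * a) = 1.
  by apply: unit_one_sub loc _ _; exact: ideal_mull.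
suff vQ1 : v \in Q1 by move: nav; rewrite rpredZ.
have -> : v = e *: (v - c' *: (a *: v)).
  by rewrite scalerA -{2}[v]scale1r -scalerBl scalerA he scale1r.
exact: rpredZ.
Qed.

(** Each factor of the product moves q down by at least one step of a composition series. *)
Lemma prod_mem P Q n (s : seq R) q : {subset P <= Q} -> lenle P Q n -> (n <= size s)%N ->
  (forall a, a \in s -> a \in m) -> q \in Q -> (\prod_(a <- s) a) *: q \in P.
Proof.
elim: n Q s q => [|n IH] Q s q PQ hn hs sm qQ; case: (pselect {subset Q <= P}) => QP.
- by rewrite rpredZ // QP.
- by have [k [Q1 [b []]]] := len_step hn PQ QP.
- by rewrite rpredZ // QP.
have [k [Q1 [b [kn h1 PQ1 Q1Q [_ _ _ mQ]]]]] := len_step hn PQ QP.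
case: s hs sm => // a s hs sm; rewrite big_cons mulrC -scalerA.
apply: (IH Q1) => //; first exact: lenle_leq h1.
  by move=> c cs; apply: sm; rewrite inE cs orbT.
by apply: mQ => //; apply: sm; exact: mem_head.
Qed.

Lemma comp_series P Q n : {subset P <= Q} -> lenle P Q n ->
  exists l, [/\ (size l <= n)%N, {subset l <= Q} & {subset Q <= adjs P l}].
Proof.
elim/ltn_ind: n Q => n IH Q PQ hn; case: (pselect {subset Q <= P}) => QP; first by exists [::].
have [k [Q1 [b [kn h1 PQ1 Q1Q [bQ _ gen _]]]]] := len_step hn PQ QP.
have [l [sl lQ1 hl]] := IH k kn Q1 PQ1 h1.
exists (b :: l) => /=; split; first exact: leq_ltn_trans kn.
  by move=> v; rewrite inE => /orP[/eqP ->|/lQ1 /Q1Q].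
move=> v /gen; apply: adj_sub; last exact: mem_adj.
by move=> w /hl; exact: sub_adj.
Qed.

Lemma nakayama N l (xs : seq R) : (forall x, x \in xs -> x \in m) ->
  {subset full <= adjs N l} -> {subset full <= addm N (idl V xs)} -> {subset full <= N}.
Proof.
move=> xm + hN; elim: l => //= g l IH hg; apply: IH => v _.
pose Qp : {pred V} := fun w => `[< exists2 a, a \in m & w - a *: g \in adjs N l >].
have Qc : submod_closed Qp.
  split; first by apply/asboolP; exists 0; rewrite ?rpred0 // scale0r subr0 rpred0.
  move=> c u w /asboolP[a am ha] /asboolP[a' am' ha']; apply/asboolP.
  exists (c * a + a'); first by apply: (rpredD (S := m)) => //; exact: ideal_mull.
  by rewrite scalerDl -scalerA opprD addrACA -scalerBr rpredD ?rpredZ.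
have NQ : {subset addm N (idl V xs) <= of_closed Qc}.
  apply: add_sub => [w wN|].
    by apply/asboolP; exists 0; rewrite ?rpred0 // scale0r subr0 sub_adjs.
  apply: idl_sub => x w /xm xm'; have /adjP[c hc] : w \in adj (adjs N l) g by exact: hg.
  apply/asboolP; exists (x * c); first by rewrite mulrC; exact: ideal_mull.
  by rewrite -scalerA -scalerBr rpredZ.
have /NQ/asboolP[a am ha] : g \in addm N (idl V xs) by exact: hN.
have [e he] := unit_one_sub loc am.
have gN : g \in adjs N l.
  have -> : g = e *: (g - a *: g) by rewrite -{2}[g]scale1r -scalerBl scalerA he scale1r.
  exact: rpredZ.
by have := hg v isT; apply: adj_sub.
Qed.

Lemma nuP : finitely_generated V ->
  generated_by V (nu V) /\ forall j, generated_by V j -> (nu V <= j)%N.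
Proof.
case=> k hk.
have ex : exists k, `[< generated_by V k >] by exists k; exact/asboolP.
case: (ex_minnP ex) => n /asboolP hn nmin.
apply: (@xgetPex _ 0%N [set k | generated_by V k /\
  forall j, generated_by V j -> (k <= j)%N]%classic).
by exists n; split=> // j hj; apply: nmin; exact/asboolP.
Qed.

Lemma nu_gt0 : finitely_generated V -> (exists v : V, v != 0) -> (0 < nu V)%N.
Proof.
move=> fg [v v0]; have [/generated_adjs[l]] := nuP fg; case: posnP => // -> /size0nil -> h _.
by have := h v isT; rewrite mem_zero (negbTE v0).
Qed.

(** By Nakayama's lemma, generators of the composition factors of V / (xs) V generate V. *)
Lemma nu_le_len (xs : seq R) n : finitely_generated V -> (forall x, x \in xs -> x \in m) ->
  lenle (idl V xs) full n -> (nu V <= n)%N.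
Proof.
move=> fg xm hn; have [l [sl _ hl]] := comp_series (@sub_full _ _ _) hn.
apply: leq_trans sl; apply: (nuP fg).2; apply/generated_adjs; exists l => //.
have /finitely_generated_adjs[l' hl'] := fg.
apply: (nakayama (l := l') xm).
  by move=> v /hl'; apply: adjs_mono; exact: zero_sub.
move=> v /hl /adjs_split[w wI h]; apply/addmP; exists (v - w), w; split=> //.
by rewrite subrK.
Qed.

Lemma lenle_fg (xs : seq R) : finitely_generated V -> (forall x, x \in m -> x \in idl R^o xs) ->
  exists n, lenle (idl V xs) full n.
Proof.
case/finitely_generated_adjs=> l hl mxs; exists (size l).
apply: lenle_mono (lenle_adjs (P := idl V xs) (l := l) _) => //.
  by move=> v /hl; apply: adjs_mono; exact: zero_sub.
by move=> a b /mxs am _; exact: idl_scale.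
Qed.

(** The analogue of [sop] for a sequence of arbitrary length. *)
Definition primary (xs : seq R) :=
  (forall x, x \in xs -> x \in m) /\ (forall a, a \in m -> exists k, a ^+ k \in idl R^o xs).

Lemma idealX (I : ideal R) (a : R) i j : (i <= j)%N -> a ^+ i \in I -> a ^+ j \in I.
Proof. by move=> /subnK <-; rewrite exprD => h; exact: ideal_mull. Qed.

Lemma primary_exp (xs ys : seq R) : (forall y, y \in ys -> y \in m) -> primary xs ->
  exists t, forall y, y \in ys -> y ^+ t \in idl R^o xs.
Proof.
move=> + [_ hx]; elim: ys => [|y ys IH] h; first by exists 0%N.
have [|t hN] := IH; first by move=> z zy; apply: h; rewrite inE zy orbT.
have [k hk] := hx _ (h _ (mem_head _ _)); exists (maxn t k) => z.
rewrite inE => /orP[/eqP ->|/hN]; first exact: idealX (leq_maxr _ _) hk.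
exact: idealX (leq_maxl _ _).
Qed.

Lemma fin_pows (ms : seq R) t : finitely_generated V -> (forall x, x \in m -> x \in idl R^o ms) ->
  finite_length (idl V (map (fun x : R => x ^+ t) ms)) full.
Proof.
move=> fg mms; have [n hn] := lenle_fg fg mms.
by exists (t ^ size ms * n)%N; exact: lenle_idlb_pows.
Qed.

Lemma ideal_gens : exists ms : seq R, m =i idl R^o ms /\ forall x, x \in ms -> x \in m.
Proof.
have [noethR _ _] := loc; have [ms em] := noetherian_idl noethR m; exists ms; split=> // y ym.
by rewrite em; exact: mem_idl_self.
Qed.

(** For generators ms of m, the ideal (xs) contains the t-th powers of all members of ms for some t,
    and modulo these powers the length is finite. *)
Lemma fin_primary (xs : seq R) : finitely_generated V -> primary xs -> finite_length (idl V xs) full.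
Proof.
move=> fg px; have [ms [em msm]] := ideal_gens; have [t ht] := primary_exp msm px.
have [|n hn] := fin_pows (ms := ms) t fg; first by move=> x; rewrite em.
exists n; apply: lenle_mono hn => //; apply: idl_incl => y.
by case/mapP=> x xm ->; exact: ht.
Qed.
End LocalModules.

(** * Tensor products and closures *)

Section HasLength.
Variables (R : comNzRingType) (V : lmodType R).

Lemma strict_chainP k : strict_chain (fun S : {pred V} => submod_closed S) k <->
  chain (zero_submod V) (full_submodule V) k.
Proof.
split=> [[c [hc hs]]|].
  suff h i : (i <= k)%N -> forall hi : submod_closed (c i), chain (zero_submod V) (of_closed hi) i.
    by have := chain_mono (h k (leqnn k) (hc k (leqnn k))); apply; exact: sub_full.
  elim: i => [|i IH] ik hi; first by apply: chain0; exact: zero_sub.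
  have hci := hc i (ltnW ik); have [h1 h2] := hs i ik.
  apply: (chainS (Q := of_closed hci)); [exact: IH (ltnW ik) hci|exact: h1|exact: h2].
suff h (Q : submodClosed V) : chain (zero_submod V) Q k ->
    exists c : nat -> submodClosed V, {subset c k <= Q} /\
      forall i, (i < k)%N -> {subset c i <= c i.+1} /\ ~ {subset c i.+1 <= c i}.
  case/h=> c [_ hc]; exists (fun i => (c i : {pred V})); split=> // i _.
  by split=> [|a u v hu hv]; rewrite ?rpred0 ?rpredD ?rpredZ.
elim=> [{}Q h|{}Q Q' {}k _ [c [cQ hc]] h nh].
  by exists (fun=> zero_submod V); split=> //; exact: zero_sub.
exists (fun i => if (i <= k)%N then c i else Q'); rewrite ltnn; split=> // i.
rewrite ltnS => ik; rewrite ik; case: ltnP => ik'; first exact: hc.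
have -> : i = k by apply/eqP; rewrite eqn_leq ik ik'.
split=> [v /cQ|hQ]; first exact: h.
by apply: nh => v /hQ /cQ.
Qed.

Lemma has_length_lenle n : has_length V n -> lenle (zero_submod V) (full_submodule V) n.
Proof. by move=> [_ h] k /strict_chainP /h. Qed.

Lemma has_length_len : finite_length (zero_submod V) (full_submodule V) ->
  has_length V (len (zero_submod V) (full_submodule V)).
Proof.
move=> f; have [c h] := lenP (@zero_sub _ _ _) f.
by split=> [|k /strict_chainP /h]; first exact/strict_chainP.
Qed.

End HasLength.

Section HasLengthSub.
Variables (R : comNzRingType) (V : lmodType R).

Lemma has_length_sub (S : submodClosed V) n :
  has_length (submodule S) n -> lenle (zero_submod V) S n.
Proof.
move=> h0; have := has_length_lenle h0; apply: (lenle_surj (f := @submodule_val R V S)) => //.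
- by move=> w wS; exists (Submodule wS) => //=; rewrite subrr rpred0.
Qed.

Lemma has_length_subI (S : submodClosed V) n : lenle (zero_submod V) S n ->
  exists2 k, has_length (submodule S) k & (k <= n)%N.
Proof.
move=> h; suff h' : lenle (zero_submod (submodule S)) (full_submodule (submodule S)) n.
  by exists (len (zero_submod (submodule S)) (full_submodule (submodule S)));
    [apply: has_length_len; exists n|exact: len_leq].
apply: (lenle_inj (f := @submodule_val R V S)) h.
- exact: zero_sub.
- by case.
- by move=> v _; rewrite !mem_zero => /eqP h; apply/eqP/val_inj; exact: h.
Qed.

Lemma has_length_quotient (A : submodClosed V) n :
  has_length (quotient_module A) n -> lenle A (full_submodule V) n.
Proof.
move=> h0; have := has_length_lenle h0; apply: (lenle_inj (f := @quotient_proj R V A)) => //.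
move=> v _; rewrite mem_zero => /eqP e.
have : quotient_proj A v = quotient_proj A 0 by rewrite e linear0.
by move/quotient_projP; rewrite subr0.
Qed.
End HasLengthSub.

Lemma has_length_homology (R : comNzRingType) (M : lmodType R) d (x : 'I_d -> R) i n :
  has_length (koszul_homology M x i) n -> homle (kosM M (kseq x)) i n.
Proof.
move=> h0; have h := has_length_quotient h0; apply: homle_koszul.
apply: (lenle_surj (f := @submodule_val R _ (koszul_cycles M x i))) h => //.
by move=> w wS; exists (Submodule wS) => //=; rewrite subrr rpred0.
Qed.

Section Tensor.
Variables (R : comNzRingType) (M N : lmodType R).

Definition pure_tensor (q : N) (u : M) : tensor M N := tensor_class [:: (u, q)].

Lemma pure_tensor_linear q : linear (pure_tensor q).
Proof.
move=> a u v; rewrite [RHS]/(_ + _) /pure_tensor.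
have -> : a *: tensor_class [:: (u, q)] = tensor_class [:: (a *: u, q)].
  exact: tensor_scale_class.
rewrite [RHS]tensor_add_class; apply/tensor_classP; exact: tensor_addl.
Qed.
HB.instance Definition _ q := GRing.isLinear.Build R M (tensor M N) *:%R (pure_tensor q) (pure_tensor_linear q).

Lemma pure_tensorDr q q' u : pure_tensor (q + q') u = pure_tensor q u + pure_tensor q' u.
Proof. by rewrite [RHS]tensor_add_class; apply/tensor_classP; exact: tensor_addr. Qed.

Lemma pure_tensorZr a q u : pure_tensor (a *: q) u = pure_tensor q (a *: u).
Proof. by apply/tensor_classP; apply: tensor_sym; exact: tensor_bal. Qed.

Lemma pure_tensor0r u : pure_tensor 0 u = 0.
Proof. by rewrite -(scale0r (0 : N)) pure_tensorZr scale0r linear0. Qed.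

Lemma tensor_class_cons p s : tensor_class (p :: s) = pure_tensor p.2 p.1 + tensor_class s :> tensor M N.
Proof. by case: p => u q; rewrite [RHS]tensor_add_class. Qed.
End Tensor.

Section TensorQuotient.
Variables (R : comNzRingType) (M F B P : lmodType R) (A : submodClosed B) (Z : submodClosed P).
Variables (pi : {linear F -> B}) (beta : M -> F -> P).
Hypothesis pi_surj : forall b, exists w, pi w = b.
Hypothesis beta_l : forall w, linear (beta^~ w).
Hypothesis beta_r : forall u, linear (beta u).
Hypothesis beta_Z : forall u w, pi w \in A -> beta u w \in Z.

(* [beta] induces a map from [M (x) (B / A)] to [P / Z], for [B] a quotient of [F]. *)
Lemma pure_tensor_eq0 u w : pure_tensor (quotient_proj A (pi w)) u = 0 -> beta u w \in Z.
Proof.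
have lift_ex (q : quotient_module A) : exists w, quotient_proj A (pi w) = q.
  by have [v e] := pi_surj (repr q); exists v; rewrite e quotient_reprK.
(* The chosen preimages are not additive in q; [bz] below shows that modulo Z this does not
   matter. *)
pose lift q := projT1 (cid (lift_ex q)).
have liftK q : quotient_proj A (pi (lift q)) = q by rewrite /lift; case: (cid _).
have bz v v' u' : quotient_proj A (pi v) = quotient_proj A (pi v') -> beta u' v - beta u' v' \in Z.
  move=> /quotient_projP; rewrite -linearB => /beta_Z => /(_ u').
  by rewrite -(linN (beta_r u')) -(linD (beta_r u')).
pose Phi (s : seq (M * quotient_module A)) := \sum_(p <- s) beta p.1 (lift p.2).
have PhiP s t : tensor_eq s t -> Phi s - Phi t \in Z.
  elim=> {s t}.
  - by move=> s; rewrite subrr rpred0.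
  - by move=> s t _ h; rewrite -opprB submodN.
  - by move=> s t r _ h1 _ h2; rewrite -(subrK (Phi t) (Phi s)) -addrA rpredD.
  - by move=> s s' t t' _ h1 _ h2; rewrite /Phi !big_cat /= opprD addrACA rpredD.
  - by move=> s t; rewrite /Phi !big_cat /= addrC subrr rpred0.
  - by move=> n; rewrite /Phi big_seq1 big_nil subr0 (lin0 (beta_l _)) rpred0.
  - move=> v v' n; rewrite /Phi big_seq1 !big_cons big_nil addr0 /=.
    by rewrite (linD (beta_l _)) subrr rpred0.
  - move=> v n n'; rewrite /Phi big_seq1 !big_cons big_nil addr0 /=.
    rewrite -(linD (beta_r _)); apply: bz.
    by rewrite linearD quotient_projD !liftK.
  - move=> a v n; rewrite /Phi !big_seq1 /= (linZ (beta_l _)) -(linZ (beta_r _)).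
    by apply: bz; rewrite linearZ_LR -quotient_scale_proj !liftK.
move=> /(tensor_classP [:: _] [::]) /PhiP; rewrite /Phi big_seq1 big_nil subr0 /= => h.
by apply: submod_subK h; apply: bz; rewrite liftK.
Qed.
End TensorQuotient.

Definition little_o (alpha g : nat -> nat) := forall eps : rat, 0 < eps ->
  exists n0, forall n, (n0 <= n)%N -> (g n)%:R <= eps * (alpha n)%:R.

Section Small.
Implicit Types (alpha g h : nat -> nat).

Lemma small_le alpha g h : (forall n, (g n <= h n)%N) -> little_o alpha h -> little_o alpha g.
Proof.
move=> gh hs eps e0; have [n0 hn] := hs eps e0; exists n0 => n /hn; apply: le_trans.
by rewrite ler_nat.
Qed.

Lemma small0 alpha : little_o alpha (fun=> 0%N).
Proof. by move=> eps e0; exists 0%N => n _; rewrite mulr_ge0 // ltW. Qed.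

Lemma smallD alpha g h : little_o alpha g -> little_o alpha h -> little_o alpha (fun n => g n + h n)%N.
Proof.
move=> hg hh eps e0; have e2 : 0 < eps / 2%:R by rewrite divr_gt0.
have [n1 h1] := hg _ e2; have [n2 h2] := hh _ e2; exists (maxn n1 n2) => n.
rewrite geq_max => /andP[/h1 {}h1 /h2 {}h2]; rewrite natrD; lra.
Qed.

Lemma smallM alpha g c : little_o alpha g -> little_o alpha (fun n => c * g n)%N.
Proof.
move=> hg; elim: c => [|c IH]; first by apply: small_le (small0 alpha) => n; rewrite mul0n.
by apply: small_le (smallD hg IH) => n; rewrite mulSn.
Qed.

Lemma small_alpha alpha beta g : (forall n, (alpha n <= beta n)%N) -> little_o alpha g -> little_o beta g.
Proof.
move=> ab hg eps e0; have [n0 hn] := hg eps e0; exists n0 => n /hn /le_trans; apply.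
by rewrite ler_pM2l // ler_nat.
Qed.

(** For eps = 1/2 one gets alpha n <= c g n <= alpha n / 2 for large n. Parts (a) and (b) both end
    with this contradiction. *)
Lemma small_absurd alpha g c : (forall n, (0 < alpha n)%N) -> (forall n, (alpha n <= c * g n)%N) ->
  ~ little_o alpha g.
Proof.
move=> a0 ag /(smallM c)/(_ (1 / 2%:R) isT)[n /(_ n (leqnn n))].
have := a0 n; have := ag n; rewrite -(ler_nat rat) -(ltr_nat rat); lra.
Qed.
End Small.

Lemma quotient_projZ (R : comNzRingType) (B : lmodType R) (A : submodClosed B) a b :
  quotient_proj A (a *: b) = a *: quotient_proj A b.
Proof. by rewrite -quotient_scale_proj. Qed.

Lemma quotient_proj_eq0 (R : comNzRingType) (B : lmodType R) (A : submodClosed B) b :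
  b \in A -> quotient_proj A b = 0.
Proof.
move=> bA; rewrite -(linear0 (@quotient_proj R B A)); apply/quotient_projP.
by rewrite subr0.
Qed.

Section Closure.
Variables (R : comNzRingType) (m : ideal R) (M : nat -> lmodType R) (alpha : nat -> nat).
Hypothesis loc : local_noetherian m.
Hypothesis fgM : forall n, finitely_generated (M n).
Variable B : lmodType R.
Implicit Types (A : submodClosed B) (b : B).
Local Notation full := (full_submodule _).

Definition tker n A b : submodClosed (M n) :=
  ker_pred (pure_tensor (quotient_proj A b) : M n -> tensor (M n) (quotient_module A)).

Lemma tkerP n A b u : reflect (pure_tensor (quotient_proj A b) u = 0) (u \in tker n A b).
Proof. exact: eqP. Qed.

(* The submodule [M n (x) (R b + A) / A] of [M n (x) B / A] is [M n / tker n A b]. *)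
Definition tsmall A b := exists2 g, (forall n, lenle (tker n A b) full (g n)) & little_o alpha g.

Lemma tsmall0 A b : b \in A -> tsmall A b.
Proof.
move=> bA; exists (fun=> 0%N); last exact: small0.
move=> n; apply: lenle_refl => u _; apply/tkerP.
by rewrite quotient_proj_eq0 // pure_tensor0r.
Qed.

Lemma lenle_cap (V : lmodType R) (X Y : submodClosed V) j k :
  lenle X full j -> lenle Y full k -> lenle (capm X Y) full (k + j).
Proof.
move=> hj hk; apply: (lenle_trans (Q := X)) hj => //; first by move=> v /capmP[].
apply: (lenle_inj (f := idfun)) hk => // v vX vY; exact/capmP.
Qed.

Lemma tsmall_closed A : submod_closed [pred b | `[< tsmall A b >]].
Proof.
split; first by apply/asboolP/tsmall0; exact: rpred0.
move=> a b c /asboolP[g hg sg] /asboolP[h hh sh]; apply/asboolP.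
exists (fun n => h n + g n)%N; last exact: smallD.
move=> n; apply: lenle_mono (lenle_cap (hg n) (hh n)) => // u /capmP[/tkerP h1 /tkerP h2].
apply/tkerP; rewrite quotient_projD pure_tensorDr h2 addr0 quotient_projZ pure_tensorZr.
by rewrite (linZ (pure_tensor_linear _)) h1 scaler0.
Qed.
Definition tsmall_sub A : submodClosed B := of_closed (tsmall_closed A).

Lemma tsmall_subP A b : reflect (tsmall A b) (b \in tsmall_sub A).
Proof. exact: asboolP. Qed.

Definition tsum n A (l : seq B) : submodClosed (tensor (M n) (quotient_module A)) :=
  foldr (fun b S => addm (imagem (pure_tensor (quotient_proj A b)) (full_submodule (M n))) S)
    (zero_submod _) l.

Lemma lenle_addm (V : lmodType R) (X Y : submodClosed V) j k :
  lenle (zero_submod V) X j -> lenle (zero_submod V) Y k ->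
  lenle (zero_submod V) (addm X Y) (j + k).
Proof.
move=> hj hk; apply: (lenle_trans (Q := X)) hj _; first exact: zero_sub.
  exact: sub_addl.
apply: (lenle_surj (f := idfun)) hk; first exact: zero_sub.
  exact: zero_sub.
by move=> w /addmP[x [y [xX yY ->]]]; exists y; rewrite //= addrK.
Qed.

Lemma lenle_tsum A (l : seq B) : {subset l <= tsmall_sub A} ->
  exists2 g, (forall n, lenle (zero_submod _) (tsum n A l) (g n)) & little_o alpha g.
Proof.
elim: l => [|b l IH] hl.
  by exists (fun=> 0%N); [move=> n; exact: lenle_refl|exact: small0].
have [|g hg sg] := IH; first by move=> c cl; apply: hl; rewrite inE cl orbT.
have /tsmall_subP[h hh sh] := hl b (mem_head _ _).
exists (fun n => h n + g n)%N; last exact: smallD.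
move=> n; apply: lenle_addm (hg n).
apply: (lenle_surj (f := pure_tensor (quotient_proj A b))) (hh n) => //.
by move=> w /imagemP[u _ <-]; exists u; rewrite // subrr rpred0.
Qed.

Lemma pure_tensor_tsum n A (l : seq B) b u : b \in adjs A l -> pure_tensor (quotient_proj A b) u \in tsum n A l.
Proof.
elim: l b u => [|c l IH] b u.
  by move=> /= bA; rewrite quotient_proj_eq0 // pure_tensor0r rpred0.
case/adjP=> a /IH h; rewrite -(subrK (a *: c) b) quotient_projD pure_tensorDr rpredD //.
  exact/sub_addr/h.
by rewrite quotient_projZ pure_tensorZr; apply/sub_addl/mem_imagem.
Qed.

Lemma tensor_image_sub A (C : submodClosed B) n
    (S : submodClosed (tensor (M n) (quotient_module A))) :
  (forall b u, b \in C -> pure_tensor (quotient_proj A b) u \in S) ->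
  {subset (tensor_image M A C n : submodClosed _) <= S}.
Proof.
move=> h; suff hs s : tensor_class (map_terms (@submodule_val R _ (sub_quotient A C)) s) \in S.
  by move=> w /imagemP[p _ <-]; exact: hs.
elim: s => [|[u [q hq]] s IH]; first exact: (rpred0 S).
rewrite /map_terms /= tensor_class_cons rpredD //=.
by have /imagemP[c cC <-] := hq; exact: h.
Qed.

Lemma mem_tensor_image A (C : submodClosed B) n b u : b \in C ->
  pure_tensor (quotient_proj A b) u \in (tensor_image M A C n : submodClosed _).
Proof.
move=> bC; have hb : quotient_proj A b \in (sub_quotient A C : submodClosed _) by exact: mem_imagem.
apply/imagemP; exists (tensor_class [:: (u, Submodule hb)]) => //.
exact: tensor_map_class.
Qed.

(** The elements b with [tsmall A b] form a submodule. As B / A has finite length, it is generated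
    over A by finitely many elements, whose number does not depend on n, so its tensor image is a
    finite sum of small images and it is admissible. Conversely, an admissible submodule has only
    such elements. *)
Lemma closure_flP A b : finite_length A full -> b \in M_closure_fl M alpha A <-> tsmall A b.
Proof.
move=> [N fA].
have sAC : {subset A <= tsmall_sub A} by move=> v /tsmall0 ?; exact/tsmall_subP.
have admC : admissible M alpha A (tsmall_sub A).
  split=> //; have [l [_ lC hl]] := comp_series loc sAC
    (lenle_mono (fun _ h => h) sAC (@sub_full _ _ _) fA).
  have [g hg sg] := lenle_tsum lC.
  have hk n : exists k,
      has_length (submodule (tensor_image M A (tsmall_sub A) n)) k /\ (k <= g n)%N.
    have [|k hk kg] := has_length_subI (S := tensor_image M A (tsmall_sub A) n) (n := g n).
      apply: lenle_mono (hg n) => //; first exact: zero_sub.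
      by apply: tensor_image_sub => c u /hl; exact: pure_tensor_tsum.
    by exists k.
  exists (fun n => projT1 (cid (hk n))); split=> [n|]; first by case: (cid _) => k [].
  by apply: (small_le (h := g)) => // n; case: (cid _) => k [].
have maxC (A' : submodClosed B) : admissible M alpha A A' -> {subset A' <= tsmall_sub A}.
  move=> [_ [g [hg sg]]] v vA'; apply/tsmall_subP; exists g => // n.
  apply: (lenle_inj (f := pure_tensor (quotient_proj A v))) (has_length_sub (hg n)).
  - exact: zero_sub.
  - by move=> u _; exact: mem_tensor_image.
  - by move=> u _; rewrite mem_zero => /eqP ?; exact/tkerP.
split=> [/asboolP h|/tsmall_subP bC]; first exact/tsmall_subP/h.
by apply/asboolP => C' aC' hC'; exact: hC' bC.
Qed.

Lemma tker_mono n A A' b : {subset A <= A'} -> {subset tker n A b <= tker n A' b}.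
Proof.
move=> AA' u /tkerP h; apply/tkerP/eqP; rewrite -mem_zero.
apply: (pure_tensor_eq0 (pi := idfun) (beta := fun u w => pure_tensor (quotient_proj A' w) u)) h.
- by move=> b'; exists b'.
- by move=> w; exact: pure_tensor_linear.
- by move=> v a w w'; rewrite quotient_projD quotient_projZ pure_tensorDr pure_tensorZr (linZ (pure_tensor_linear _)).
by move=> v w /AA' wA; rewrite quotient_proj_eq0 // pure_tensor0r rpred0.
Qed.

Lemma tsmall_mono A A' b : {subset A <= A'} -> tsmall A b -> tsmall A' b.
Proof.
move=> h [g hg sg]; exists g => // n; apply: lenle_mono (hg n) => //; exact: tker_mono.
Qed.

Hypothesis fgB : finitely_generated B.

Lemma fin_power A t : finite_length (addm A (ideal_mul B (ideal_power m t))) full.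
Proof.
have [ms [em msm]] := ideal_gens loc.
have [|n hn] := fin_pows (ms := ms) loc t fgB; first by move=> x; rewrite em.
exists n; apply: lenle_mono hn => //; apply: idl_sub => y v /mapP[x /msm xm ->].
apply/sub_addr/asboolP => W hW; apply: hW; exists (x ^+ t), v; split=> //.
apply/asboolP => I hI; apply: hI; exists (fun=> x) => //=.
by rewrite prodr_const card_ord.
Qed.

(** Any bound for the length of B / A can serve as the exponent, by [prod_mem]. *)
Lemma power_sub A : finite_length A full ->
  exists t, {subset (ideal_mul B (ideal_power m t) : submodClosed B) <= A}.
Proof.
move=> [t hA]; exists t => v /asboolP; apply => _ [a [b [/asboolP ha ->]]].
have : a \in preimm (scale_vec b) A; last by [].
apply: ha => _ [c hc <-]; rewrite mem_preim.
change ((\prod_(i < t) c i) *: b \in A); rewrite -big_enum -(big_map c xpredT id).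
apply: (prod_mem loc (@sub_full _ _ A) hA) => //; last by move=> x /mapP[i _ ->]; exact: hc.
by rewrite size_map size_enum_ord.
Qed.

(** For A' of finite colength, some A + m^t B from the definition of the closure is contained in A',
    and smallness passes to larger submodules. *)
Lemma M_closure_tsmall A A' b : {subset A <= A'} -> finite_length A' full ->
  b \in M_closure m M alpha A -> tsmall A' b.
Proof.
move=> AA' fA' /asboolP h; have [t ht] := power_sub fA'.
have /(closure_flP _ (fin_power A t)) := h t; apply: tsmall_mono.
exact: add_sub.
Qed.

Lemma tsmall_M_closure A b : tsmall A b -> b \in M_closure m M alpha A.
Proof.
move=> h; apply/asboolP => t; apply/(closure_flP _ (fin_power A t)).
by apply: tsmall_mono h; exact: sub_addl.
Qed.
End Closure.

(** * Koszul homology and ideal closures for lim Cohen-Macaulay sequences *)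

Section LimCM.
Variables (R : comNzRingType) (m : ideal R) (d : nat) (M : nat -> lmodType R).
Hypothesis loc : local_noetherian m.
Hypothesis lim : lim_CM m d M.
Local Notation full := (full_submodule _).

Lemma sop_primary e (x : 'I_e -> R) : sop m x -> primary m (kseq x).
Proof.
move=> [xm xp]; split=> [y /mapP[i _ ->] //|a /xp[k hk]].
by exists k; rewrite -ideal_gen_idl.
Qed.

Lemma lim_CM_fg n : finitely_generated (M n). Proof. exact: (lim.1 n).1. Qed.

Lemma lim_CM_nu n : (0 < nu (M n))%N.
Proof. by apply: nu_gt0; [exact: lim_CM_fg|exact: (lim.1 n).2]. Qed.

Lemma lim_CM_homle (ys : seq R) : primary m ys -> (size ys <= d)%N ->
  exists2 g, (forall n, homle (kosM (M n) ys) 1 (g n)) & little_o (fun n => nu (M n)) g.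
Proof.
move=> py sy; have [x [sx hx]] := lim.2.
have [|N hN] := primary_exp (ys := kseq x) _ py; first by case: (sop_primary sx).
suff [G hG sG] : exists2 G, (forall i n, (0 < i <= d.+1)%N -> homle (kosM (M n) (kseq x)) i (G n)) &
    little_o (fun n => nu (M n)) G.
  exists (fun n => N ^ d * (2 ^ size ys * G n))%N; last exact/smallM/smallM.
  move=> n; have := @homle_kos_indep R (base_complex (M n)) (kseq x) ys N (G n).
  by rewrite size_kseq; apply=> // i hi; exact: hG.
(* One function bounds the degrees 1, .., d + 1 simultaneously; [homle_kos_indep] takes them all as
   input. *)
elim: (d.+1) => [|k [G hG sG]].
  by exists (fun=> 0%N); [move=> [] |exact: small0].
have [l [hl sl]] := hx k.+1 isT.
exists (fun n => G n + l n)%N; last exact: smallD.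
move=> i n /andP[i0]; rewrite leq_eqVlt => /orP[/eqP ->|ik].
  exact: lenle_leq (leq_addl _ _) (has_length_homology (hl n)).
by apply: lenle_leq (leq_addr _ _) (hG i n _); rewrite i0.
Qed.

(** M (x) R / I is M / IM, with u (x) b corresponding to the class of b u. *)
Lemma tker_colon (I : ideal R) (xs : seq R) n (b : R) : I =i idl R^o xs ->
  tker (B := R^o) M n I b =i colon (idl (M n) xs) b.
Proof.
move=> e; have one u (a : R) : a \in I -> pure_tensor (quotient_proj I 1) (a *: u) = 0.
  move=> aI; rewrite -pure_tensorZr -quotient_projZ quotient_proj_eq0 ?pure_tensor0r //.
  by rewrite /GRing.scale /= mulr1.
move=> u; apply/tkerP/idP => [h|].
  have := pure_tensor_eq0 (pi := idfun) (beta := fun (u : M n) (w : R^o) => w *: u) (Z := idl (M n) xs).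
  move=> /(_ I (fun b => ex_intro _ b erefl)); apply=> //.
  - by move=> w a v v'; rewrite scalerDr scaler_comm.
  - by move=> v a w w'; rewrite scalerDl scalerA.
  - by move=> v w; rewrite /= e; exact: idl_scale.
rewrite mem_colon => hb.
have -> : quotient_proj I b = b *: quotient_proj I 1.
  by rewrite -quotient_projZ /GRing.scale /= mulr1.
rewrite pure_tensorZr; apply/eqP; rewrite -mem_zero.
rewrite -[_ \in _]/(_ \in preimm (pure_tensor (quotient_proj I 1)) (zero_submod _)).
move: hb; apply: idl_sub => x v xl; apply/eqP/one.
by rewrite e; exact: mem_idl_self.
Qed.

Variable alpha : nat -> nat.
Hypothesis alpha_nu : forall n, (alpha n <= nu (M n))%N.
Hypothesis nu_alpha : forall g, little_o (fun n => nu (M n)) g -> little_o alpha g.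

Lemma closure_sub_m (x : 'I_d -> R) : sop m x ->
  {subset ideal_M_closure m M alpha (ideal_gen x) <= m}.
Proof.
move=> sx r hr; have px := sop_primary sx.
have fx := fin_primary loc (fg_regular R) px.
have [||g hg sg] := M_closure_tsmall loc (fg_regular R) (A' := ideal_gen x) _ _ hr => //.
  by apply: fin_mono fx => // v; rewrite ideal_gen_idl.
(* For a unit r the kernel (x)M : r is (x)M. Then g n bounds the length of M / (x)M, hence nu,
   although g is o(alpha) and so o(nu). *)
apply: contrapT => /negP /(local_unit loc)[c cr].
apply: (small_absurd (c := 1) lim_CM_nu _ (small_alpha alpha_nu sg)) => n.
rewrite mul1n; apply: (nu_le_len loc (lim_CM_fg n) px.1).
apply: lenle_mono (hg n) => // u; rewrite (tker_colon _ (ideal_gen_idl x)) mem_colon => h.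
by rewrite -[u]scale1r -cr -scalerA rpredZ.
Qed.

Lemma closure_colon (x : 'I_d -> R) t r : sop m x -> (1 <= t)%N ->
  r * (\prod_i x i) ^+ (t - 1) \in ideal_M_closure m M alpha (ideal_gen (fun i => x i ^+ t)) ->
  r \in ideal_M_closure m M alpha (ideal_gen x).
Proof.
move=> sx; case: t => // t _; rewrite subn1 /= => hr; have px := sop_primary sx.
have fx := fin_primary loc (fg_regular R) px.
have kp : kseq (fun i => x i ^+ t.+1) = map (fun a : R => a ^+ t.+1) (kseq x).
  by rewrite /kseq -map_comp.
have et : ideal_gen (fun i => x i ^+ t.+1) =i idl R^o (map (fun a : R => a ^+ t.+1) (kseq x)).
  by move=> a; rewrite ideal_gen_idl kp.
have [||g hg sg] := M_closure_tsmall loc (fg_regular R)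
  (A' := ideal_gen (fun i => x i ^+ t.+1)) _ _ hr => //.
  have [k hk] := fx; exists (t.+1 ^ size (kseq x) * k)%N.
  by apply: lenle_mono (@lenle_idlb_pows _ _ _ _ t.+1 _ hk) => // v; rewrite et.
have [|h hh sh] := lim_CM_homle px; first by rewrite size_kseq.
apply: (tsmall_M_closure loc (fg_regular R)).
exists (fun n => size (kseq x) * t.+1 ^ size (kseq x) * t * h n + g n)%N; last first.
  by apply: smallD => //; apply/smallM/nu_alpha.
move=> n; have := @lenle_colon_pows R (M n) t (kseq x) [::] r (h n) (g n).
rewrite cats0 => /(_ (hh n)) h1; apply: lenle_mono (h1 _) => //.
  by move=> u; rewrite (tker_colon _ (ideal_gen_idl x)).
have -> : \prod_(i <- kseq x) i = \prod_i x i by rewrite /kseq big_map big_enum.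
apply: lenle_mono (hg n) => // u; rewrite (tker_colon _ et) //.
by rewrite cats0.
Qed.

Lemma closure_notin (x : 'I_d -> R) t : sop m x -> (1 <= t)%N ->
  (\prod_i x i) ^+ (t - 1) \notin ideal_M_closure m M alpha (ideal_gen (fun i => x i ^+ t)).
Proof.
move=> sx t1; apply/negP => h; have := one_notin loc; apply/negP; rewrite negbK.
by apply: (closure_sub_m sx); apply: (closure_colon sx t1); rewrite mul1r.
Qed.
End LimCM.

(** * The lower bound for pure tensors *)

Section LinearCombination.
Variables (T : comNzRingType) (k : nat).
Local Notation F := ({ffun 'I_k -> T^o} : lmodType T).

Definition lincomb (V : lmodType T) (g : 'I_k -> V) (w : F) : V := \sum_j (w j : T) *: g j.
Lemma lincomb_linear (V : lmodType T) (g : 'I_k -> V) : linear (lincomb g).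
Proof.
move=> a u v; rewrite /lincomb scaler_sumr -big_split; apply: eq_bigr => j _ /=.
by rewrite !ffunE scalerDl scalerA.
Qed.

Definition basis_vec (i : 'I_k) : F := [ffun j => (j == i)%:R : T^o].
Lemma lincomb_basis (V : lmodType T) (g : 'I_k -> V) i : lincomb g (basis_vec i) = g i.
Proof.
rewrite /lincomb (bigD1 i) //= big1 => [|j ji]; rewrite ffunE; first by rewrite eqxx scale1r addr0.
by rewrite (negbTE ji) scale0r.
Qed.

Lemma basis_sum (v : F) : v = \sum_j (v j : T) *: basis_vec j.
Proof.
apply/ffunP => i; rewrite sum_ffunE (bigD1 i) //= big1 => [|j ji].
  by rewrite addr0 !ffunE eqxx /GRing.scale /= mulr1.
by rewrite !ffunE eq_sym (negbTE ji) scaler0.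
Qed.

Definition basis_seq : seq F := [seq basis_vec j | j <- enum 'I_k].

Lemma adjs_basis (P : submodClosed F) v : v \in adjs P basis_seq.
Proof.
rewrite [v]basis_sum; apply: submod_sum => j; apply: rpredZ; apply: mem_adjs.
by apply: map_f; rewrite mem_enum.
Qed.

Lemma fg_ffun : finitely_generated F.
Proof. by apply/finitely_generated_adjs; exists basis_seq => v _; exact: adjs_basis. Qed.

Lemma lincomb_surj (V : lmodType T) (l : seq V) v : size l = k ->
  {subset full_submodule V <= adjs (zero_submod V) l} ->
  exists w, lincomb (fun j : 'I_k => l`_j) w = v.
Proof.
move=> sl hl; pose g (j : 'I_k) := l`_j.
suff /imagemP[w _ <-] : v \in imagem (mk_linear (lincomb_linear g)) (full_submodule F) by exists w.
have : v \in adjs (zero_submod V) l by exact: hl.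
apply: adjs_sub => [|c /(nthP 0)[i]]; first exact: zero_sub.
rewrite sl => ik <-; apply/imagemP; exists (basis_vec (Ordinal ik)) => //.
exact: (lincomb_basis g (Ordinal ik)).
Qed.
End LinearCombination.

Section PowerModule.
Variables (R : comNzRingType) (M : lmodType R) (k : nat) (P : submodClosed M).
Local Notation G := ({ffun 'I_k -> M} : lmodType R).

Definition from_coord_pred j : {pred G} := fun v => [forall i : 'I_k, (j <= i)%N ==> (v i \in P)].
Lemma from_coordP j (v : G) : reflect (forall i : 'I_k, (j <= i)%N -> v i \in P) (from_coord_pred j v).
Proof.
apply: (iffP forallP) => h i; first by move: (h i) => /implyP.
by apply/implyP; exact: h.
Qed.
Lemma from_coord_closed j : submod_closed (from_coord_pred j).
Proof.
split; first by apply/from_coordP => i _; rewrite ffunE rpred0.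
move=> a u v /from_coordP hu /from_coordP hv; apply/from_coordP => i ij.
by rewrite !ffunE rpredD ?rpredZ ?hu ?hv.
Qed.
(* [from_coord 0 <= from_coord 1 <= .. <= from_coord k] is a filtration with factors [M / P]. *)
Definition from_coord j : submodClosed G := of_closed (from_coord_closed j).

Definition delta_mod (j : 'I_k) (u : M) : G := [ffun i => if i == j then u else 0].
Lemma delta_mod_linear j : linear (delta_mod j).
Proof.
move=> a u v; apply/ffunP => i; rewrite !ffunE.
by case: ifP; rewrite ?scaler0 ?addr0.
Qed.

Lemma sub_from_coord i j : (i <= j)%N -> {subset from_coord i <= from_coord j}.
Proof. by move=> ij v /from_coordP h; apply/from_coordP => l /(leq_trans ij)/h. Qed.

Lemma len_power : finite_length (from_coord 0) (full_submodule G) ->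
  (k * len P (full_submodule M) <= len (from_coord 0) (full_submodule G))%N.
Proof.
move=> f; suff h j : (j <= k)%N -> (j * len P (full_submodule M) <= len (from_coord 0) (from_coord j))%N.
  have := h k (leqnn k); rewrite (_ : len (from_coord 0) (full_submodule G) = len (from_coord 0) (from_coord k)) //.
  have fk : {subset full_submodule G <= from_coord k}.
    by move=> v _; apply/from_coordP => i; rewrite leqNgt ltn_ord.
  rewrite (lenD (sub_from_coord (leq0n k)) (@sub_full _ _ _) f).
  have /eqP -> : len (from_coord k) (full_submodule G) == 0%N.
    by rewrite -leqn0; apply/len_leq/lenle_refl.
  by rewrite addn0.
elim: j => [|j IH] jk //.
have fj : finite_length (from_coord 0) (from_coord j.+1) by apply: fin_mono f => //; exact: sub_from_coord.
rewrite (lenD (sub_from_coord (leq0n j)) (sub_from_coord (leqnSn j)) fj) mulSn addnC leq_add ?IH ?(ltnW jk) //.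
apply: len_leq; apply: (lenle_inj (f := mk_linear (delta_mod_linear (Ordinal jk)))
   (P' := from_coord j) (Q' := from_coord j.+1)) => [|u _|u _ /from_coordP/(_ (Ordinal jk) (leqnn j))|].
- exact: sub_from_coord.
- apply/from_coordP => i ij; rewrite ffunE; case: eqP => [e|_]; last exact: rpred0.
  by move: ij; rewrite e ltnn.
- by rewrite ffunE eqxx.
- by apply: len_lenle; apply: fin_mono fj => //; exact: sub_from_coord.
Qed.
End PowerModule.

Section Key.
Variables (T R : comNzRingType) (f : {rmorphism T -> R}) (M : lmodType R) (k : nat).
Local Notation F := ({ffun 'I_k -> T^o} : lmodType T).
Local Notation G := ({ffun 'I_k -> M} : lmodType R).
Implicit Types (W A B : submodClosed F).

(* [M (x)_T F / W] is [G / tmul W], with [emb w u] in the role of [u (x) w]. *)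
Definition emb (w : F) (u : M) : G := [ffun j => f (w j : T) *: u].

Lemma emb_linear w : linear (emb w).
Proof. by move=> a u v; apply/ffunP => j; rewrite !ffunE scalerDr scaler_comm. Qed.

Lemma embD w w' u : emb (w + w') u = emb w u + emb w' u.
Proof. by apply/ffunP => j; rewrite !ffunE rmorphD scalerDl. Qed.

Lemma embZ a w u : emb (a *: w) u = f a *: emb w u.
Proof. by apply/ffunP => j; rewrite !ffunE rmorphM scalerA. Qed.

Definition tmul W : submodClosed G :=
  Defs.span [set v : G | exists w u, w \in W /\ v = emb w u]%classic.

Lemma mem_tmul W w u : w \in W -> emb w u \in tmul W.
Proof. by move=> wW; apply/asboolP => Q; apply; exists w, u. Qed.

Lemma tmul_sub W (Q : submodClosed G) : (forall w u, w \in W -> emb w u \in Q) ->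
  {subset tmul W <= Q}.
Proof. by move=> h v /asboolP; apply=> _ [w [u [wW ->]]]; exact: h. Qed.

Lemma tmul_mono A B : {subset A <= B} -> {subset tmul A <= tmul B}.
Proof. by move=> AB; apply: tmul_sub => w u /AB; exact: mem_tmul. Qed.

(** Passing from A to A + T b enlarges [tmul A] by the image of u |-> u (x) b, which is a quotient
    of M / K. *)
Lemma tmul_adj A b (K : submodClosed M) n : lenle K (full_submodule M) n ->
  (forall u, u \in K -> emb b u \in tmul A) -> lenle (tmul A) (tmul (adj A b)) n.
Proof.
move=> hn hK; apply: (lenle_surj (f := mk_linear (@emb_linear b))) hn => //.
suff h : {subset tmul (adj A b) <=
    addm (imagem (mk_linear (@emb_linear b)) (full_submodule M)) (tmul A)}.
  move=> w /h /addmP[_ [y [/imagemP[u _ <-] yA ->]]]; exists u => //.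
  by rewrite addrC addKr.
apply: tmul_sub => w u /adjP[a ha]; rewrite -(subrK (a *: b) w) embD embZ rpredD //.
  exact/sub_addr/mem_tmul.
by rewrite -(linZ (emb_linear b)); apply/sub_addl/imagemP; exists (f a *: u).
Qed.

Variables (mT : ideal T) (xs : seq T).
Hypothesis locT : local_noetherian mT.
Hypothesis mT_xs : mT =i idl T^o xs.
Local Notation fxs := (map f xs).
Local Notation pows t l := (map (fun x => x ^+ t) l).

Lemma xs_mT x : x \in xs -> x \in mT.
Proof. by move=> xl; rewrite mT_xs; exact: mem_idl_self. Qed.

(** A composition factor of B / A is generated by some b and killed by [mT]; hence u |-> u (x) b
    vanishes on (f xs) M, and the factor contributes at most n. *)
Lemma lenle_tmul A B j n : {subset A <= B} -> lenle A B j ->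
  lenle (idl M fxs) (full_submodule M) n ->
  lenle (tmul A) (tmul B) (j * n).
Proof.
move=> + + hn; elim/ltn_ind: j B => j IH B AB hj.
case: (pselect {subset B <= A}) => BA.
  by apply: lenle_leq (leq0n _) (lenle_refl _); exact: tmul_mono.
have [i [Q1 [b [ij h1 AQ1 Q1B [bB _ gen mB]]]]] := len_step locT hj AB BA.
have h2 := IH i ij Q1 AQ1 h1.
apply: (lenle_leq (m := i * n + n)); first by rewrite addnC -mulSn leq_mul2r ij orbT.
apply: lenle_trans (tmul_mono AQ1) (tmul_mono Q1B) h2 _.
apply: lenle_mono (tmul_adj (A := Q1) (b := b) hn _) => //; [exact: tmul_mono|exact: tmul_mono|].
move=> u; suff h : {subset idl M fxs <= preimm (mk_linear (@emb_linear b)) (tmul Q1)} by move/h.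
apply: idl_sub => _ v /mapP[x /xs_mT xm ->].
by change (emb b (f x *: v) \in tmul Q1); rewrite (linZ (emb_linear b)) -embZ mem_tmul // mB.
Qed.

Lemma lenle_free t : lenle (idl F (pows t xs)) (full_submodule F) (t ^ size xs * k).
Proof.
have h : lenle (idl F xs) (full_submodule F) k.
  have se : size (basis_seq T k) = k by rewrite size_map size_enum_ord.
  rewrite -[k in lenle _ _ k]se.
  apply: lenle_mono (lenle_adjs locT (P := idl F xs) (l := basis_seq T k) _) => // [v _|a b].
    exact: adjs_basis.
  by rewrite mT_xs => am _; exact: idl_scale.
exact: lenle_idlb_pows.
Qed.

Lemma tmul_idl (l : seq T) : {subset tmul (idl F l) <= idl G (map f l)}.
Proof.
apply: tmul_sub => w u.
pose Q : {pred F} := fun w => `[< forall u, emb w u \in idl G (map f l) >].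
have Qc : submod_closed Q.
  split; first by apply/asboolP => v; rewrite -(scale0r 0) embZ rmorph0 scale0r rpred0.
  move=> a v v' /asboolP hv /asboolP hv'; apply/asboolP => z.
  by rewrite embD embZ rpredD ?rpredZ ?hv ?hv'.
suff h : {subset idl F l <= of_closed Qc} by move/h/asboolP; apply.
apply: idl_sub => x v xl; apply/asboolP => z; rewrite embZ.
by apply: mem_idlb; exact: map_f.
Qed.

Lemma tmul_full (v : G) : v \in tmul (full_submodule F).
Proof.
have -> : v = \sum_j emb (basis_vec T j) (v j).
  apply/ffunP => i; rewrite sum_ffunE (bigD1 i) //= big1 => [|j ji].
    by rewrite addr0 !ffunE eqxx rmorph1 scale1r.
  by rewrite !ffunE eq_sym (negbTE ji) rmorph0 scale0r.
by apply: submod_sum => j; exact: mem_tmul.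
Qed.

(* [F / (xs ^ t.+1) F] has at most [k * t.+1 ^ size xs] composition factors, and each
   contributes at most [len (M / xs M)] to the length of [G / (xs ^ t.+1) G]. As that
   length is almost [k * t.+1 ^ size xs * len (M / xs M)], every factor, in particular
   [(W + T b) / W], must contribute almost the maximum. *)
Lemma key_bound W b (K : submodClosed M) t h L :
  finite_length (idl M fxs) (full_submodule M) -> homle (kosM M fxs) 1 h ->
  {subset idl F (pows t.+1 xs) <= W} -> b \notin W -> (forall a, a \in mT -> a *: b \in W) ->
  lenle K (full_submodule M) L -> (forall u, u \in K -> emb b u \in tmul W) ->
  (len (idl M fxs) (full_submodule M) <= L + k * size xs * t.+1 ^ size xs * h)%N.
Proof.
move=> fM hh IW bW mbW hL hK.
set n := len (idl M fxs) _; have hn : lenle (idl M fxs) (full_submodule M) n by exact: len_lenle.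
set I := idl F (pows t.+1 xs); set Wb := adj W b.
have WWb : {subset W <= Wb} by exact: sub_adj.
have hF := @lenle_free t.+1.
have fF : finite_length I (full_submodule F) by exists (t.+1 ^ size xs * k)%N.
have fIW : finite_length I W by apply: fin_mono fF.
have fWb : finite_length Wb (full_submodule F) by apply: fin_mono fF => // v /IW /WWb.
(* The factor [Wb / W] is nonzero. Leaving it out saves at least one of the k * t.+1 ^ size xs
   composition factors; its contribution is bounded by L instead of n. *)
have lI : (len I W + len Wb (full_submodule F) < t.+1 ^ size xs * k)%N.
  have e3 : len I (full_submodule F) = (len I W + len W (full_submodule F))%N by exact: lenD.
  have e4 : len W (full_submodule F) = (len W Wb + len Wb (full_submodule F))%N.
    by apply: lenD => //; apply: fin_mono fF.
  have e5 : (len I (full_submodule F) <= t.+1 ^ size xs * k)%N by exact: len_leq hF.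
  suff : (0 < len W Wb)%N by move: e3 e4 e5; clear; lia.
  have fWWb : finite_length W Wb by apply: fin_mono fF.
  apply: (len_lenle fWWb); apply: (chainS (chain0 (Q := W) _)) => //.
  by move=> /(_ _ (mem_adj _ _)); exact/negP.
have hT := lenle_tmul (@sub_full _ _ I) hF hn.
have fT : finite_length (tmul I) (tmul (full_submodule F)) by exists (t.+1 ^ size xs * k * n)%N.
have e1 := lenD (tmul_mono IW) (tmul_mono (@sub_full _ _ W)) fT.
have fTW : finite_length (tmul W) (tmul (full_submodule F)).
  by apply: fin_mono fT => //; exact: tmul_mono.
have e2 := lenD (tmul_mono WWb) (tmul_mono (@sub_full _ _ Wb)) fTW.
have b1 := len_leq (lenle_tmul IW (len_lenle fIW) hn).
have b2 := len_leq (lenle_tmul (@sub_full _ _ Wb) (len_lenle fWb) hn).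
have b3 := len_leq (tmul_adj hL hK).
have sIG : {subset tmul I <= from_coord k (idl M (pows t.+1 fxs)) 0}.
  move=> v /tmul_idl hv; have -> : pows t.+1 fxs = map f (pows t.+1 xs).
    by rewrite -!map_comp; apply: eq_map => x /=; rewrite rmorphXn.
  move: v hv; apply: idl_sub => x v xl; apply/from_coordP => i _; rewrite ffunE.
  exact: mem_idlb.
have sGT : {subset full_submodule G <= tmul (full_submodule F)} by move=> v _; exact: tmul_full.
have fG : finite_length (from_coord k (idl M (pows t.+1 fxs)) 0) (full_submodule G) by apply: fin_mono fT.
have b4 := len_power fG.
have b5 : (len (from_coord k (idl M (pows t.+1 fxs)) 0) (full_submodule G) <=
    len (tmul I) (tmul (full_submodule F)))%N.
  have fTG : finite_length (tmul I) (full_submodule G) by apply: fin_mono fT.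
  apply: (leq_trans (len_monol sIG (@sub_full _ _ _) fTG)).
  by apply: len_monor fT.
have fMp : finite_length (idl M (pows t.+1 fxs)) (full_submodule M).
  by exists (t.+1 ^ size fxs * n)%N; exact: lenle_idlb_pows.
have := @len_pows R M t fxs [::] h; rewrite !cats0 size_map => /(_ fMp hh) b6.
move: lI e1 e2 b1 b2 b3 b4 b5 b6; rewrite -/n.
set a1 := len I W; set a2 := len Wb _; set c1 := len (tmul I) (tmul W).
set c2 := len (tmul I) _; set c3 := len (tmul W) _; set c4 := len (tmul W) _.
set c5 := len (tmul Wb) _; set c6 := len (idl M (pows _ _)) _; set c7 := len (from_coord _ _ _) _.
set Tt := (t.+1 ^ size xs)%N; set e := size xs.
move=> lI e1 e2 b1 b2 b3 b4 b5 b6.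
(* With N = Tt * k the estimates combine to N n - k e Tt h <= length of G / [tmul I] <= (N - 1) n +
   L. *)
have b7 : (k * (Tt * n) <= k * c6 + k * (e * Tt * h))%N by rewrite -mulnDr leq_mul2l b6 orbT.
have b8 : ((a1 + a2).+1 * n <= Tt * k * n)%N by rewrite leq_mul2r lI orbT.
have -> : (k * e * Tt * h = k * (e * Tt * h))%N by rewrite !mulnA.
have b9 : (k * (Tt * n) = Tt * k * n)%N by rewrite mulnA (mulnC k).
rewrite mulSn mulnDl in b8; lia.
Qed.
End Key.

Section Avoid.
Variables (R : comNzRingType) (m : ideal R) (V : lmodType R).
Hypothesis loc : local_noetherian m.
Hypothesis fgV : finitely_generated V.
Implicit Types (W : submodClosed V).

(* For [W] maximal avoiding [b] every submodule strictly above [W] contains [b];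
   since the submodules [colon W (a ^+ t)] are stationary, [a ^+ t V] cannot lie
   strictly above [W] for large [t]. *)
Lemma max_avoid W0 (b : V) : b \notin W0 -> exists W,
  [/\ {subset W0 <= W}, b \notin W, forall a, a \in m -> a *: b \in W &
      forall a, a \in m -> exists t, forall v, a ^+ t *: v \in W].
Proof.
move=> bW0; have [noethR _ _] := loc.
have [W [bW W0W Wmax]] := max_submod noethR (F := fun W => b \notin W) fgV bW0.
have above W' : {subset W <= W'} -> ~ {subset W' <= W} -> b \in W'.
  by move=> h nh; apply: contrapT => /negP bW'; apply/nh/Wmax.
have mb a : a \in m -> a *: b \in W.
  move=> am; apply: contrapT => /negP nab.
  have /adjP[c hc] : b \in adj W (a *: b).
    by apply: above; [exact: sub_adj|move=> /(_ _ (mem_adj _ _)); exact/negP].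
  have [e he] := unit_one_sub loc (ideal_mull c am).
  move: bW; have -> : b = e *: (b - c *: (a *: b)).
    by rewrite scalerA -{2}[b]scale1r -scalerBl scalerA he scale1r.
  by rewrite rpredZ.
exists W; split=> // a am.
have [|N [[t Nt] _ Nmax]] := max_submod noethR
  (F := fun N => exists t, N =i colon W (a ^+ t)) (N0 := colon W (a ^+ 0)) fgV.
  by exists 0%N.
exists t => v; apply: contrapT => /negP nv.
have /addxP[w hw] : b \in addx W (a ^+ t).
  apply: above; first exact: sub_addx.
  by move=> h; move: nv; rewrite h ?mem_addx.
have : w \in colon W (a ^+ t).
  rewrite -Nt; apply: (Nmax (colon W (a ^+ t.+1))); first by exists t.+1.
    by move=> u; rewrite Nt !mem_colon exprS -scalerA => hu; rewrite rpredZ.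
  rewrite mem_colon exprS -scalerA; apply: (submod_subK (v := a *: b)); last exact: mb.
  by rewrite -scalerBr -opprB scalerN submodN // rpredZ.
rewrite mem_colon => h; move: bW; rewrite -(subrK (a ^+ t *: w) b).
by rewrite rpredD.
Qed.

Lemma max_avoid_list W0 (b : V) (xs : seq R) : (forall x, x \in xs -> x \in m) -> b \notin W0 ->
  exists W t, [/\ {subset W0 <= W}, b \notin W, forall a, a \in m -> a *: b \in W &
      {subset idl V (map (fun x : R => x ^+ t.+1) xs) <= W}].
Proof.
move=> xm /max_avoid[W [W0W bW mb ht]]; exists W.
have [t h] : exists t, forall x, x \in xs -> forall v, x ^+ t.+1 *: v \in W.
  elim: xs xm => [|x xs IH] xm; first by exists 0%N.
  have [|t h] := IH; first by move=> y yx; apply: xm; rewrite inE yx orbT.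
  have [s hs] := ht x (xm x (mem_head _ _)); exists (maxn t s) => y.
  rewrite inE => /orP[/eqP ->|/h hy] v.
    by rewrite -(subnK (leqW (leq_maxr t s))) exprD -scalerA rpredZ.
  have -> : (maxn t s).+1 = ((maxn t s - t) + t.+1)%N by rewrite addnS subnK ?leq_maxl.
  by rewrite exprD -scalerA rpredZ.
exists t; split=> //; apply: idl_sub => _ v /mapP[x xl ->]; exact: h.
Qed.
End Avoid.

(** * Closures over regular local rings *)

Section Regular.
Variables (R : comNzRingType) (m : ideal R).

Lemma krull_dim_uniq (d e : nat) : krull_dim R d -> krull_dim R e -> d = e.
Proof. by move=> [c h] [c' h']; apply/eqP; rewrite eqn_leq h ?h'. Qed.

Lemma regular_gens : regular_local m ->
  exists xs : seq R, krull_dim R (size xs) /\ m =i idl R^o xs.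
Proof.
move=> [loc dimR]; have [ms [em msm]] := ideal_gens loc.
have [l el] : exists l : seq (submodule m), map val l = ms.
  elim: ms msm {em} => [|x ms IH] h; first by exists [::].
  have [|l <-] := IH; first by move=> y hy; apply: h; rewrite inE hy orbT.
  by exists (Submodule (h x (mem_head _ _)) :: l).
have fg : finitely_generated (submodule m).
  apply/finitely_generated_adjs; exists l => v _.
  have : val v \in idl R^o ms by rewrite -em; case: v.
  suff h : {subset idl R^o ms <= imagem (@submodule_val R R^o m) (adjs (zero_submod _) l)}.
    by move=> /h /imagemP[w hw /val_inj <-].
  rewrite -el; apply: idl_sub => x a /mapP[w wl ->]; apply/imagemP.
  exists ((a : R) *: (w : submodule m)); first by rewrite rpredZ ?mem_adjs.
  by rewrite linearZ_LR /GRing.scale /= mulrC.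
have [/generated_adjs[l' sl hl'] _] := nuP fg.
exists (map val l'); rewrite size_map sl; split=> // a; apply/idP/idP => [am|].
  have : Submodule am \in adjs (zero_submod _) l' by exact: hl'.
  suff h : {subset adjs (zero_submod _) l' <=
      preimm (@submodule_val R R^o m) (idl R^o (map val l'))}.
    by move/h.
  apply: adjs_sub; first exact: zero_sub.
  by move=> w wl; apply: mem_idl_self; exact: map_f.
apply: idl_sub => x v /mapP[w _ ->].
have -> : val w *: (v : R^o) = v *: (val w : R^o) by rewrite /GRing.scale /= mulrC.
by apply: rpredZ; case: w.
Qed.

Variables (d : nat) (M : nat -> lmodType R).
Hypothesis lim : lim_CM m d M.
Hypothesis reg : regular_local m.
Hypothesis dimR : krull_dim R d.
Variable alpha : nat -> nat.
Hypothesis alpha_nu : forall n, (alpha n <= nu (M n))%N.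

Lemma regular_closure (B : lmodType R) (A : submodClosed B) : finitely_generated B ->
  M_closure m M alpha A =i A.
Proof.
move=> fgB; have [loc _] := reg; move=> b; apply/idP/idP => [hb|bA]; last first.
  by apply: tsmall_M_closure => //; exact: tsmall0.
apply: contrapT => /negP bA; have [xs [dx em]] := regular_gens reg.
have sx : size xs = d by exact: krull_dim_uniq dx dimR.
have xm x : x \in xs -> x \in m by move=> xl; rewrite em; exact: mem_idl_self.
have [A' [t [AA' bA' mbA' hA']]] := max_avoid_list loc fgB xm bA.
have fA' : finite_length A' (full_submodule B).
  have [|n hn] := fin_pows (ms := xs) loc t.+1 fgB; first by move=> x; rewrite em.
  by exists n; apply: lenle_mono hn.
have [g hg sg] := M_closure_tsmall loc fgB AA' fA' hb.
have px : primary m xs by split=> // a am; exists 1%N; rewrite expr1 -em.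
have [|h hh sh] := lim_CM_homle lim px; first by rewrite sx.
have /finitely_generated_adjs[l hl] := fgB.
(* [key_bound] is about quotients of a free module, so B is presented as a quotient of F, with [W]
   the preimage of [A'] and [b'] a preimage of b. *)
pose F : lmodType R := {ffun 'I_(size l) -> R^o}.
pose pi : F -> B := lincomb (fun j : 'I_(size l) => l`_j).
have lpi : linear pi by exact: lincomb_linear.
have pi_surj v : exists w, mk_linear lpi w = v := lincomb_surj v erefl hl.
have [b' eb'] := pi_surj b.
pose W := preimm (mk_linear lpi) A'.
have key n : (nu (M n) <= g n + size l * size xs * t.+1 ^ size xs * h n)%N.
  have xm' x : x \in map (idfun : {rmorphism R -> R}) xs -> x \in m by rewrite map_id; exact: xm.
  have fx : finite_length (idl (M n) (map (idfun : {rmorphism R -> R}) xs)) (full_submodule (M n)).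
    by rewrite map_id; apply: (fin_primary loc _ px); exact: lim_CM_fg lim n.
  apply: leq_trans (nu_le_len loc (lim_CM_fg lim n) xm' (len_lenle fx)) _.
  apply: (key_bound (W := W) (b := b') (K := tker M n A' b) loc em fx _ _ _ _ (hg n)).
  - by rewrite map_id.
  - apply: idl_sub => _ v /mapP[x xl ->]; change (pi (x ^+ t.+1 *: v) \in A'); rewrite (linZ lpi).
    by apply/hA'/mem_idlb/map_f.
  - by change (pi b' \notin A'); rewrite [pi b']eb'.
  - by move=> a am; change (pi (a *: b') \in A'); rewrite (linZ lpi) [pi b']eb'; exact: mbA'.
  move=> u /tkerP; rewrite -eb'.
  apply: (pure_tensor_eq0 (beta := fun u w => @emb _ _ (idfun : {rmorphism R -> R}) (M n) (size l) w u)).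
  - exact: pi_surj.
  - by move=> w; exact: emb_linear.
  - by move=> v a w w'; rewrite embD embZ.
  - by move=> v w hw; exact: mem_tmul.
apply: (small_absurd (c := 1) (lim_CM_nu lim) _
  (smallD (small_alpha alpha_nu sg) (smallM _ sh))) => n.
by rewrite mul1n; exact: key.
Qed.
End Regular.

(** * Module-finite extensions *)

Definition is_prime (R : comNzRingType) (P : {pred R}) := idealr_closed P /\ prime_idealr_closed P.

Section GoingUp.
Variables (T R : comNzRingType) (f : {rmorphism T -> R}).
Hypotheses (noethT : noetherian T) (noethR : noetherian R).
Hypothesis fgf : finitely_generated (restrict f).

Lemma restrict_scaleE (a : T) (r : restrict f) : a *: r = f a * (r : R) :> R.
Proof. by []. Qed.

(** The submodules spanned by 1, r, .., r^(n-1) become stationary because R is a Noetherian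
    T-module; this is an integral equation for r. *)
Lemma integral_power (r : R) : exists n,
  (r ^+ n : restrict f) \in
    adjs (zero_submod (restrict f)) [seq (r ^+ i : restrict f) | i <- iota 0 n].
Proof.
pose A n := adjs (zero_submod (restrict f)) [seq (r ^+ i : restrict f) | i <- iota 0 n].
have [|N [[n ->] _ Nmax]] := max_submod noethT (F := fun N => exists n, N = A n) (N0 := A 0%N) fgf.
  by exists 0%N.
exists n; apply: (Nmax (A n.+1)); first by exists n.+1.
  apply: adjs_sub => [|v /mapP[i]]; first exact: zero_sub.
  rewrite mem_iota add0n => /andP[_ i_n] ->; rewrite /A; apply: mem_adjs; apply: map_f.
  by rewrite mem_iota add0n (leqW i_n).
by rewrite /A; apply: mem_adjs; apply: map_f; rewrite mem_iota add0n leqnn.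
Qed.

(** J is maximal among the ideals above I whose contraction lies in p. By maximality, J together
    with any further element u contains modulo J some [f s] with s outside p ([meets]); this gives
    primality, and integrality forces the contraction to be all of p. *)
Lemma going_up (I : ideal R) (p : {pred T}) : is_prime p -> (forall t, f t \in I -> t \in p) ->
  exists J : ideal R, [/\ is_prime J, {subset I <= J} & forall t, (f t \in J) = (t \in p)].
Proof.
move=> [[p0 p1 pD] pM] Ip.
have pB u v : u - v \in p -> v \in p -> u \in p.
  by move=> h hv; rewrite -(subrK v u) -[u - v]mul1r; exact: pD.
have pMl u v : v \in p -> u * v \in p by move=> hv; rewrite -[u * v]addr0; exact: pD.
have pMP u v : u \notin p -> v \notin p -> u * v \notin p.
  by move=> hu hv; apply/negP => /pM; rewrite (negbTE hu) (negbTE hv).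
have pX u n : u \notin p -> u ^+ n \notin p.
  by move=> hu; elim: n => [|n IH]; rewrite ?expr0 // exprS pMP.
have [J [Jp IJ Jmax]] := max_submod noethR
  (F := fun J : ideal R => forall t, f t \in J -> t \in p) (fg_regular R) Ip.
have meets u : u \notin J -> exists s c, s \notin p /\ f s - c * u \in J.
  move=> uJ; apply: contrapT => h; move: uJ.
  suff -> : u \in J by [].
  apply: (Jmax (adj (J : submodClosed R^o) u)); [|exact: sub_adj|exact: mem_adj].
  move=> t /adjP[c hc]; apply: contrapT => /negP tp; apply: h.
  by exists t, c.
have J1 : 1 \notin J by apply/negP => h; move: p1; rewrite Jp // rmorph1.
have JM c u : u \in J -> c * u \in J by exact: ideal_mull.
have JD u v : u \in J -> v \in J -> u + v \in J by move=> hu hv; exact: (rpredD hu hv).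
have JB u v : u - v \in J -> v \in J -> u \in J by move=> hu hv; exact: submod_subK hu hv.
have primeJ : is_prime J.
  split; first by split=> //; [exact: rpred0|move=> a u v hu hv; exact: JD (JM a u hu) hv].
  move=> u v uvJ; apply: contrapT => /negP; rewrite negb_or.
  case/andP=> /meets[s [c [sp hs]]] /meets[s' [c' [sp' hs']]].
  have := pMP _ _ sp sp'; rewrite Jp // rmorphM.
  have -> : f s * f s' =
    f s' * (f s - c * u) + (c * u * (f s' - c' * v) + c * c' * (u * v)) by ring.
  exact: JD (JM _ _ hs) (JD _ _ (JM _ _ hs') (JM _ _ uvJ)).
exists J; split=> // t; apply/idP/idP => [/Jp //|tp].
apply: contrapT => /negP /meets[s [r [sp hs]]].
have hrt i : (r * f t) ^+ i - f s ^+ i \in J.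
  by rewrite subrXX mulrC JM // -opprB; exact: submodN hs.
(* Multiply an integral equation of [r] by [f t ^+ n] and use [r * f t = f s] modulo
   [J] to obtain [s ^+ n \in p]. *)
have [n hn] := integral_power r.
pose Qp : {pred restrict f} := fun w => `[< exists2 q, q \in p & f t ^+ n * (w : R) - f q \in J >].
have Qc : submod_closed Qp.
  split; first by apply/asboolP; exists 0; rewrite // rmorph0 mulr0 subr0; exact: rpred0.
  move=> a u w /asboolP[q qp hq] /asboolP[q' qp' hq']; apply/asboolP.
  exists (a * q + q'); first exact: pD.
  have e (x y : R) : f t ^+ n * (f a * x + y) - f (a * q + q') =
      f a * (f t ^+ n * x - f q) + (f t ^+ n * y - f q').
    by rewrite rmorphD rmorphM; ring.
  suff : f t ^+ n * (f a * (u : R) + (w : R)) - f (a * q + q') \in J by [].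
  by rewrite e; exact: JD (JM _ _ hq) hq'.
have : (r ^+ n : restrict f) \in of_closed Qc.
  apply: adjs_sub hn => [|w /mapP[i]]; first exact: zero_sub.
  rewrite mem_iota /= add0n => i_n ->; apply/asboolP.
  exists (t ^+ (n - i) * s ^+ i).
    by rewrite mulrC -(subnSK i_n) exprSr mulrA pMl.
  have -> : f t ^+ n * r ^+ i - f (t ^+ (n - i) * s ^+ i) =
     f t ^+ (n - i) * ((r * f t) ^+ i - f s ^+ i).
    by rewrite -{1}(subnK (ltnW i_n)) exprD exprMn rmorphM !rmorphXn; ring.
  exact: JM (hrt i).
case/asboolP=> q qp hq; have := pX _ n sp.
rewrite (pB (s ^+ n) q) //; apply: Jp; rewrite rmorphB rmorphXn.
have -> : f s ^+ n - f q = (f t ^+ n * r ^+ n - f q) - ((r * f t) ^+ n - f s ^+ n).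
  by rewrite exprMn; ring.
by apply: submodB => //; exact: hrt.
Qed.

(** A chain of primes of T is lifted from the bottom, where injectivity makes the contraction of the
    zero ideal zero. The lifted chain is strict because its contractions are. *)
Lemma finite_dim_le d e : injective f -> krull_dim R d -> krull_dim T e -> (e <= d)%N.
Proof.
move=> finj [_ dimR] [[c [hc sc]] _]; apply: dimR.
have lift i : (i <= e)%N -> exists C : nat -> ideal R, [/\
    forall j, (j <= i)%N -> is_prime (C j) /\ (forall t, (f t \in C j) = (t \in c j)) &
    forall j, (j < i)%N -> {subset C j <= C j.+1}].
  elim: i => [|i IH] ie.
    have [|J [Jp _ hJ]] := going_up (I := zero_submod R^o) (hc 0%N ie).
      move=> t; change (f t == 0 -> t \in c 0%N) => /eqP ft0; have [[p0 _ _] _] := hc 0%N ie.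
      by have -> : t = 0 by apply: finj; rewrite rmorph0.
    by exists (fun=> J); split=> // j; rewrite leqn0 => /eqP ->.
  have [C [hC sC]] := IH (ltnW ie).
  have [|J [Jp CJ hJ]] := going_up (I := C i) (hc i.+1 ie).
    by move=> t; rewrite (hC i (leqnn i)).2; exact: (sc i ie).1.
  exists (fun j => if (j <= i)%N then C j else J); split=> j.
    case: (leqP j i) => [ji _|ij ji]; first exact: hC.
    by have -> : j = i.+1 by apply/eqP; rewrite eqn_leq ij ji.
  rewrite ltnS => ji; rewrite ji; case: ltnP => [|ij]; first exact: sC.
  by have -> : j = i by apply/eqP; rewrite eqn_leq ji ij.
have [C [hC sC]] := lift e (leqnn e).
exists (fun i => (C i : {pred R})); split=> i ie; first exact: (hC i ie).1.
split; first exact: sC.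
move=> h; have [_] := sc i ie; apply=> t.
by rewrite -(hC i.+1 ie).2 -(hC i (ltnW ie)).2; exact: h.
Qed.
End GoingUp.

Section Finite.
Variables (T R : comNzRingType) (f : {rmorphism T -> R}) (mT : ideal T) (m : ideal R).
Hypotheses (locT : local_noetherian mT) (loc : local_noetherian m).
Hypothesis fgf : finitely_generated (restrict f).
Hypothesis fm : forall a, a \in mT -> f a \in m.

Lemma restrict_ideal_closed (Q : ideal R) : submod_closed (Q : {pred restrict f}).
Proof.
split; first exact: rpred0.
by move=> a u v hu hv; apply: (rpredD (ideal_mull (f a) hu) hv).
Qed.
Definition restrict_ideal (Q : ideal R) : submodClosed (restrict f) := of_closed (restrict_ideal_closed Q).

Lemma chain_restrict_ideal (P Q : ideal R) k : chain P Q k -> chain (restrict_ideal P) (restrict_ideal Q) k.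
Proof.
elim=> [{}Q h|{}Q Q' {}k _ c h nh]; first exact: chain0.
by apply: (chainS (Q := restrict_ideal Q)); [exact: c|exact: h|exact: nh].
Qed.

(** R / (f xs) has finite length over T, hence over R, as ideals are T-submodules; so a power of
    every element of m kills it. *)
Lemma primary_image (xs : seq T) : mT =i idl T^o xs -> primary m (map f xs).
Proof.
move=> em; split.
  move=> y /mapP[x xl ->]; apply: fm; rewrite em; exact: mem_idl_self.
have [|n hn] := lenle_fg (V := restrict f) (xs := xs) locT fgf; first by move=> x; rewrite em.
have hR : lenle (idl R^o (map f xs)) (full_submodule R^o) n.
  move=> k /chain_restrict_ideal; move: k; apply: lenle_mono hn => //.
  apply: idl_sub => x v xl; change (f x * v \in idl R^o (map f xs)).
  by apply: (mem_idlb (V := R^o)); exact: map_f.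
move=> a am; exists n; have := prod_mem (s := nseq n a) (q := 1) loc (@sub_full _ _ _) hR.
rewrite size_nseq big_nseq /GRing.scale /= mulr1.
rewrite (_ : iter n ( *%R a) 1 = a ^+ n); last by elim: n {hn hR} => //= n ->; rewrite exprS.
by apply=> // b /nseqP[->].
Qed.
End Finite.

(** * Finite extensions of regular local rings split *)

Section Splitting.
Variables (T R : comNzRingType) (f : {rmorphism T -> R}) (mT : ideal T) (m : ideal R).
Variables (d : nat) (M : nat -> lmodType R).
Hypotheses (regT : regular_local mT) (loc : local_noetherian m).
Hypothesis finj : injective f.
Hypothesis fgf : finitely_generated (restrict f).
Hypothesis fm : forall a, a \in mT -> f a \in m.
Hypothesis dimR : krull_dim R d.
Hypothesis lim : lim_CM m d M.

Lemma regular_summand : direct_summand_along (@restrict_map T R f).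
Proof.
have [locT _] := regT; have [noethT _ _] := locT; have [noethR _ _] := loc.
have [xs [dx em]] := regular_gens regT.
have xd : (size xs <= d)%N := finite_dim_le noethT noethR fgf finj dimR dx.
have px := primary_image locT loc fgf fm em.
have xm x : x \in xs -> x \in mT by move=> xl; rewrite em; exact: mem_idl_self.
have /finitely_generated_adjs[l hl] := fgf.
pose g (j : 'I_(size l)) := l`_j.
pose F1 : lmodType T := {ffun 'I_(size l) -> T^o}.
pose pi : F1 -> restrict f := lincomb g.
have lpi : linear pi := lincomb_linear g.
have pi_surj v : exists w, pi w = v := lincomb_surj v erefl hl.
have [e he] := pi_surj (1 : R).
pose Rel : submodClosed F1 := ker_pred (mk_linear lpi).
have [rel relR Rrel] := noeth_fg noethT Rel (fg_ffun T _).
(* A retraction is a solution [c] of the linear system [Psi c = b]: its first equation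
   says that [1] is sent to [1], the others that the relations between the generators
   [l] are respected. *)
pose row (i : 'I_(size rel).+1) : F1 := (e :: rel)`_i.
pose F : lmodType T := {ffun 'I_(size rel).+1 -> T^o}.
pose Psi (c : F1) : F := [ffun i => \sum_j row i j * c j : T^o].
have lPsi : linear Psi.
  move=> a u v; apply/ffunP => i; rewrite !ffunE scaler_sumr -big_split.
  by apply: eq_bigr => j _; rewrite !ffunE mulrDr /GRing.scale /= mulrCA.
pose b : F := basis_vec T ord0.
have [/imagemP[c _ ec]|bW0] := boolP (b \in imagem (mk_linear lPsi) (full_submodule F1)).
  have row_c i : \sum_j row i j * c j = (i == ord0)%:R :> T.
    by move/ffunP: ec => /(_ i); rewrite !ffunE.
  pose chi : F1 -> T^o := lincomb (fun j => c j : T^o).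
  have lchi : linear chi := lincomb_linear _.
  have chi_e : chi e = 1 by exact: (row_c ord0).
  have chi_rel w : pi w = 0 -> chi w = 0.
    move=> w0; have : w \in adjs (zero_submod F1) rel by apply: Rrel; apply/eqP.
    suff h : {subset adjs (zero_submod F1) rel <= (ker_pred (mk_linear lchi) : submodClosed F1)}.
      by move/h/eqP.
    apply: adjs_sub; first exact: zero_sub.
    move=> _ /(nthP 0)[i ir <-]; apply/eqP.
    by have := row_c (lift ord0 (Ordinal ir)).
  have pi_e v : pi (v *: e) = restrict_map f v.
    by rewrite (linZ lpi) he restrict_scaleE mulr1.
  split; first exact: finj.
  (* [chi] vanishes on all relations and so induces a retraction, whose kernel is the complement. *)
  exists (imagem (mk_linear lpi) (ker_pred (mk_linear lchi) : submodClosed F1)); split=> [w|v].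
    have [w' <-] := pi_surj w; exists (chi w'), (pi (w' - chi w' *: e)); split.
      apply: mem_imagem; apply/eqP; rewrite [LHS](linD lchi) (linN lchi) (linZ lchi) chi_e.
      by rewrite /GRing.scale /= mulr1 subrr.
    transitivity (pi (chi w' *: e) + pi (w' - chi w' *: e)); last by rewrite pi_e.
    by rewrite -(linD lpi) addrC subrK.
  case/imagemP=> w /eqP w0 ew; have /chi_rel : pi (w - v *: e) = 0.
    by rewrite (linD lpi) (linN lpi) pi_e [pi w]ew subrr.
  rewrite (linD lchi) (linN lchi) (linZ lchi) [chi w]w0 chi_e /GRing.scale /= mulr1 sub0r.
  by move/eqP; rewrite oppr_eq0 => /eqP ->; exact: linear0.
exfalso.
have [W [t [W0W bW mbW hW]]] := max_avoid_list locT (fg_ffun T _) xm bW0.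
have [|h hh sh] := lim_CM_homle lim px; first by rewrite size_map.
(* In R the generators [g] themselves solve the system, because [pi (row i)] is 1 for i = 0 and 0
   otherwise. Hence b (x) u is the sum of the Psi (e_j) (x) g_j u, which come from the image of
   [Psi]. *)
have bM n u : emb f b u \in @tmul T R f (M n) _ W.
  have -> : emb f b u = \sum_j emb f (Psi (basis_vec T j)) ((g j : R) *: u).
    apply/ffunP => i; rewrite sum_ffunE ffunE.
    have row_pi : pi (row i) = (i == ord0)%:R :> R.
      case: (unliftP ord0 i) => [i' ->|->]; last exact: he.
      rewrite -[RHS]/(0 : R); apply/eqP; apply: relR; apply: mem_nth.
      by rewrite /= (ltn_ord i').
    rewrite ffunE rmorph_nat -row_pi scaler_suml; apply: eq_bigr => j _.
    rewrite ffunE scalerA ffunE; congr (_ *: _).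
    rewrite (bigD1 j) //= big1 => [|j' jj]; rewrite ffunE; last by rewrite (negbTE jj) mulr0.
    by rewrite eqxx mulr1 addr0.
  by apply: submod_sum => j; apply: mem_tmul; apply/W0W/imagemP; exists (basis_vec T j).
have key n : (nu (M n) <= (size rel).+1 * size xs * t.+1 ^ size xs * h n)%N.
  have fx : finite_length (idl (M n) (map f xs)) (full_submodule (M n)).
    by apply: (fin_primary loc _ px); exact: lim_CM_fg lim n.
  apply: leq_trans (nu_le_len loc (lim_CM_fg lim n) px.1 (len_lenle fx)) _.
  (* Here the kernel K is all of M n, so L = 0 and only the Koszul error remains. *)
  have hL : lenle (full_submodule (M n)) (full_submodule (M n)) 0 by exact: lenle_refl.
  have := key_bound locT em fx (hh n) hW bW mbW hL (fun u _ => bM n u).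
  by rewrite add0n.
exact: (small_absurd (lim_CM_nu lim) key sh).
Qed.
End Splitting.

Local Open Scope quotient_scope.

(** * Rank *)

Section Primes.
Variable R : comNzRingType.

Definition of_prime (P : {pred R}) (h : is_prime P) : {pred R} := P.
HB.instance Definition _ (P : {pred R}) (h : is_prime P) := isIdealr.Build R (of_prime h) h.1.
HB.instance Definition _ (P : {pred R}) (h : is_prime P) :=
  isPrimeIdealrClosed.Build R (of_prime h) h.2.

Lemma prime_idealr_is_prime (p : prime_idealr R) : is_prime p.
Proof.
split; last exact: prime_idealr_closed_subproof.
split; [exact: idealr0|by rewrite idealr1|move=> a u v hu hv].
by apply: rpredD => //; exact: idealMr.
Qed.

Definition prime_chain (c : nat -> {pred R}) (k : nat) :=
  (forall i, (i <= k)%N -> is_prime (c i)) /\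
  (forall i, (i < k)%N -> {subset c i <= c i.+1} /\ ~ {subset c i.+1 <= c i}).

Lemma prime_chain_cons (p : {pred R}) c k : is_prime p -> prime_chain c k ->
  {subset p <= c 0%N} -> ~ {subset c 0%N <= p} ->
  prime_chain (fun i => if i is j.+1 then c j else p) k.+1.
Proof. by move=> hp [hc sc] h nh; split=> -[|i] //; [exact: hc|exact: sc]. Qed.

Lemma prime_chain_sub c k i : prime_chain c k -> (i <= k)%N -> {subset c 0%N <= c i}.
Proof.
move=> [_ sc]; elim: i => [|i IH] ik v; first by [].
by move/(IH (ltnW ik)); exact: (sc i ik).1.
Qed.

(* For [d] the dimension of [R], a prime [p] with [top d p] is minimal with
   [dim R / p = d]. *)
Definition top d (p : {pred R}) := exists2 c, prime_chain c d & {subset p <= c 0%N}.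

Variable d : nat.
Hypothesis dimR : krull_dim R d.

Lemma top_exists : exists2 p : {pred R}, is_prime p & top d p.
Proof.
have [[c hc] _] := dimR; exists (c 0%N); first by apply: hc.1.
by exists c.
Qed.

Lemma top_sub p q : is_prime q -> top d p -> {subset q <= p} -> {subset p <= q}.
Proof.
move=> hq [c hc pc] qp; apply: contrapT => npq.
have [_ /(_ d.+1) hd] := dimR; suff : (d.+1 <= d)%N by rewrite ltnn.
apply: hd.
exists (fun i => if i is j.+1 then c j else q); apply: prime_chain_cons => //.
  by move=> v /qp /pc.
by move=> h; apply: npq => v /pc /h.
Qed.

Lemma top_dim (p : prime_idealr R) : top d p -> krull_dim {ideal_quot p} d.
Proof.
move=> [c hc pc]; pose pi a : {ideal_quot p} := \pi_{ideal_quot p} a.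
have piP a b : pi a = pi b <-> a - b \in p.
  by split=> [/eqP|h]; [rewrite /pi piE Quotient.equivE|apply/eqP; rewrite /pi piE Quotient.equivE].
have piD a b : pi a + pi b = pi (a + b) by rewrite /pi piE.
have piM a b : pi a * pi b = pi (a * b) by rewrite /pi piE.
have pi1 : 1 = pi 1 by rewrite /pi piE.
have pi0 : 0 = pi 0 by rewrite /pi piE.
have reprK' (y : {ideal_quot p}) : pi (repr y) = y by exact: reprK.
(* Membership does not depend on the representative, since every [c i] contains p. *)
pose cb i : {pred {ideal_quot p}} := fun y => repr y \in c i.
have cbE i a : (i <= d)%N -> (pi a \in cb i) = (a \in c i).
  move=> id; have [[_ _ cD] _] := hc.1 i id.
  have pci v : v \in p -> v \in c i by move=> /pc; exact: prime_chain_sub hc id v.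
  have e : repr (pi a) - a \in p by apply/piP; rewrite reprK'.
  rewrite -[pi a \in cb i]/(repr (pi a) \in c i); apply/idP/idP => h.
    have -> : a = (-1) * (repr (pi a) - a) + repr (pi a) by rewrite mulN1r opprB subrK.
    by apply: cD => //; exact: pci.
  have -> : repr (pi a) = 1 * (repr (pi a) - a) + a by rewrite mul1r subrK.
  by apply: cD => //; exact: pci.
split=> [|k [b [hb sb]]].
  exists cb; split=> i id.
    have [[c0 c1 cD] cM] := hc.1 i id; split; first split.
    - by rewrite pi0 cbE.
    - by rewrite pi1 cbE.
    - move=> x y z; rewrite -[x]reprK' -[y]reprK' -[z]reprK' piM piD !cbE //; exact: cD.
    by move=> x y; rewrite -[x]reprK' -[y]reprK' piM !cbE //; exact: cM.
  have [h1 h2] := hc.2 i id; split.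
    by move=> x; rewrite -[x]reprK' !cbE ?(ltnW id) //; exact: h1.
  by move=> h; apply: h2 => a; rewrite -!cbE ?(ltnW id) //; exact: h.
have [_] := dimR; apply; pose B i : {pred R} := fun a => pi a \in b i.
have BE i a : (a \in B i) = (pi a \in b i) by [].
exists B; split=> i ik.
  have [[b0 b1 bD] bM] := hb i ik; split; first split.
  - by rewrite BE -pi0.
  - by rewrite BE -pi1.
  - by move=> x y z; rewrite !BE -piD -piM; exact: bD.
  by move=> x y; rewrite !BE -piM; exact: bM.
have [h1 h2] := sb i ik; split; first by move=> a; rewrite !BE; exact: h1.
by move=> h; apply: h2 => y; rewrite -[y]reprK' => /h.
Qed.

Lemma top_minimal (p : prime_idealr R) : top d p -> minimal_prime p.
Proof. by move=> tp q; apply: top_sub => //; exact: prime_idealr_is_prime. Qed.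
End Primes.

Section LocalizedLength.
Variables (R : comNzRingType) (q : prime_idealr R).
Local Notation Rq := (local_ring q).

Lemma frac_scale1 (V : lmodType R) (v : V) s :
  Defs.frac v s = (Defs.frac (1 : R^o) s : Rq) *: (Defs.frac v (denom1 q) : local_module q V).
Proof.
rewrite [RHS](local_scale_frac (1 : R^o) s v (denom1 q)); apply/Defs.frac_eqP.
by exists (denom1 q); rewrite /= !scale1r !mul1r mulr1.
Qed.

Lemma frac_add (V : lmodType R) (u v : V) :
  (Defs.frac u (denom1 q) : local_module q V) + Defs.frac v (denom1 q) =
  Defs.frac (u + v) (denom1 q).
Proof.
rewrite [LHS](local_add_frac u (denom1 q) v (denom1 q)); apply/Defs.frac_eqP; exists (denom1 q).
by rewrite /= !scale1r !mul1r !scale1r.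
Qed.

Lemma frac_scale (V : lmodType R) (a : R) (v : V) :
  (Defs.frac (a : R^o) (denom1 q) : Rq) *: (Defs.frac v (denom1 q) : local_module q V) =
  Defs.frac (a *: v) (denom1 q).
Proof.
rewrite [LHS](local_scale_frac (a : R^o) (denom1 q) v (denom1 q)); apply/Defs.frac_eqP.
by exists (denom1 q); rewrite /= !mul1r !scale1r.
Qed.

Lemma lenle_adj_any (S : comNzRingType) (W : lmodType S) (P : submodClosed W) b l :
  lenle (zero_submod S^o) (full_submodule S^o) l -> lenle P (adj P b) l.
Proof.
apply: (lenle_surj (f := scale_vec b)) => //.
  by move=> v; rewrite mem_zero => /eqP ->; rewrite linear0 rpred0.
by move=> w /adjP[a ha]; exists a.
Qed.

Lemma lenle_adjs_any (S : comNzRingType) (W : lmodType S) (P : submodClosed W) bs l :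
  lenle (zero_submod S^o) (full_submodule S^o) l -> lenle P (adjs P bs) (size bs * l).
Proof.
move=> hl; elim: bs => [|b bs IH] /=; first exact: lenle_refl.
rewrite mulSn addnC; apply: lenle_trans IH _; [exact: sub_adjs|exact: sub_adj|].
exact: lenle_adj_any.
Qed.

(** Generators of V also generate the localization, and each of them contributes at most the length
    of the local ring. *)
Lemma local_len_le (V : lmodType R) k l n : generated_by V k -> has_length (Rq^o : lmodType Rq) l ->
  has_length (local_module q V : lmodType Rq) n -> (n <= k * l)%N.
Proof.
move=> /generated_adjs[bs <- hbs] /has_length_lenle hl [/strict_chainP c _].
pose bq := [seq (Defs.frac b (denom1 q) : local_module q V) | b <- bs].
have hV v : Defs.frac v (denom1 q) \in adjs (zero_submod (local_module q V)) bq.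
  have : v \in adjs (zero_submod V) bs by exact: hbs.
  rewrite /bq; elim: bs {hbs bq} v => [|b bs IH] v /=.
    rewrite mem_zero => /eqP ->; exact: (rpred0 (zero_submod (local_module q V))).
  case/adjP=> a /IH h; apply/adjP; exists (Defs.frac (a : R^o) (denom1 q)).
  have -> // : Defs.frac v (denom1 q) -
      (Defs.frac (a : R^o) (denom1 q) : Rq) *: (Defs.frac b (denom1 q) : local_module q V) =
    Defs.frac (v - a *: b) (denom1 q).
  apply/eqP; rewrite subr_eq; apply/eqP.
  by rewrite frac_scale frac_add subrK.
have := lenle_adjs_any (P := zero_submod (local_module q V)) (bs := bq) hl.
rewrite size_map; apply; apply: chain_mono c _ => x _.
elim/Defs.frac_ind: x => v s; rewrite frac_scale1; apply: rpredZ; exact: hV.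
Qed.

Lemma local_len_gt0 l : has_length (Rq^o : lmodType Rq) l -> (0 < l)%N.
Proof.
move=> /has_length_lenle; apply.
apply: (chainS (chain0 (Q := zero_submod Rq^o) _)) => //.
by move=> /(_ 1 isT); rewrite mem_zero oner_eq0.
Qed.
End LocalizedLength.

Section Filtration.
Variables (R : comNzRingType) (V : lmodType R).
Hypothesis noethR : noetherian R.
Implicit Types (P Q : submodClosed V).

Definition ann_mod Q (b : V) : ideal R := preimm (scale_vec b) Q.

Lemma mem_ann Q b (a : R) : (a \in ann_mod Q b) = (a *: b \in Q).
Proof. by []. Qed.

Inductive prime_filtration P : submodClosed V -> seq (ideal R) -> Prop :=
| prime_filtration0 : prime_filtration P P [::]
| prime_filtrationS Q ps b : prime_filtration P Q ps -> is_prime (ann_mod Q b) ->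
    prime_filtration P (adj Q b) (ann_mod Q b :: ps).

Lemma prime_filtration_sub P Q ps : prime_filtration P Q ps -> {subset P <= Q}.
Proof. by elim=> // {}Q {}ps b _ h _ v /h; exact: sub_adj. Qed.

(** For Q maximal with a filtration and different from V, a maximal one among the annihilators of
    nonzero classes in V / Q is prime and would extend the filtration. *)
Lemma prime_filtration_exists P : finitely_generated V ->
  exists Q ps, prime_filtration P Q ps /\ {subset full_submodule V <= Q}.
Proof.
move=> fgV; have [|Q [[ps hQ] _ Qmax]] := max_submod noethR
  (F := fun Q => exists ps, prime_filtration P Q ps) (N0 := P) fgV.
  by exists [::]; exact: prime_filtration0.
exists Q, ps; split=> // v _; apply: contrapT => /negP vQ.
have [J [[b [bQ ->]] _ Jmax]] := max_submod noethR
  (F := fun J : ideal R => exists b, b \notin Q /\ J = ann_mod Q b) (fg_regular R)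
  (ex_intro _ v (conj vQ erefl)).
suff hp : is_prime (ann_mod Q b).
  have := Qmax (adj Q b) (ex_intro _ _ (prime_filtrationS hQ hp)) (@sub_adj _ _ _ _) b (mem_adj _ _).
  exact/negP.
split; first split.
- by rewrite mem_ann scale0r rpred0.
- by rewrite mem_ann scale1r.
- move=> a u w hu hw; change ((a * u + w) *: b \in Q); rewrite scalerDl -scalerA.
  by apply: rpredD => //; exact: rpredZ.
move=> u w; rewrite !mem_ann => huw; apply/orP; case: (boolP (u *: b \in Q)) => hu; [by left|right].
have := Jmax (ann_mod Q (u *: b)) (ex_intro _ _ (conj hu erefl)); apply.
  by move=> a; rewrite !mem_ann scaler_comm => ha; rewrite rpredZ.
by rewrite mem_ann scalerA mulrC.
Qed.

(** Multiplication of b by scalars maps R / (p + (l)) onto the factor, for p the annihilator of b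
    modulo Q. *)
Lemma lenle_idlb_adj Q b l n :
  lenle (idlb (ann_mod Q b : submodClosed R^o) l) (full_submodule R^o) n ->
  lenle (idlb Q l) (idlb (adj Q b) l) n.
Proof.
apply: (lenle_surj (f := scale_vec b)) => // [a|w].
  suff h : {subset idlb (ann_mod Q b : submodClosed R^o) l <=
      preimm (scale_vec b) (idlb Q l)} by move/h.
  apply: idlb_sub => [c|x c xl]; first by rewrite mem_ann => h; exact: (sub_idlb _ h).
  by change ((x * c) *: b \in idlb Q l); rewrite -scalerA; exact: mem_idlb.
suff h : {subset idlb (adj Q b) l <= adj (idlb Q l) b} by move=> /h /adjP[a ha]; exists a.
apply: idlb_sub => [v /adjP[a ha]|x v xl].
  by apply/adjP; exists a; exact: sub_idlb.
by apply: sub_adj; exact: mem_idlb.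
Qed.

Section Growth.
Variables (l : seq R) (k : nat) (c : ideal R -> nat).
Local Notation pows t l := (map (fun x : R => x ^+ t) l).

(* The length grows like [C t^(k-1) + e t^k]; the extra factor [t] avoids the
   exponent [k - 1] when [k = 0]. *)
Definition growth (W : lmodType R) (P Q : submodClosed W) e := exists C, forall t, exists2 N,
  lenle (idlb P (pows t.+1 l)) (idlb Q (pows t.+1 l)) N &
  (t.+1 * N <= C * t.+1 ^ k + e * (t.+1 * t.+1 ^ k))%N.

Lemma prime_filtration_growth P Q ps : prime_filtration P Q ps ->
  (forall p : ideal R, is_prime p -> (forall a, (forall v, a *: v \in P) -> a \in p) ->
     growth (p : submodClosed R^o) (full_submodule R^o) (c p)) ->
  growth P Q (\sum_(p <- ps) c p).
Proof.
move=> h hc; elim: h => [|{}Q {}ps b hQ [C hC] hp].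
  exists 0%N => t; exists 0%N; last by rewrite muln0.
  exact: lenle_refl.
have [|C' hC'] := hc (ann_mod Q b) hp.
  by move=> a ha; rewrite mem_ann; apply: (prime_filtration_sub hQ); exact: ha.
exists (C' + C)%N => t; have [N hN eN] := hC t; have [N' hN' eN'] := hC' t.
exists (N + N')%N.
  apply: lenle_trans hN _.
  - by apply: idlb_mono; exact: prime_filtration_sub hQ.
  - by apply: idlb_mono; exact: sub_adj.
  apply: lenle_idlb_adj; apply: lenle_mono hN' => // v _; exact: sub_idlb.
rewrite big_cons mulnDr !mulnDl; move: eN eN'.
set s := t.+1; set T := (s ^ k)%N; lia.
Qed.
End Growth.
End Filtration.

(** * Dimension and growth of lengths *)

Section Dimension.
Variables (R : comNzRingType) (m : ideal R).
Hypothesis loc : local_noetherian m.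
Local Notation full := (full_submodule R^o).

Lemma m_prime : is_prime m.
Proof.
have m1 := one_notin loc.
split.
  split=> [||a u v hu hv] //; [exact: rpred0|exact: (rpredD (ideal_mull a hu) hv)].
move=> u v huv; apply: contrapT => /negP; rewrite negb_or.
case/andP=> /(local_unit loc)[a au] /(local_unit loc)[b bv].
by move: m1; rewrite -(mulr1 1) -{1}au -bv mulrACA ideal_mull.
Qed.

(** The absence of chains says dim R / I < [size l]. A prime filtration of R / I reduces to primes
    p. If x lies in p, the shorter list already bounds the length, with one power of t fewer.
    Otherwise a chain above p + (x) could be extended by p, so induction applies to p + (x), and
    passing from x to x ^ t costs a factor t. *)
Lemma growth_dim (l : seq R) (I : ideal R) : finite_length (idlb (I : submodClosed R^o) l) full ->
  (forall c, prime_chain c (size l) -> ~ {subset I <= c 0%N}) ->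
  growth l (size l) (I : submodClosed R^o) full 0.
Proof.
have [noethR _ _] := loc.
elim: l I => [|x l IH] I fI noc.
  have I1 : 1 \in I.
    apply: contrapT => /negP I1; apply: (noc (fun=> m)).
      by split=> // i _; exact: m_prime.
    move=> a aI; apply: contrapT => /negP /(local_unit loc)[b ba].
    by move: I1; rewrite -ba ideal_mull.
  exists 0%N => t; exists 0%N; last by rewrite muln0.
  by apply: lenle_refl => a _; rewrite -[a]mulr1; exact: ideal_mull.
have [Q [ps [hQ fQ]]] := prime_filtration_exists noethR (I : submodClosed R^o) (fg_regular R).
have [|C hC] := prime_filtration_growth (l := x :: l) (k := (size l).+1) (c := fun=> 0%N) hQ; last first.
  exists C => t; have [N hN eN] := hC t; exists N; last by move: eN; rewrite big1_eq.
  by apply: lenle_mono hN => //; apply: idlb_mono => //; exact: fQ.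
move=> p hp Ip; have {}Ip : {subset I <= p}.
  by move=> a aI; apply: Ip => v; rewrite -[a *: v]/(a * v) mulrC; exact: ideal_mull.
have fp : finite_length (idlb (p : submodClosed R^o) (x :: l)) full.
  by apply: fin_mono fI => //; exact: idlb_mono.
case: (boolP (x \in p)) => xp.
  have [n hn] : finite_length (idlb (p : submodClosed R^o) l) full.
    apply: fin_mono fp => //; apply: addx_sub => // v; apply: sub_idlb.
    by rewrite -[x *: v]/(x * v) mulrC; exact: ideal_mull.
  exists n => t; exists (t.+1 ^ size l * n)%N.
    apply: lenle_mono (@lenle_idlb_pows _ _ _ _ t.+1 _ hn) => //; first exact: sub_addx.
    by move=> v _; apply: sub_idlb.
  by rewrite mul0n addn0 expnS [X in (_ <= X)%N]mulnC mulnA.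
have [||C hC] := IH (addx (p : submodClosed R^o) x).
- by apply: fin_mono fp => // v; rewrite -idlb_addx.
- move=> c hc pc; apply: (noc (fun i => if i is j.+1 then c j else p)).
    apply: prime_chain_cons => //; first by move=> a ap; apply/pc/sub_addx.
    move=> h; move: xp; rewrite h //; apply: pc.
    by have := mem_addx (p : submodClosed R^o) x (1 : R^o); rewrite -[x *: _]/(x * 1) mulr1.
  exact: Ip.
exists C => t; have [N hN eN] := hC t; exists (t.+1 * N)%N.
  have h1 : lenle (addx (idlb (p : submodClosed R^o) (map (fun x => x ^+ t.+1) l)) x) full N.
    apply: (lenle_eq (idlb_addx _ _ _)); apply: lenle_mono hN => // v vf; exact: sub_idlb.
  apply: lenle_mono (@lenle_addx_exp _ _ _ _ _ t.+1 h1) => // v _; exact: sub_idlb.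
move: eN; rewrite !mul0n !addn0 expnS => eN; rewrite [X in (_ <= X)%N]mulnCA.
by rewrite leq_mul2l eN orbT.
Qed.
End Dimension.

Section LocalizedFiltration.
Variables (R : comNzRingType) (V : lmodType R) (q : prime_idealr R).
Local Notation Vq := (local_module q V : lmodType (local_ring q)).
Implicit Types (Q : submodClosed V).

Definition loc_pred Q : {pred Vq} := fun x => `[< exists v s, v \in Q /\ x = Defs.frac v s >].
Lemma loc_closed Q : submod_closed (loc_pred Q).
Proof.
split; first by apply/asboolP; exists 0, (denom1 q); rewrite rpred0.
move=> a x y /asboolP[v [s [vQ ->]]] /asboolP[w [t [wQ ->]]]; apply/asboolP.
elim/Defs.frac_ind: a => c r.
exists (sval t *: (c *: v) + sval (denomM r s) *: w), (denomM (denomM r s) t); split.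
  by rewrite rpredD ?rpredZ.
by rewrite [X in X + _](local_scale_frac (c : R^o) r v s) [LHS]local_add_frac.
Qed.
Definition locm Q : submodClosed Vq := of_closed (loc_closed Q).

(** A factor R / q survives localization at q: if b / 1 were equal to v / s with v in Q, a product
    of two denominators would annihilate b modulo Q and thus lie in q. *)
Lemma prime_filtration_chain_loc P Q ps : prime_filtration P Q ps ->
  chain (zero_submod Vq) (locm Q) (count (fun p : ideal R => `[< p =i q >]) ps).
Proof.
elim=> [|{}Q {}ps b _ IH hp] /=; first by apply: chain0; exact: zero_sub.
have sQ : {subset locm Q <= locm (adj Q b)}.
  move=> x /asboolP[v [s [vQ ->]]]; apply/asboolP; exists v, s; split=> //; exact: sub_adj.
case: asboolP => [e|_]; last by rewrite add0n; exact: chain_mono IH sQ.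
rewrite add1n; apply: chainS IH sQ _ => h.
have /h/asboolP[v [s [vQ /Defs.frac_eqP[u eu]]]] : Defs.frac b (denom1 q) \in locm (adj Q b).
  by apply/asboolP; exists b, (denom1 q); split=> //; exact: mem_adj.
have : sval u * sval s \in q by rewrite -e mem_ann eu rpredZ.
by rewrite prime_idealrM (negbTE (svalP u)) (negbTE (svalP s)).
Qed.

Lemma count_loc P Q ps n : prime_filtration P Q ps -> has_length Vq n ->
  (count (fun p : ideal R => `[< p =i q >]) ps <= n)%N.
Proof. by move=> /prime_filtration_chain_loc c /has_length_lenle; apply; exact: chain_mono c _. Qed.
End LocalizedFiltration.

Section Rank.
Variables (R : comNzRingType) (m : ideal R) (d : nat).
Hypothesis loc : local_noetherian m.
Hypothesis dimR : krull_dim R d.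
Local Notation pows t l := (map (fun x : R => x ^+ t) l).

(** If no prime of the filtration were inside p, choosing from each an element outside p would give
    a product outside p that kills R. *)
Lemma prime_contains Q ps (p : {pred R}) : prime_filtration (zero_submod R^o) Q ps ->
  {subset full_submodule R^o <= Q} -> is_prime p ->
  has (fun q : ideal R => `[< is_prime q /\ {subset q <= p} >]) ps.
Proof.
move=> hQ fQ [[p0 p1 pD] pM]; apply: contrapT => /negP nh.
have [s [sp sQ]] : exists s, s \notin p /\ forall v, v \in Q -> s * v = 0.
  elim: hQ nh {fQ} => [_|{}Q {}ps b _ IH hp] /=.
    by exists 1; split=> // v; rewrite mem_zero => /eqP ->; rewrite mulr0.
  rewrite negb_or => /andP[/asboolPn nqp /IH[s [sp sQ]]].
  have [a aq ap] : exists2 a, a \in ann_mod Q b & a \notin p.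
    apply: contrapT => h; apply: nqp; split=> // a aq; apply: contrapT => /negP ap.
    by apply: h; exists a.
  exists (s * a); split.
    by apply/negP => /pM; rewrite (negbTE sp) (negbTE ap).
  move=> v /adjP[c /sQ hc]; have /sQ hab : a * b \in Q by exact: aq.
  have -> : s * a * v = a * (s * (v - c * b)) + c * (s * (a * b)) by ring.
  by rewrite [s * (v - c * b)]hc hab !mulr0 addr0.
by move: sp; rewrite -[s]mulr1 sQ ?p0 //; exact: fQ.
Qed.

Lemma top_eqi (p q : ideal R) : p =i q -> top d p -> top d q.
Proof. by move=> e [c hc pc]; exists c => // a; rewrite -e; exact: pc. Qed.

(* [0] when [q] is not prime. *)
Definition loc_len (q : ideal R) : nat := if pselect (@is_prime R q) is left h
  then len (zero_submod (local_ring (of_prime h))^o) (full_submodule (local_ring (of_prime h))^o)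
  else 0%N.

Lemma has_rank_top (V : lmodType R) r (q : ideal R) : has_rank V r -> is_prime q -> top d q ->
  forall P Q ps, prime_filtration (V := V) P Q ps ->
  (count (fun p : ideal R => `[< p =i q >]) ps <= r * loc_len q)%N.
Proof.
move=> hr hq tq P Q ps hQ; rewrite /loc_len; case: pselect => // h.
have tq' : top d (of_prime h) by [].
have [l [hl hVl]] := hr d (of_prime h) dimR (top_minimal dimR tq') (top_dim dimR tq').
apply: leq_trans (count_loc hQ hVl) _; rewrite leq_mul2l; apply/orP; right.
have [/strict_chainP c _] := hl.
by apply: (len_lenle (lenle_fin (has_length_lenle hl)) c).
Qed.

(** Every top prime occurs in one fixed prime filtration of R, by [prime_contains] and minimality.
    So there are finitely many, and L is the sum of the lengths of R localized at primes of that
    filtration; at each of them the rank bounds the multiplicity. *)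
Lemma count_top_bound : exists L, forall (V : lmodType R) r, has_rank V r ->
  forall P Q ps, prime_filtration (V := V) P Q ps -> (count (fun p : ideal R => `[< top d p >]) ps <= L * r)%N.
Proof.
have [noethR _ _] := loc.
have [Q0 [ps0 [hQ0 fQ0]]] := prime_filtration_exists noethR (zero_submod R^o) (fg_regular R).
pose good (q : ideal R) := `[< is_prime q /\ top d q >].
exists (\sum_(q <- ps0) loc_len q)%N => V r hr P Q ps hQ.
apply: (@leq_trans (\sum_(q <- ps0 | good q)
  count (fun p : ideal R => `[< p =i q >]) ps)); last first.
  rewrite big_distrl /= [X in (_ <= X)%N](bigID good) /=.
  apply: leq_trans (leq_addr _ _); apply: leq_sum => q /asboolP[hq tq].
  by rewrite mulnC; exact: has_rank_top hr hq tq _ _ _ hQ.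
elim: hQ => [|{}Q {}ps b _ IH hp] //=.
rewrite big_split /=; apply: leq_add => //; case: asboolP => // tp.
have : has (fun q : ideal R => good q && `[< ann_mod Q b =i q >]) ps0.
  have := prime_contains hQ0 fQ0 hp; apply: sub_has => q /asboolP[hq qp].
  have e : ann_mod Q b =i q by move=> a; apply/idP/idP; [exact: (top_sub dimR hq tp qp)|exact: qp].
  by apply/andP; split; apply/asboolP => //; split=> //; exact: top_eqi tp.
elim: (ps0) => //= q qs IHq; rewrite big_cons; case/orP => [/andP[-> ->]//|/IHq h].
by case: ifP => // _; exact: leq_trans h (leq_addl _ _).
Qed.

Lemma nu_rank (V : lmodType R) Q ps (xs : seq R) h : finitely_generated V ->
  primary m xs -> size xs = d -> homle (kosM V xs) 1 h ->
  prime_filtration (zero_submod V) Q ps -> {subset full_submodule V <= Q} ->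
  (nu V <= count (fun p : ideal R => `[< top d p >]) ps *
           len (idl R^o xs) (full_submodule R^o) + d * h)%N.
Proof.
move=> fg px sx hh hQ fQ; set L0 := len _ _.
have fR := fin_primary loc (fg_regular R) px.
have fV := fin_primary loc fg px.
(* For a top prime, R / (p + (xs)) has length at most L0, which gives t^d L0 for the t-th powers;
   the other primes fall under [growth_dim] and contribute nothing of order t^d. *)
pose c (p : ideal R) := if `[< top d p >] then L0 else 0%N.
have [|C hC] := prime_filtration_growth (l := xs) (k := d) (c := c) hQ.
  move=> p hp _.
  have fp : finite_length (idlb (p : submodClosed R^o) xs) (full_submodule R^o).
    apply: fin_mono fR => //; apply: idlb_mono; exact: zero_sub.
  rewrite /c; case: asboolP => tp; last first.
    by rewrite -sx; apply: (growth_dim loc fp) => c' hc' pc; apply: tp; exists c'; rewrite // -sx.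
  have h0 : lenle (idlb (p : submodClosed R^o) xs) (full_submodule R^o) L0.
    apply: lenle_mono (len_lenle fR) => //; apply: idlb_mono; exact: zero_sub.
  exists 0%N => t; exists (t.+1 ^ d * L0)%N; last by rewrite mul0n add0n mulnA mulnC.
  rewrite -sx; apply: lenle_mono (@lenle_idlb_pows _ _ _ _ t.+1 _ h0) => // v _.
  exact: sub_idlb.
have -> : (count (fun p : ideal R => `[< top d p >]) ps * L0 = \sum_(p <- ps) c p)%N.
  elim: (ps) => [|p s IH] /=; first by rewrite big_nil.
  by rewrite big_cons mulnDl IH /c; case: ifP => _; rewrite ?mul1n ?mul0n.
set S := (\sum_(p <- ps) c p)%N.
(* The inequality holds for all exponents [t]; taking [t = C.+1] suffices because
   [C < C.+1] and all other terms are multiples of [t]. *)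
have [N hN eN] := hC C.
have hN' : lenle (idl V (pows C.+1 xs)) (full_submodule V) N.
  apply: lenle_mono hN => //; first by move=> v _; apply: sub_idlb; exact: fQ.
have := @len_pows R V C xs [::] h; rewrite !cats0 => /(_ (lenle_fin hN') hh).
have lN := len_leq hN'; have nuL := nu_le_len loc fg px.1 (len_lenle fV).
rewrite sx => e1; have {e1} e1 := leq_trans e1 (leq_add lN (leqnn _)).
have {e1} e1 := leq_trans (leq_mul (leqnn (C.+1 ^ d)%N) nuL) e1.
have T0 : (0 < C.+1 ^ d)%N by rewrite expn_gt0.
move: e1 eN T0; rewrite -/S; move: (nu V) (C.+1 ^ d)%N => n T e1 eN T0.
have e2 : (C.+1 * n <= C + C.+1 * (S + d * h))%N.
  rewrite -(leq_pmul2l T0).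
  have := leq_mul (leqnn C.+1) e1; rewrite mulnDr => e3.
  have := leq_trans e3 (leq_add eN (leqnn _)); nia.
rewrite leqNgt; apply/negP => e3; have := leq_mul (leqnn C.+1) e3; nia.
Qed.

Lemma rank_has_rank (V : lmodType R) : rank_defined V -> has_rank V (Defs.rank V).
Proof.
move=> [r hr].
exact: (@xgetPex _ 0%N [set r | has_rank V r]%classic (ex_intro _ r hr)).
Qed.

(** At a top prime both sides are compared after multiplication by the positive length of the local
    ring. The default value 0 of an undefined rank also satisfies the inequality. *)
Lemma rank_le_nu (V : lmodType R) : finitely_generated V -> (Defs.rank V <= nu V)%N.
Proof.
move=> fg; rewrite /Defs.rank; case: xgetP => // r _ hr.
have [p hp tp] := top_exists dimR; have tp' : top d (of_prime hp) by [].
have [l [hl hV]] := hr d (of_prime hp) dimR (top_minimal dimR tp') (top_dim dimR tp').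
have := local_len_le (nuP fg).1 hl hV.
by rewrite leq_pmul2r // (local_len_gt0 hl).
Qed.

Variable M : nat -> lmodType R.
Hypothesis lim : lim_CM m d M.

Lemma small_nu_rank g : (forall n, rank_defined (M n)) ->
  little_o (fun n => nu (M n)) g -> little_o (fun n => Defs.rank (M n)) g.
Proof.
move=> rk sg; have [noethR _ _] := loc; have [x [sx _]] := lim.2.
have px := sop_primary sx.
have [|h hh sh] := lim_CM_homle lim px; first by rewrite size_kseq.
have [L hL] := count_top_bound.
pose K := (L * len (idl R^o (kseq x)) (full_submodule R^o))%N.
have key n : (nu (M n) <= K * Defs.rank (M n) + d * h n)%N.
  have [Q [ps [hQ fQ]]] := prime_filtration_exists noethR (zero_submod (M n)) (lim_CM_fg lim n).
  apply: leq_trans (nu_rank (lim_CM_fg lim n) px (size_kseq x) (hh n) hQ fQ) _.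
  rewrite leq_add2r /K mulnAC leq_mul2r; apply/orP; right.
  exact: hL (rank_has_rank (rk n)) _ _ _ hQ.
move=> eps e0.
have half : 0 < 1 / 2%:R :> rat by [].
have [n1 h1] := smallM d sh half.
(* Once d h <= nu / 2, the inequality [key] gives nu <= 2 K rank; the summand 1 keeps the divisor of
   eps positive when K = 0. *)
have K0 : 0 < (2 * K + 1)%:R :> rat by rewrite ltr0n addn1.
have [n2 h2] := sg _ (divr_gt0 e0 K0).
exists (maxn n1 n2) => n; rewrite geq_max => /andP[/h1 {}h1 /h2 {}h2].
apply: le_trans h2 _; rewrite -mulrA ler_pM2l // ler_pdivrMl //.
have := key n; rewrite -(ler_nat rat) natrD natrM.
set r : rat := (Defs.rank (M n))%:R; have r0 : 0 <= r by rewrite ler0n.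
have KK0 : 0 <= K%:R :> rat by rewrite ler0n.
rewrite natrD natrM => e; nra.
Qed.
End Rank.

Theorem corollary8p5 (R : comNzRingType) (m : ideal R) (d : nat)
    (M : nat -> lmodType R) :
  local_noetherian m -> krull_dim R d -> lim_CM m d M ->
  [/\ forall alpha : nat -> nat,
        (alpha = (fun n => nu (M n))) \/
        ((forall n, rank_defined (M n)) /\ alpha = (fun n => rank (M n))) ->
        forall x : 'I_d -> R, sop m x -> forall t : nat, (1 <= t)%N ->
        let It := ideal_gen (fun i => x i ^+ t) in
        let y := (\prod_i x i) ^+ (t - 1) in
        [/\ forall r : R, r * y \in ideal_M_closure m M alpha It ->
              r \in ideal_M_closure m M alpha (ideal_gen x),
            {subset ideal_M_closure m M alpha (ideal_gen x) <= m} &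
            y \notin ideal_M_closure m M alpha It],
      forall (T : comNzRingType) (mT : ideal T) (f : {rmorphism T -> R}),
        regular_local mT -> injective f ->
        finitely_generated (restrict f) ->
        (forall a : T, a \in mT -> f a \in m) ->
        direct_summand_along (@restrict_map T R f) &
      regular_local m ->
        forall B : lmodType R, finitely_generated B ->
        forall A : submodClosed B,
          M_closure m M (fun n => nu (M n)) A =i A /\
          M_closure m M (fun n => rank (M n)) A =i A].
Proof.
move=> loc dimR lim; split.
- move=> alpha halpha x sx t t1 It y.
  (* The first property turns smallness against alpha into a contradiction with nu; the second makes
     the Koszul errors, which are o(nu), small against alpha. *)
  have [alpha_nu nu_alpha] : (forall n, (alpha n <= nu (M n))%N) /\
      (forall g, little_o (fun n => nu (M n)) g -> little_o alpha g).
    case: halpha => [->|[rk ->]]; first by split.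
    split=> [n|g sg]; first exact: (rank_le_nu dimR (lim_CM_fg lim n)).
    exact: (small_nu_rank loc dimR lim rk sg).
  split.
  + move=> r; exact: (closure_colon loc lim nu_alpha sx t1).
  + exact: (closure_sub_m loc lim alpha_nu sx).
  + exact: (closure_notin loc lim alpha_nu nu_alpha sx t1).
- move=> T mT f regT finj fgf fm.
  exact: (regular_summand regT loc finj fgf fm dimR lim).
(* Only alpha <= nu enters: a smaller alpha makes the closure smaller. *)
- move=> regR B fgB A; split.
    exact: (regular_closure lim regR dimR (fun n => leqnn _) A fgB).
  exact: (regular_closure lim regR dimR (fun n => rank_le_nu dimR (lim_CM_fg lim n)) A fgB).
Qed.
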